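(* Let $c,h\in\mathbb{C}$ and $k\ge2$. If $M(c,h)=L(c,h)$ and $W(c,h,k)=\mathfrak L_0(U(c,h,k))$ is the $V_{Vir}(c,0)$-module induced from the $A_0(V_{Vir}(c,0))$-module $U(c,h,k)=\mathbb{C}[x]/((x-h)^k)$, then $$\mathrm{pstr}_{W(c,h,k)}(\mathbf 1_{c,0},\tau)=q^{(1-c)/24+h}\frac1{(k-1)!}(\log q)^{k-1}\eta(q)^{-1}=\frac1{(k-1)!}(\log q)^{k-1}Z_{M(c,h)}(\mathbf 1_{c,0},\tau),$$ and this graded pseudo-trace satisfies the logarithmic derivative property $$\mathrm{pstr}_{W(c,h,k)}(\omega,\tau)=q^{-c/24}\frac1{2\pi i}\frac{d}{d\tau}q^{c/24}\mathrm{pstr}_{W(c,h,k)}(\mathbf 1_{c,0},\tau)=q^{-c/24}q\frac{d}{dq}q^{c/24}\mathrm{pstr}_{W(c,h,k)}(\mathbf 1_{c,0},\tau),$$ where $$\mathrm{pstr}_{W(c,h,k)}(\omega,\tau)=q^{h-c/24}\sum_{\ell\in\mathbb{Z}_{\ge0}}\mathfrak p(\ell)q^\ell\Big(\frac{\ell+h}{(k-1)!}(\log q)^{k-1}+\frac1{(k-2)!}(\log q)^{k-2}\Big)$$ $$=q^{h-c/24}\frac1{(k-2)!}(\log q)^{k-2}\Big(\frac{\log q}{k-1}\Big(\sum_{\ell\in\mathbb{Z}_{\ge0}}(\ell+h)\mathfrak p(\ell)q^\ell\Big)+q^{1/24}\eta(q)^{-1}\Big).$$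
   Context: $\mathcal L$ is the Virasoro algebra, basis $L_n$ ($n\in\mathbb{Z}$), $\mathbf c$ central, $[L_m,L_n]=(m-n)L_{m+n}+\frac{m^3-m}{12}\delta_{m+n,0}\mathbf c$. $M(c,h)$ is the Verma module generated by $\mathbf 1_{c,h}$ ($L_0=h$, $\mathbf c=c$, $L_n\mathbf 1_{c,h}=0$ for $n>0$), and $L(c,h)$ its irreducible quotient. $V_{Vir}(c,0)=M(c,0)/\langle L_{-1}\mathbf 1_{c,0}\rangle$ is the universal Virasoro vertex operator algebra with vacuum $\mathbf 1_{c,0}$, conformal vector $\omega=L_{-2}\mathbf 1_{c,0}$, $o(\omega)=L_0$; its level zero Zhu algebra is $\mathbb{C}[x]$, $x$ the class of $\omega$. $U(c,h,k)$ has Jordan basis $u_1,\dots,u_k$: $L_0u_1=hu_1$, $L_0u_j=hu_j+u_{j-1}$. $M(c,h,k)$ is the $\mathcal L$-module induced from $U(c,h,k)$ ($L_n=0$ for $n>0$ on $U(c,h,k)$, $L_0=x$, $\mathbf c=c$), $J(c,h,k)$ the submodule of all $v$ with $yv$ having zero degree-zero component for all $y\in\mathcal U(\mathcal L)$, and $\mathfrak L_0(U(c,h,k))=M(c,h,k)/J(c,h,k)$, graded by degree with $W(\ell)=W_{h+\ell}$ the generalized $L_0$-eigenspace of weight $h+\ell$. $\mathfrak p(\ell)$ is the number of partitions of $\ell$; $\eta(q)=q^{1/24}\prod_{j\ge1}(1-q^j)$; $Z_{M(c,h)}(\mathbf 1_{c,0},\tau)=q^{-c/24}\sum_\ell\dim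 M(c,h)(\ell)\,q^{\ell+h}$; $q=e^{2\pi i\tau}$, $\log q=2\pi i\tau$. Graded pseudo-trace: when $M(c,h)=L(c,h)$, $W=W(c,h,k)$ is strongly interlocked, i.e. its nontrivial proper submodules are finite in number, indecomposable, and form a chain $0=W^{(0)}\subset W^{(1)}\subset\cdots\subset W^{(k)}=W$ with $W^{(j+1)}/W^{(j)}\cong W^{(1)}=Soc(W)$ and $W/W^{(j)}\cong W^{(k-j)}$. In suitable (strongly interlocked) bases of the weight spaces $W_\mu$, weight-preserving operators $\sigma$ coming from the module structure (such as zero modes $o(v)=v_{\mathrm{wt}\,v-1}$ and powers of the nilpotent part $L_0^N$ of $L_0$) have $k\times k$ block upper triangular matrices with blocks of size $\dim Soc(W)_\mu$, all diagonal blocks equal to $\sigma|_{Soc(W)_\mu}$, first block row $(A,C_1,\dots,C_{k-2},B)$ and last block column $(B,C_{k-2},\dots,C_1,A)^T$; $\mathrm{pstr}(\sigma|_{W_\mu})=\mathrm{tr}(B)$. The pseudo-trace is computed in bases $\{b_1u_1,\dots,b_pu_1,b_1u_2,\dots,b_pu_k\}$ of $W(\ell)$, where $b_1,\dots,b_p$ is a PBW basis of the degree $\ell$ part of $\mathcal U(\mathrm{span}\{L_n:n<0\})$ and $u_1,\dots,u_k$ is the Jordan basis of $U(c,h,k)$ with $L_0u_1=hu_1$ and $L_0u_j=hu_j+u_{j-1}$ for $2\le j\le k$, so that $L_0^N|_{W(\ell)}$ has ones on the $p$th superdiagonal and zeros elsewhere. Then $$\mathrm{pstr}_W(v,\tau)=\sum_\mu\sum_{j\ge0}\mathrm{pstr}\big(o(v)|_{W_\mu}\tfrac1{j!}(L_0^N)_\mu^j\big)(\log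 q)^jq^{\mu-c/24}.$$ For irreducible $W$ (i.e. $k=1$) the graded pseudo-trace is defined to be zero. *)

(* Defs.v *)
From HB Require Import structures.
From mathcomp Require Import all_boot all_order all_algebra.
From mathcomp Require Import generic_quotient ring_quotient.
From mathcomp Require Import complex.
From mathcomp Require Import all_classical all_reals all_analysis.

Set Implicit Arguments.
Unset Strict Implicit.
Unset Printing Implicit Defensive.

Import Order.TTheory GRing.Theory Num.Theory.
Import numFieldNormedType.Exports.
Local Open Scope classical_set_scope.
Local Open Scope ring_scope.

Section Submodules.
Variables (A : nzRingType) (V : lmodType A).

Definition is_submod (S : set V) : Prop :=
  S 0 /\ forall (a : A) (u v : V), S u -> S v -> S (a *: u + v).

Record submodule := Submodule { smset :> set V; smP : is_submod smset }.

Definition smpred (S : submodule) : pred V := fun v => `[< smset S v >].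

Lemma smpred_zmod_closed (S : submodule) : zmod_closed (smpred S).
Proof.
have [S0 SD] := smP S; split=> [|u v /asboolP Su /asboolP Sv]; apply/asboolP => //.
by rewrite -scaleN1r addrC; exact: SD.
Qed.

HB.instance Definition _ (S : submodule) :=
  GRing.isZmodClosed.Build V (smpred S) (smpred_zmod_closed S).

Definition smzmod (S : submodule) : zmodClosed V :=
  GRing.ZmodClosed.clone V (smpred S) _.

Definition generated_set (G : set V) : set V :=
  [set v | forall S : set V, is_submod S -> G `<=` S -> S v].

Lemma generated_submod (G : set V) : is_submod (generated_set G).
Proof.
split=> [S [S0 _] _ //|a u v Gu Gv S Ssub GS].
by apply: Ssub.2; [exact: Gu|exact: Gv].
Qed.

Definition generated (G : set V) : submodule := Submodule (generated_submod G).

End Submodules.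

Definition quotmod (A : nzRingType) (V : lmodType A) (S : submodule V) : Type :=
  Quotient.quot (smzmod S).

Section QuotMod.
Local Open Scope quotient_scope.
Variables (A : nzRingType) (V : lmodType A) (S : submodule V).
Local Notation Q := (quotmod S).

HB.instance Definition _ := GRing.Zmodule.on Q.

Definition projmod (v : V) : Q := \pi_(Quotient.quot (smzmod S)) v.

Lemma projmod_is_zmod_morphism : zmod_morphism projmod.
Proof. by move=> u v; rewrite /projmod raddfB. Qed.

HB.instance Definition _ :=
  GRing.isZmodMorphism.Build V Q projmod projmod_is_zmod_morphism.

Lemma projmod_repr (x : Q) : projmod (repr (x : Quotient.quot (smzmod S))) = x.
Proof. exact: reprK. Qed.

Lemma eq_projmod (u v : V) : projmod u = projmod v <-> smset S (u - v).
Proof.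
have E := Quotient.idealrBE (smzmod S) u v.
split=> [H|H].
  by apply/asboolP; have -> : `[< smset S (u - v) >] = (u - v \in smpred S) by [];
     rewrite E; apply/eqP.
by apply/eqP; rewrite -E; apply/asboolP.
Qed.

Definition quot_scale (a : A) (x : Q) : Q :=
  projmod (a *: repr (x : Quotient.quot (smzmod S))).

Lemma projmodZ a v : quot_scale a (projmod v) = projmod (a *: v).
Proof.
apply/eq_projmod; rewrite -scalerBr.
have /eq_projmod H := projmod_repr (projmod v).
by rewrite -[_ *: _]addr0; apply: (smP S).2 => //; exact: (smP S).1.
Qed.

Lemma quot_scaleA a b x : quot_scale a (quot_scale b x) = quot_scale (a * b) x.
Proof. by rewrite -[x]projmod_repr !projmodZ scalerA. Qed.

Lemma quot_scale1 : left_id 1 quot_scale.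
Proof. by move=> x; rewrite -[x]projmod_repr projmodZ scale1r. Qed.

Lemma quot_scaleDr : right_distributive quot_scale +%R.
Proof.
move=> a x y; rewrite -[x]projmod_repr -[y]projmod_repr -raddfD !projmodZ.
by rewrite scalerDr raddfD.
Qed.

Lemma quot_scaleDl x : {morph quot_scale^~ x : a b / a + b}.
Proof. by move=> a b; rewrite -[x]projmod_repr !projmodZ scalerDl raddfD. Qed.

HB.instance Definition _ := GRing.Zmodule_isLmodule.Build A Q
  quot_scaleA quot_scale1 quot_scaleDr quot_scaleDl.

Lemma projmod_is_scalable : scalable projmod.
Proof. by move=> a v; rewrite -projmodZ. Qed.

HB.instance Definition _ :=
  GRing.isScalable.Build A V Q *:%R projmod projmod_is_scalable.

End QuotMod.

(* U(L) is the unital associative K-algebra presented by the generators L_n and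
   c and the relations xy - yx = [x, y]: noncommutative polynomial expressions
   modulo the congruence generated by the algebra axioms and the Virasoro
   brackets. *)

Section Enveloping.
Variable K : numClosedFieldType.

Inductive vterm : Type :=
| VL of int
| VC
| Vconst of K
| Vadd of vterm & vterm
| Vopp of vterm
| Vmul of vterm & vterm.

Inductive veq : vterm -> vterm -> Prop :=
| veq_refl x : veq x x
| veq_sym x y : veq x y -> veq y x
| veq_trans x y z : veq x y -> veq y z -> veq x z
| veq_add x x' y y' : veq x x' -> veq y y' -> veq (Vadd x y) (Vadd x' y')
| veq_opp x x' : veq x x' -> veq (Vopp x) (Vopp x')
| veq_mul x x' y y' : veq x x' -> veq y y' -> veq (Vmul x y) (Vmul x' y')
| veq_addA x y z : veq (Vadd x (Vadd y z)) (Vadd (Vadd x y) z)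
| veq_addC x y : veq (Vadd x y) (Vadd y x)
| veq_add0 x : veq (Vadd (Vconst 0) x) x
| veq_addN x : veq (Vadd (Vopp x) x) (Vconst 0)
| veq_mulA x y z : veq (Vmul x (Vmul y z)) (Vmul (Vmul x y) z)
| veq_mul1l x : veq (Vmul (Vconst 1) x) x
| veq_mul1r x : veq (Vmul x (Vconst 1)) x
| veq_mulDl x y z : veq (Vmul (Vadd x y) z) (Vadd (Vmul x z) (Vmul y z))
| veq_mulDr x y z : veq (Vmul x (Vadd y z)) (Vadd (Vmul x y) (Vmul x z))
| veq_constD a b : veq (Vconst (a + b)) (Vadd (Vconst a) (Vconst b))
| veq_constM a b : veq (Vconst (a * b)) (Vmul (Vconst a) (Vconst b))
| veq_constC a x : veq (Vmul (Vconst a) x) (Vmul x (Vconst a))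
| veq_centralL n : veq (Vmul VC (VL n)) (Vmul (VL n) VC)
| veq_vir m n :
    veq (Vadd (Vmul (VL m) (VL n)) (Vopp (Vmul (VL n) (VL m))))
        (Vadd (Vmul (Vconst (m - n)%:~R) (VL (m + n)))
              (Vmul (Vconst (if m + n == 0 then (m ^+ 3 - m)%:~R / 12 else 0))
                    VC)).

HB.instance Definition _ := gen_eqMixin vterm.
HB.instance Definition _ := gen_choiceMixin vterm.

Definition veqb (x y : vterm) : bool := `[< veq x y >].

Lemma veqb_equiv : equiv_class_of veqb.
Proof.
split=> [x|x y|y x z].
- exact/asboolP/veq_refl.
- by apply/asboolP/asboolP; exact: veq_sym.
- by move=> /asboolP xy /asboolP yz; apply/asboolP; exact: veq_trans yz.
Qed.

Canonical veqb_equivRel := EquivRelPack veqb_equiv.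
Canonical veqb_encModRel := defaultEncModRel veqb.

Definition Uvir : Type := {eq_quot veqb}%qT.

HB.instance Definition _ := Choice.on Uvir.

Section Instances.
Local Open Scope quotient_scope.

Definition Upi (t : vterm) : Uvir := \pi_({eq_quot veqb}) t.
Definition Urep (x : Uvir) : vterm := repr (x : {eq_quot veqb}).

Lemma UrepK x : Upi (Urep x) = x. Proof. exact: reprK. Qed.

Lemma Upi_eq t u : Upi t = Upi u <-> veq t u.
Proof.
split=> [H|H]; last by apply/eqmodP; exact/asboolP.
by have /eqmodP/asboolP := H.
Qed.

Lemma Urep_pi t : veq (Urep (Upi t)) t.
Proof. by apply/Upi_eq; rewrite UrepK. Qed.

Definition Uadd (x y : Uvir) := Upi (Vadd (Urep x) (Urep y)).
Definition Uopp (x : Uvir) := Upi (Vopp (Urep x)).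
Definition Umul (x y : Uvir) := Upi (Vmul (Urep x) (Urep y)).
Definition Uscale (a : K) (x : Uvir) := Upi (Vmul (Vconst a) (Urep x)).

Lemma UaddE s t : Uadd (Upi s) (Upi t) = Upi (Vadd s t).
Proof. by apply/Upi_eq/veq_add; exact: Urep_pi. Qed.
Lemma UoppE t : Uopp (Upi t) = Upi (Vopp t).
Proof. by apply/Upi_eq/veq_opp; exact: Urep_pi. Qed.
Lemma UmulE s t : Umul (Upi s) (Upi t) = Upi (Vmul s t).
Proof. by apply/Upi_eq/veq_mul; exact: Urep_pi. Qed.
Lemma UscaleE a t : Uscale a (Upi t) = Upi (Vmul (Vconst a) t).
Proof. by apply/Upi_eq/veq_mul; [exact: veq_refl|exact: Urep_pi]. Qed.

Let UE := (UaddE, UoppE, UmulE, UscaleE).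

Lemma UaddA : associative Uadd.
Proof.
move=> x y z; rewrite -[x]UrepK -[y]UrepK -[z]UrepK !UE.
exact/Upi_eq/veq_addA.
Qed.
Lemma UaddC : commutative Uadd.
Proof. by move=> x y; rewrite -[x]UrepK -[y]UrepK !UE; exact/Upi_eq/veq_addC. Qed.
Lemma Uadd0 : left_id (Upi (Vconst 0)) Uadd.
Proof. by move=> x; rewrite -[x]UrepK !UE; exact/Upi_eq/veq_add0. Qed.
Lemma UaddN : left_inverse (Upi (Vconst 0)) Uopp Uadd.
Proof. by move=> x; rewrite -[x]UrepK !UE; exact/Upi_eq/veq_addN. Qed.

HB.instance Definition _ := GRing.isZmodule.Build Uvir UaddA UaddC Uadd0 UaddN.

Lemma UmulA : associative Umul.
Proof.
move=> x y z; rewrite -[x]UrepK -[y]UrepK -[z]UrepK !UE.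
exact/Upi_eq/veq_mulA.
Qed.
Lemma Umul1l : left_id (Upi (Vconst 1)) Umul.
Proof. by move=> x; rewrite -[x]UrepK !UE; exact/Upi_eq/veq_mul1l. Qed.
Lemma Umul1r : right_id (Upi (Vconst 1)) Umul.
Proof. by move=> x; rewrite -[x]UrepK !UE; exact/Upi_eq/veq_mul1r. Qed.
Lemma UmulDl : left_distributive Umul Uadd.
Proof.
move=> x y z; rewrite -[x]UrepK -[y]UrepK -[z]UrepK !UE.
exact/Upi_eq/veq_mulDl.
Qed.
Lemma UmulDr : right_distributive Umul Uadd.
Proof.
move=> x y z; rewrite -[x]UrepK -[y]UrepK -[z]UrepK !UE.
exact/Upi_eq/veq_mulDr.
Qed.

(* Evaluation in the trivial one-dimensional module, giving 1 <> 0. *)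
Fixpoint vaug (t : vterm) : K :=
  match t with
  | VL _ | VC => 0
  | Vconst a => a
  | Vadd s t => vaug s + vaug t
  | Vopp t => - vaug t
  | Vmul s t => vaug s * vaug t
  end.

Lemma vaug_eq s t : veq s t -> vaug s = vaug t.
Proof.
elim=> //=.
- by move=> x y z _ -> _ ->.
- by move=> x x' y y' _ -> _ ->.
- by move=> x x' _ ->.
- by move=> x x' y y' _ -> _ ->.
- by move=> x y z; rewrite addrA.
- by move=> x y; rewrite addrC.
- by move=> x; rewrite add0r.
- by move=> x; rewrite addNr.
- by move=> x y z; rewrite mulrA.
- by move=> x; rewrite mul1r.
- by move=> x; rewrite mulr1.
- by move=> x y z; rewrite mulrDl.
- by move=> x y z; rewrite mulrDr.
- by move=> a x; rewrite mulrC.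
- by move=> m n; rewrite !mulr0 oppr0 !addr0.
Qed.

Lemma Uone_neq0 : Upi (Vconst 1) != 0 :> Uvir.
Proof.
apply/negP => /eqP /Upi_eq /vaug_eq /= /eqP.
by rewrite oner_eq0.
Qed.

HB.instance Definition _ := GRing.Zmodule_isNzRing.Build Uvir
  UmulA Umul1l Umul1r UmulDl UmulDr Uone_neq0.

Lemma UscaleA a b x : Uscale a (Uscale b x) = Uscale (a * b) x.
Proof.
rewrite -[x]UrepK !UE; apply/Upi_eq.
apply: veq_trans (veq_mulA _ _ _) _.
by apply: veq_mul (veq_refl _); apply: veq_sym; exact: veq_constM.
Qed.
Lemma Uscale1 : left_id 1 Uscale.
Proof. by move=> x; rewrite -[x]UrepK !UE; exact/Upi_eq/veq_mul1l. Qed.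
Lemma UscaleDr : right_distributive Uscale +%R.
Proof.
move=> a x y; rewrite -[x]UrepK -[y]UrepK /GRing.add/= !UE.
exact/Upi_eq/veq_mulDr.
Qed.
Lemma UscaleDl x : {morph Uscale^~ x : a b / a + b}.
Proof.
move=> a b; rewrite -[x]UrepK !UE [in RHS]/GRing.add/= !UE; apply/Upi_eq.
apply: veq_trans (veq_mulDl _ _ _).
by apply: veq_mul (veq_refl _); exact: veq_constD.
Qed.

HB.instance Definition _ := GRing.Zmodule_isLmodule.Build K Uvir
  UscaleA Uscale1 UscaleDr UscaleDl.

Lemma UscaleAl (a : K) (x y : Uvir) : a *: (x * y) = (a *: x) * y.
Proof.
rewrite -[x]UrepK -[y]UrepK /GRing.mul /GRing.scale/= !UE.
exact/Upi_eq/veq_mulA.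
Qed.

HB.instance Definition _ := GRing.Lmodule_isLalgebra.Build K Uvir UscaleAl.

Lemma UscaleAr (a : K) (x y : Uvir) : a *: (x * y) = x * (a *: y).
Proof.
rewrite -[x]UrepK -[y]UrepK /GRing.mul /GRing.scale/= !UE; apply/Upi_eq.
apply: veq_trans (veq_mulA _ _ _) _.
apply: veq_trans (veq_sym (veq_mulA _ _ _)).
by apply: veq_mul (veq_refl _); exact: veq_constC.
Qed.

HB.instance Definition _ := GRing.Lalgebra_isAlgebra.Build K Uvir UscaleAr.

End Instances.

Definition L (n : int) : Uvir := Upi (VL n).
Definition cc : Uvir := Upi VC.

Lemma vir_bracket (m n : int) :
  L m * L n - L n * L m =
  (m - n)%:~R *: L (m + n) +
  (if m + n == 0 then (m ^+ 3 - m)%:~R / 12 else 0) *: cc.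
Proof.
rewrite /GRing.mul /GRing.scale /GRing.opp /GRing.add /= /L /cc.
by rewrite !(UaddE, UoppE, UmulE, UscaleE); exact/Upi_eq/veq_vir.
Qed.

Lemma cc_central (n : int) : cc * L n = L n * cc.
Proof. by rewrite /GRing.mul/= /L /cc !UmulE; exact/Upi_eq/veq_centralL. Qed.

End Enveloping.

(* Modules for the Virasoro algebra are the left modules over Uvir K; the field
   K acts on them through K -> Uvir K. *)
Notation "a ⋆ v" := ((a%:A : Uvir _) *: v)
  (at level 40, left associativity, v at next level) : ring_scope.

Section LinearAlgebra.
Variables (K : numClosedFieldType) (V : lmodType (Uvir K)).

Definition Kspan (G : set V) : set V :=
  [set v | exists n (a : 'I_n -> K) (g : 'I_n -> V),
     (forall i, G (g i)) /\ v = \sum_(i < n) a i ⋆ g i].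

Definition Kindependent (n : nat) (e : 'I_n -> V) : Prop :=
  forall a : 'I_n -> K, \sum_(i < n) a i ⋆ e i = 0 -> forall i, a i = 0.

Definition is_Kbasis (S : set V) (n : nat) (e : 'I_n -> V) : Prop :=
  [/\ forall i, S (e i), Kindependent e & S `<=` Kspan (range e)].

(* Meaningful when S is a finite dimensional K-subspace. *)
Definition Kdim (S : set V) : nat :=
  xget 0%N [set n | exists e : 'I_n -> V, is_Kbasis S e].

Lemma Kspan_incl (G : set V) : G `<=` Kspan G.
Proof.
move=> v Gv; exists 1%N, (fun=> 1), (fun=> v); split=> //.
by rewrite big_ord1 !scale1r.
Qed.

Lemma Kspan0 (G : set V) : Kspan G 0.
Proof.
exists 0%N, (fun=> 0), (fun=> 0); split=> [[]//|].
by rewrite big_ord0.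
Qed.

Lemma KspanD (G : set V) u v : Kspan G u -> Kspan G v -> Kspan G (u + v).
Proof.
move=> [m [a [g [Gg ->]]]] [n [b [f [Gf ->]]]].
exists (m + n)%N, (fun i => match fintype.split i with inl j => a j | inr j => b j end),
  (fun i => match fintype.split i with inl j => g j | inr j => f j end); split.
  by move=> i; case: fintype.split.
rewrite big_split_ord /=; congr (_ + _); apply: eq_bigr => i _.
  by rewrite (unsplitK (inl i)).
by rewrite (unsplitK (inr i)).
Qed.

End LinearAlgebra.

Section Modules.
Variable K : numClosedFieldType.
Local Notation U := (Uvir K).

(* U(c,h,k) = K[x]/((x-h)^k) has the Jordan basis u_j, the class of (x-h)^(k-j),
   on which x acts as L_0. We realize U(L) (x) U(c,h,k) as the row vectors
   over U(L): jvec k j is 1 (x) u_j, and jvec k 0 = 0. The induced module is the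
   quotient by y z (x) u = y (x) z u, for z among c and the L_n, n >= 0. *)

Definition jvec (k j : nat) : 'rV[U]_k := \row_(i < k) (i.+1 == j)%:R.

Inductive ind_relation (c h : K) (k j : nat) : 'rV[U]_k -> Prop :=
| ind_Ln (n : int) : 0 < n -> ind_relation c h j (L K n *: jvec k j)
| ind_L0 : ind_relation c h j
    (L K 0 *: jvec k j - (h ⋆ jvec k j + jvec k j.-1))
| ind_c : ind_relation c h j (cc K *: jvec k j - c ⋆ jvec k j).

Definition ind_submod (c h : K) (k : nat) : submodule 'rV[U]_k :=
  generated [set v | exists2 j, (1 <= j <= k)%N & ind_relation c h j v].

Definition M (c h : K) (k : nat) : Type := quotmod (ind_submod c h k).
HB.instance Definition _ (c h : K) (k : nat) := GRing.Lmodule.on (M c h k).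

Definition ugen (c h : K) (k j : nat) : M c h k :=
  projmod (ind_submod c h k) (jvec k j).

Definition Lword (s : seq int) : U := \prod_(n <- s) L K n.

(* The degree l component M(c,h,k)(l): L_{n_1} ... L_{n_r} u_j has degree
   - (n_1 + ... + n_r). *)
Definition Mdeg (c h : K) (k : nat) (l : int) : set (M c h k) :=
  Kspan [set v | exists s j,
    - (\sum_(n <- s) n) = l /\ v = Lword s *: ugen c h k j].

Definition zero_deg0 (c h : K) (k : nat) : set (M c h k) :=
  Kspan (\bigcup_(l in [set l : int | l != 0]) @Mdeg c h k l).

Definition Jset (c h : K) (k : nat) : set (M c h k) :=
  [set v | forall y : U, @zero_deg0 c h k (y *: v)].

Lemma Jset_submod (c h : K) (k : nat) : is_submod (@Jset c h k).
Proof.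
split=> [y|a u v Ju Jv y]; first by rewrite scaler0; exact: Kspan0.
by rewrite scalerDr scalerA; apply: KspanD; [exact: Ju|exact: Jv].
Qed.

Definition J (c h : K) (k : nat) : submodule (M c h k) :=
  Submodule (Jset_submod c h k).

Definition W (c h : K) (k : nat) : Type := quotmod (J c h k).
HB.instance Definition _ (c h : K) (k : nat) := GRing.Lmodule.on (W c h k).

Definition wgen (c h : K) (k j : nat) : W c h k :=
  projmod (J c h k) (ugen c h k j).

Definition Verma (c h : K) : Type := M c h 1.
HB.instance Definition _ (c h : K) := GRing.Lmodule.on (Verma c h).

(* 1_{c,h} *)
Definition vac (c h : K) : Verma c h := ugen c h 1 1.

(* The sum of all proper submodules, i.e. the largest proper submodule. *)
Definition Verma_rad (c h : K) : submodule (Verma c h) :=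
  generated [set v | exists S : submodule (Verma c h),
                       smset S <> setT /\ smset S v].

Definition Lirr (c h : K) : Type := quotmod (Verma_rad c h).
HB.instance Definition _ (c h : K) := GRing.Lmodule.on (Lirr c h).

Definition Verma_eq_Lirr (c h : K) : Prop :=
  bijective (projmod (Verma_rad c h) : Verma c h -> Lirr c h).

Definition Vvir (c : K) : Type :=
  quotmod (generated [set L K (-1) *: vac c 0]).
HB.instance Definition _ (c : K) := GRing.Lmodule.on (Vvir c).

Definition vacuum (c : K) : Vvir c :=
  projmod (generated [set L K (-1) *: vac c 0]) (vac c 0).

Definition omega (c : K) : Vvir c := L K (-2) *: vacuum c.

Definition binz (m : int) (i : nat) : K :=
  (\prod_(j < i) (m - j%:Z)%:~R) / (i`!)%:R.

Section Modes.
Variable V : lmodType U.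

Definition modes_linear (X : lmodType U) (Y : V -> int -> X -> X) : Prop :=
  (forall (a : K) u v n x, Y (a ⋆ u + v) n x = a ⋆ Y u n x + Y v n x) /\
  (forall (a : K) v n x y, Y v n (a ⋆ x + y) = a ⋆ Y v n x + Y v n y).

Definition truncated (X : lmodType U) (Y : V -> int -> X -> X) : Prop :=
  forall v x, exists N : int, forall n, N <= n -> Y v n x = 0.

(* The component form of the Jacobi identity. By truncation both sums have
   finite support. *)
Definition borcherds (X : lmodType U) (YV : V -> int -> V -> V)
    (Y : V -> int -> X -> X) : Prop :=
  forall (u v : V) (x : X) (m n l : int),
    \sum_(i \in [set: nat]) binz m i ⋆ Y (YV u (l + i%:Z) v) (m + n - i%:Z) x =
    \sum_(i \in [set: nat]) ((-1) ^+ i * binz l i) ⋆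
      (Y u (m + l - i%:Z) (Y v (n + i%:Z) x) -
       ((-1) ^ l) ⋆ Y v (n + l - i%:Z) (Y u (m + i%:Z) x)).

End Modes.

(* X is a V_Vir(c,0)-module through Y, the L_n being the modes of omega. *)
Definition is_Vvir_module (c : K) (X : lmodType U)
    (YV : Vvir c -> int -> Vvir c -> Vvir c) (Y : Vvir c -> int -> X -> X) :
    Prop :=
  [/\ modes_linear Y,
      truncated Y,
      forall n x, Y (vacuum c) n x = if n == -1 then x else 0,
      forall n x, Y (omega c) (n + 1) x = L K n *: x
    & borcherds YV Y].

Definition is_Vvir_voa (c : K) (YV : Vvir c -> int -> Vvir c -> Vvir c) : Prop :=
  is_Vvir_module YV YV /\
  forall v, YV v (-1) (vacuum c) = v /\
            forall n : int, 0 <= n -> YV v n (vacuum c) = 0.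

Definition wt (c : K) (v : Vvir c) : int :=
  xget 0 [set n : int | L K 0 *: v = (n%:~R : K) ⋆ v].

(* o(v) = v_{wt v - 1} for homogeneous v *)
Definition zero_mode (c : K) (X : lmodType U) (Y : Vvir c -> int -> X -> X)
  (v : Vvir c) : X -> X := Y v (wt v - 1).

(* m encodes the partition of l in which i+1 has multiplicity m i. *)
Definition partition_of (l : nat) : Type :=
  {m : {ffun 'I_l -> 'I_l.+1} | (\sum_(i < l) i.+1 * m i == l)%N}.
HB.instance Definition _ (l : nat) := Finite.on (partition_of l).

Definition npart (l : nat) : nat := #|{: partition_of l}|.

Definition pbw (l : nat) (m : partition_of l) : U :=
  \prod_(i < l) L K (- (i.+1)%:Z) ^+ val m i.

Section PseudoTrace.
Variables (c h : K) (k l : nat).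

(* The vectors b_a u_j (a < npart l, 1 <= j <= k), the PBW basis of
   W(l) = W_{h+l}. *)
Definition pbw_basis (j : nat) (a : 'I_(npart l)) : W c h k :=
  pbw (enum_val a) *: wgen c h k j.

Definition pbw_coord (w : W c h k) : nat -> 'I_(npart l) -> K :=
  xget (fun _ _ => 0)
    [set x | w = \sum_(1 <= j < k.+1) \sum_a x j a ⋆ pbw_basis j a].

(* Block (i,j), 1 <= i, j <= k, of the matrix of sigma restricted to W(l). *)
Definition pbw_block (sigma : W c h k -> W c h k) (i j : nat) :
    'M[K]_(npart l) :=
  \matrix_(a, b) pbw_coord (sigma (pbw_basis j b)) i a.

(* The upper right block is B; the pseudo-trace is zero for irreducible W. *)
Definition pstr_op (sigma : W c h k -> W c h k) : K :=
  if (k <= 1)%N then 0 else \tr (pbw_block sigma 1 k).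

(* The nilpotent part of L_0 on the generalized eigenspace of weight mu. *)
Definition L0N (mu : K) (w : W c h k) : W c h k := L K 0 *: w - mu ⋆ w.

End PseudoTrace.

End Modules.

Definition Cplx (R : realType) : numClosedFieldType := R[i]%C.

Lemma near_dist (K : numFieldType) (z e : K) :
  0 < e -> \forall w \near z, `|z - w| < e.
Proof.
by move=> e0; apply: (@cvgr_dist_lt K K K (nbhs z) _ id z) => //; exact: cvg_id.
Qed.

Lemma cvg_of_dist (K K' : numFieldType) (f : K -> K') (g : K' -> K) (z : K) :
  (forall e, 0 < e -> 0 < g e) ->
  (forall e w, 0 < e -> `|z - w| < g e -> `|f z - f w| < e) -> {for z, continuous f}.
Proof.
move=> g0 fg; apply/(@cvgrPdist_lt K' K' K (nbhs z) _ f (f z)) => e e0.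
have := near_dist z (g0 _ e0).
apply: (@filterS _ (nbhs z) (nbhs_filter z)) => w.
exact: fg.
Qed.

Lemma cvg_affine (K : numFieldType) (T : Type) (F : set_system T) (FF : Filter F)
    (f g : T -> K) (x y a b c : K) :
  f @ F --> a -> g @ F --> b ->
  (fun t => x + c * (f t + y * g t)) @ F --> x + c * (a + y * b).
Proof.
move=> fa gb; apply: cvgD; first exact: cvg_cst.
apply: cvgMl_tmp; apply: cvgD => //; exact: cvgMl_tmp.
Qed.

Section Analytic.
Variable R : realType.
Local Notation C := (Cplx R).

Definition cexp (z : C) : C :=
  (expR (complex.Re z))%:C%C *
  (cos (complex.Im z) +i* sin (complex.Im z))%C.

Definition twopii : C := (2 * pi)%:C%C * 'i%C.

(* log q *)
Definition logq (tau : C) : C := twopii * tau.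

(* q^x = e^{2 pi i tau x} *)
Definition qpow (tau x : C) : C := cexp (logq tau * x).

Definition eta (tau : C) : C :=
  qpow tau (1 / 24) *
  limn (fun n => \prod_(1 <= j < n.+1) (1 - qpow tau j%:R) : C).

Definition tsum (u : nat -> C) : C := limn (series u).

Definition Zterm (c h : C) (tau : C) (l : nat) : C :=
  (Kdim (@Mdeg C c h 1 l%:Z))%:R * qpow tau (l%:R + h).

Definition ZM (c h : C) (tau : C) : C :=
  qpow tau (- (c / 24)) * tsum (Zterm c h tau).

(* The contribution of the weight mu = h + l. *)
Definition pstr_term (c h : C) (k : nat)
    (Y : Vvir c -> int -> W c h k -> W c h k) (v : Vvir c) (tau : C)
    (l : nat) : C :=
  let mu : C := h + l%:R in
  \sum_(j \in [set: nat])
    (pstr_op l (fun w => zero_mode Y v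
                  ((j`!%:R^-1 : C) ⋆ iter j (L0N mu) w))
     * logq tau ^+ j * qpow tau (mu - c / 24)).

Definition pstr (c h : C) (k : nat)
    (Y : Vvir c -> int -> W c h k -> W c h k) (v : Vvir c) (tau : C) : C :=
  tsum (pstr_term Y v tau).

(* t is a continuous local branch, at q0 = e^{2 pi i tau}, of
   q |-> log q / (2 pi i), with value tau at q0. *)
Definition tau_branch (tau : C) (t : C -> C) : Prop :=
  [/\ t (qpow tau 1) = tau,
      {for qpow tau 1, continuous t}
    & \forall z \near qpow tau 1, qpow (t z) 1 = z].

Lemma cexpD (x y : C) : cexp (x + y) = cexp x * cexp y.
Proof.
case: x => a b; case: y => a' b'; rewrite /cexp /= expRD cosD sinD rmorphM /=.
rewrite mulrACA; congr (_ * _).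
by apply/eqP; rewrite eq_complex /= eqxx /= [X in _ == X]addrC.
Qed.

Lemma cexp0 : cexp (0 : C) = 1.
Proof. by rewrite /cexp /= expR0 cos0 sin0 mul1r. Qed.

Lemma cexp_neq0 (x : C) : cexp x != 0.
Proof.
apply/negP => /eqP x0; have := cexpD x (- x).
by rewrite subrr cexp0 x0 mul0r => /eqP; rewrite oner_eq0.
Qed.

Lemma twopii_neq0 : twopii != 0.
Proof.
apply/negP => /eqP /(congr1 (@complex.Im R)) /=.
rewrite mul0r mulr1 addr0 => /eqP.
by rewrite mulf_eq0 pnatr_eq0 /= gt_eqF // pi_gt0.
Qed.

Lemma continuous_Re : continuous (fun z : C => complex.Re z : R).
Proof.
move=> z; apply: (@cvg_of_dist C R _ (fun e => (e%:C)%C)) => [e|e w _].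
  by rewrite ltcR.
case: z w => [z1 z2] [w1 w2]; rewrite normc_def /= ltcR => h.
apply: le_lt_trans h; rewrite -sqrtr_sqr; apply: ler_wsqrtr.
by rewrite lerDl sqr_ge0.
Qed.

Lemma continuous_Im : continuous (fun z : C => complex.Im z : R).
Proof.
move=> z; apply: (@cvg_of_dist C R _ (fun e => (e%:C)%C)) => [e|e w _].
  by rewrite ltcR.
case: z w => [z1 z2] [w1 w2]; rewrite normc_def /= ltcR => h.
apply: le_lt_trans h; rewrite -sqrtr_sqr; apply: ler_wsqrtr.
by rewrite lerDr sqr_ge0.
Qed.

Lemma continuous_realC : continuous (fun x : R => (x%:C)%C : C).
Proof.
move=> x; apply: (@cvg_of_dist R C _ (fun e => complex.Re e)) => [e|e w e0].
  by rewrite ltcE => /andP[].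
have [r r0 er] : exists2 r : R, 0 < r & e = (r%:C)%C.
  move: e0; case: e => a b; rewrite ltcE /= => /andP[/eqP -> a0].
  by exists a.
have E (z : C) : `|z| < (r%:C)%C =
    (Num.sqrt ((complex.Re z) ^+ 2 + (complex.Im z) ^+ 2) < r).
  by rewrite -ltcR -normc_def.
move=> hw; rewrite er E.
by rewrite /= subrr expr0n addr0 sqrtr_sqr; move: hw; rewrite er.
Qed.

Lemma sinatan (x : R) : sin (atan x) = x / Num.sqrt (1 + x ^+ 2).
Proof.
rewrite -cos_atan -{2}[x]atanK /tan divfK // cos_atan.
by rewrite invr_eq0 gt_eqF // sqrtr_gt0 ltr_wpDr ?sqr_ge0.
Qed.

Definition clog (w : C) : C :=
  ((ln (complex.Re `|w|))%:C + 'i * (atan (complex.Im w / complex.Re w))%:C)%C.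

Lemma clogK (w : C) : 0 < complex.Re w -> cexp (clog w) = w.
Proof.
case: w => a b /= a0; rewrite /cexp /clog /=.
rewrite !(mul0r, mulr0, mul1r, subr0, addr0, add0r, oppr0).
have s0 : 0 < Num.sqrt (a ^+ 2 + b ^+ 2).
  by rewrite sqrtr_gt0 ltr_wpDr ?sqr_ge0 // exprn_gt0.
rewrite lnK ?posrE // cos_atan sinatan.
have -> : Num.sqrt (1 + (b / a) ^+ 2) = Num.sqrt (a ^+ 2 + b ^+ 2) / a.
  have -> : 1 + (b / a) ^+ 2 = (a ^+ 2 + b ^+ 2) * (a^-1) ^+ 2.
    by rewrite mulrDl -!exprMn divff ?gt_eqF // expr1n.
  by rewrite sqrtrM ?addr_ge0 ?sqr_ge0 // sqrtr_sqr ger0_norm // invr_ge0 ltW.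
apply/eqP; rewrite eq_complex /= !(mul0r, subr0, addr0).
apply/andP; split; apply/eqP; move: s0; set s := Num.sqrt _ => s0.
  by rewrite invf_div mulrCA divff ?mulr1 ?gt_eqF.
by rewrite invf_div mulrC -!mulrA mulVf ?gt_eqF // mulr1 mulVf ?mulr1 // gt_eqF.
Qed.

Lemma tau_branch_exists (tau : C) : exists t, tau_branch tau t.
Proof.
set q0 := qpow tau 1.
have q0n : q0 != 0 by exact: cexp_neq0.
have cw : (fun z : C => z / q0) @ q0 --> (1 : C).
  have E : q0 / q0 = 1 by rewrite divff.
  by rewrite -E; exact: (@mulrr_continuous C (q0^-1) q0).
have cR : (fun z : C => complex.Re (z / q0) : R) @ q0 --> (1 : R).
  apply: (@cvg_comp C C R (fun z => z/q0) (fun w => complex.Re w)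
    (nbhs q0) (nbhs (1:C)) (nbhs (1:R)) cw).
  exact: (@continuous_Re 1).
have cI : (fun z : C => complex.Im (z / q0) : R) @ q0 --> (0 : R).
  apply: (@cvg_comp C C R (fun z => z/q0) (fun w => complex.Im w)
    (nbhs q0) (nbhs (1:C)) (nbhs (0:R)) cw).
  exact: (@continuous_Im 1).
have cN : (fun z : C => complex.Re `|z / q0| : R) @ q0 --> (1 : R).
  have cn : (fun z : C => `|z / q0| : C) @ q0 --> (1 : C).
    have E1 : (1 : C) = `|1 : C| by rewrite normr1.
    rewrite E1; exact: (@cvg_norm C C C (nbhs q0) _ _ _ cw).
  apply: (@cvg_comp C C R (fun z => `|z/q0|) (fun w => complex.Re w)
    (nbhs q0) (nbhs (1:C)) (nbhs (1:R)) cn).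
  exact: (@continuous_Re 1).
have cl : (fun z : C => ln (complex.Re `|z / q0|) : R) @ q0 --> (0 : R).
  rewrite -[X in _ --> X]ln1; apply: continuous_cvg cN.
  by apply: continuous_ln; exact: ltr01.
have ca : (fun z : C => atan (complex.Im (z / q0) / complex.Re (z / q0)) : R)
    @ q0 --> (0 : R).
  have cq : (fun z : C => complex.Im (z / q0) / complex.Re (z / q0) : R) @ q0 --> (0 : R).
    rewrite -[X in _ --> X](mul0r (1^-1 : R)).
    by apply: cvgM cI _; apply: cvgV cR; rewrite oner_eq0.
  have c0 : @atan R @ (0 : R) --> (0 : R).
    rewrite -[X in _ --> X]atan0; exact: continuous_atan.
  exact: (@cvg_comp C R R _ (@atan R) (nbhs q0) (nbhs (0:R)) (nbhs (0:R)) cq c0).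
exists (fun z => tau + twopii^-1 * clog (z / q0)).
have t0 : tau + twopii^-1 * clog (q0 / q0) = tau.
  by rewrite divff // /clog normr1 /= ln1 mul0r atan0 mulr0 addr0 mulr0 addr0.
split; first exact: t0.
- rewrite /prop_for /continuous_at t0.
  have E : tau = tau + twopii^-1 * (0 + 'i%C * 0).
    by rewrite mulr0 addr0 mulr0 addr0.
  rewrite [X in _ --> X]E.
  have c0 : (fun x : R => (x%:C)%C : C) @ (0 : R) --> (0 : C).
    exact: (@continuous_realC (0 : R)).
  have L1 := @cvg_comp C R C _ (fun x : R => (x%:C)%C : C)
    (nbhs q0) (nbhs (0 : R)) (nbhs (0 : C)) cl c0.
  have L2 := @cvg_comp C R C _ (fun x : R => (x%:C)%C : C)
    (nbhs q0) (nbhs (0 : R)) (nbhs (0 : C)) ca c0.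
  exact: (@cvg_affine C C (nbhs q0) _
    (fun z => (ln (complex.Re `|z / q0|))%:C%C)
    (fun z => (atan (complex.Im (z / q0) / complex.Re (z / q0)))%:C%C)
    tau 'i%C 0 0 twopii^-1 L1 L2).
- have : \forall z \near q0, 0 < complex.Re (z / q0).
    exact: (cvgr_gt _ cR 0 ltr01).
  apply: filterS => z zp.
  rewrite /qpow mulr1 /logq mulrDr mulrA divff ?twopii_neq0 // mul1r cexpD.
  by rewrite clogK // -[X in cexp X]mulr1 mulrC divfK.
Qed.

End Analytic.

(* Main.v *)
Require Import Defs.
From mathcomp Require Import all_boot all_order all_algebra.
From mathcomp Require Import complex.
From mathcomp Require Import all_classical all_reals all_analysis.
From mathcomp Require Import ring lra zify.
Import Order.TTheory GRing.Theory Num.Theory.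
Import numFieldNormedType.Exports.
Local Open Scope ring_scope.

(** Since M(c,h) is irreducible, W = W(c,h,k) turns out to be the whole induced
    module M(c,h,k), and its degree l part has the basis b_a u_j, where b_a runs
    over the p(l) PBW monomials and u_1, ..., u_k is the Jordan basis. The modes
    of a vertex algebra module give o(1) = id and o(omega) = L_0. On a PBW vector
    L_0 b_a u_j = (h + l) b_a u_j + b_a u_(j-1), so the nilpotent part of L_0 is
    the shift u_j |-> u_(j-1), and the upper right block of o(v) (L_0^N)^i / i! is
    a scalar matrix. For v = 1 only i = k - 1 contributes, with scalar 1/(k-1)!;
    for v = omega the values i = k - 1 and i = k - 2 contribute, with scalars
    (h + l)/(k-1)! and 1/(k-2)!. Everything else is the generating function of
    the partition numbers and its derivative.

    _Linear independence._ This is the core of the algebra: the PBW vectors must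
    be independent in a module given by generators and relations
    (pbw_independent), and must remain so modulo J (pbw_J_trivial). Functionals
    on the induced module are built by hand. A functional is a function phi of a
    word w in the L_(-n) and an index j, standing for the value at w u_j. Every
    L_n acts on all such functions, by recursion on the word (dact), and the
    Virasoro relations hold on the functions that respect the relations among
    the L_(-n) (admissible, bracket_admissible). Admissible functions therefore
    carry a right action of the enveloping algebra and kill the relations that
    define M(c,h,k). To separate PBW vectors it is enough to have many admissible
    functions, and any representation of the negative part alone produces them:
    we let L_(-n) act as sum_i y_i^(n+1) d/dy_i on polynomials in y_1, ..., y_r.
    The coefficients of L_(-n_1) ... L_(-n_r) (y_1 ... y_r) at monomials with
    all exponents at least 2 tell multisets of length r apart
    (vfcoef_support, vfcoef_neq0).

    _The radical._ If a nonzero combination w of PBW vectors lay in J, let u_i be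
    the highest Jordan vector that it involves. Modulo the lower ones w becomes a
    nonzero vector of M(c,h), which some y maps to 1_(c,h) by irreducibility.
    Then y w has u_i-component 1 in degree zero, against the definition of J.

    _Spanning._ For Z_M the dimension of M(c,h)(l) is needed, so PBW vectors must
    also span (Lword_span): positive modes are pushed to the right, and permuting
    the letters of a word changes it by shorter words.

    _Analysis._ The partial products of 1 / eta are compared with truncated
    partition generating polynomials, whose coefficients are at most p(l) and
    equal to p(l) in low degree (euler_product). Sums of p(l) q^l are
    differentiated by an estimate that needs only their convergence in a slightly
    larger disc (pow_diff2, psum_quadratic). Derivatives are handled in the form
    of Caratheodory (carat), for which the chain rule and the derivative of a
    continuous local inverse, hence of every branch of log q, are algebra. *)

(** * Vector fields on polynomial functions *)

Section Coefficients.
Context {r : nat}.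
Local Notation expo := ('I_r -> nat).

Definition expo_sub (d : expo) (i : 'I_r) (n : nat) : expo :=
  fun j => if j == i then (d j - n)%N else d j.

(** Let D_m = sum_i y_i^(m+2) d/dy_i, the image of L_(-(m+1)). For a word w with
    letters m_1, ..., m_s this is the coefficient of prod_i y_i^(1 + d i) in
    D_(m_1) ... D_(m_s) (y_1 ... y_r). The exponents are shifted by one so that
    the starting monomial is d = 0. *)
Fixpoint vfcoef (w : seq nat) (d : expo) : nat :=
  match w with
  | [::] => [forall i, d i == 0%N]
  | m :: w' =>
      (\sum_i if m < d i then (d i - m) * vfcoef w' (expo_sub d i m.+1) else 0)%N
  end.

Lemma expo_sub_comm d i j m n :
  expo_sub (expo_sub d i m) j n = expo_sub (expo_sub d j n) i m.
Proof.
apply/funext => x; rewrite /expo_sub.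
by case: eqP => [->|_]; case: eqP => // ->; lia.
Qed.

Lemma expo_sub_add d i m n : expo_sub (expo_sub d i m) i n = expo_sub d i (m + n).
Proof. by apply/funext => x; rewrite /expo_sub; case: eqP => // _; lia. Qed.

(** [D_a, D_b] = (b - a) D_(a+b+1), read off on coefficients. The one-variable
    fields in different variables commute, so only the diagonal terms of the
    double sums survive. *)
Lemma vfcoef_bracket (K : comNzRingType) u a b w d :
  (vfcoef (u ++ a :: b :: w) d)%:R - (vfcoef (u ++ b :: a :: w) d)%:R =
  (b%:Z - a%:Z)%:~R * (vfcoef (u ++ (a + b).+1 :: w) d)%:R :> K.
Proof.
elim: u d => [|x u IH] d; last first.
  rewrite /= !natr_sum mulr_sumr -sumrB; apply: eq_bigr => i _.
  case: ifP => _; last by rewrite subrr mulr0.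
  by rewrite !natrM -mulrBr IH mulrCA.
rewrite /=.
have E (x y : nat) : (\sum_i if x < d i then (d i - x) *
      (\sum_j if y < expo_sub d i x.+1 j then (expo_sub d i x.+1 j - y) *
        vfcoef w (expo_sub (expo_sub d i x.+1) j y.+1) else 0) else 0)%N =
   (\sum_i \sum_j (if (x < d i) && (y < expo_sub d i x.+1 j) then
     (d i - x) * ((expo_sub d i x.+1 j - y) *
       vfcoef w (expo_sub (expo_sub d i x.+1) j y.+1)) else 0))%N.
  apply: eq_bigr => i _; case: ifP => xd /=; last by rewrite big1.
  by rewrite big_distrr /=; apply: eq_bigr => j _; case: ifP => //; rewrite muln0.
rewrite !E [in X in _ - X]exchange_big /= !natr_sum mulr_sumr -sumrB.
apply: eq_bigr => i _; rewrite !natr_sum -sumrB (bigD1 i) //= big1 => [|j ji].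
  rewrite addr0 !expo_sub_add /expo_sub eqxx.
  have -> : (b.+1 + a.+1 = a.+1 + b.+1)%N by rewrite addnC.
  have -> : (a.+1 + b.+1 = (a + b).+2)%N by lia.
  case: (ltnP (a + b).+1 (d i)) => H; last first.
    have -> : ((a < d i) && (b < d i - a.+1))%N = false by lia.
    have -> : ((b < d i) && (a < d i - b.+1))%N = false by lia.
    by rewrite subrr mulr0.
  have -> : ((a < d i) && (b < d i - a.+1))%N by lia.
  have -> : ((b < d i) && (a < d i - b.+1))%N by lia.
  move: (vfcoef _ _) => v; rewrite !natrM !natrB; try lia.
  by rewrite !mulrS rmorphB /=; ring.
rewrite (expo_sub_comm d j i) /expo_sub (negPf ji) eq_sym (negPf ji) andbC.
by case: ifP => _; rewrite ?subrr // mulnCA subrr.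
Qed.

Definition expo_supp (d : expo) : {set 'I_r} := [set i | d i != 0%N].

Lemma sum_nat_neq0 (F : 'I_r -> nat) :
  (\sum_i F i != 0)%N -> exists i, F i != 0%N.
Proof.
move=> H; apply: contrapT => /forallNP N; move/eqP: H; apply.
by apply: big1 => i _; apply/eqP; move/negP: (N i); rewrite negbK.
Qed.

Lemma card_expo_level d i m x : d i = m.+1 ->
  #|[set j | d j == x.+1]| = ((m == x) + #|[set j | expo_sub d i m.+1 j == x.+1]|)%N.
Proof.
move=> dim; set d' := expo_sub d i m.+1.
have -> : [set j | d j == x.+1] =
    (if m == x then i |: [set j | d' j == x.+1] else [set j | d' j == x.+1]).
  apply/setP => j; case: (m =P x) => mx; rewrite !inE /d' /expo_sub;
    case: (j =P i) => [->|] //=; rewrite dim ?mx ?eqxx //.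
  by rewrite subnn eqSS; apply/eqP.
case: (m == x) => //=.
by rewrite cardsU1 inE /d' /expo_sub eqxx dim subnn.
Qed.

(** Each field raises one exponent only, so s fields reach at most s variables.
    When they have to reach s variables, every variable is raised exactly once,
    and the increments are the letters of the word. *)
Lemma vfcoef_support w d : vfcoef w d != 0%N ->
  (#|expo_supp d| <= size w)%N /\
  ((size w <= #|expo_supp d|)%N ->
   forall x, count_mem x w = #|[set i | d i == x.+1]|).
Proof.
elim: w d => [|m w IH] d /=.
  case: forallP => // d0 _; split=> [|_ x].
    by rewrite leqn0 cards_eq0 -finset.subset0; apply/fintype.subsetP => i; rewrite inE d0.
  symmetry; apply/eqP; rewrite cards_eq0 -finset.subset0.
  by apply/fintype.subsetP => i; rewrite inE (eqP (d0 i)).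
case/sum_nat_neq0 => i.
case: ifP => // mdi; rewrite muln_eq0 negb_or => /andP[_ /IH [le_w eq_w]].
(* The outermost field raises the variable i, from d' to d. *)
set d' := expo_sub d i m.+1 in le_w eq_w.
have sub : expo_supp d \subset i |: expo_supp d'.
  by apply/fintype.subsetP => j; rewrite !inE /d' /expo_sub; case: (j =P i).
have sub' : expo_supp d' \subset expo_supp d.
  by apply/fintype.subsetP => j; rewrite !inE /d' /expo_sub; case: (j =P i) => // ->; lia.
have card_sub := subset_leq_card sub.
rewrite cardsU1 in card_sub.
split=> [|le_d x]; first by move: card_sub le_w; case: (_ \notin _) => /=; lia.
have iNd' : i \notin expo_supp d'.
  by apply: contraTT le_d => H; move: card_sub le_w; rewrite (negPf H) /=; lia.
have dim : d i = m.+1.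
  by move: iNd'; rewrite inE negbK /d' /expo_sub eqxx; lia.
rewrite eq_w; last by move: card_sub le_d; rewrite iNd' /=; lia.
by rewrite (card_expo_level _ _ _ _ dim).
Qed.

(** All contributions are nonnegative, so it suffices to follow one of them,
    which raises each variable directly to its final exponent. *)
Lemma vfcoef_neq0 w d :
  (forall x, count_mem x w = #|[set i | d i == x.+1]|) -> vfcoef w d != 0%N.
Proof.
elim: w d => [|m w IH] d /= cnt.
  rewrite -lt0n lt0b; apply/forallP => i; case E: (d i) => [//|x].
  have := cnt x; move/esym/eqP; rewrite cards_eq0 => /eqP/setP/(_ i).
  by rewrite !inE E eqxx.
have : (0 < #|[set i | d i == m.+1]|)%N by rewrite -cnt eqxx.
case/card_gt0P => i; rewrite inE => /eqP dim.
rewrite (bigD1 i) //= addn_eq0 negb_and; apply/orP; left.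
rewrite dim ltnSn muln_eq0 negb_or; apply/andP; split; first by lia.
apply: IH => x; have := cnt x.
by rewrite (card_expo_level _ _ _ _ dim) => /addnI.
Qed.

End Coefficients.

(** The letter b stands for the part b + 1. *)
Definition word_expo (w : seq nat) : 'I_(size w) -> nat := fun i => (nth 0%N w i).+1.

Lemma card_word_expo w x : #|[set i | word_expo w i == x.+1]| = count_mem x w.
Proof.
rewrite -sum1_card -sum1_count (big_nth 0%N) big_mkord.
by apply: eq_bigl => i; rewrite inE.
Qed.

Lemma card_expo_supp_word w : #|expo_supp (word_expo w)| = size w.
Proof.
have -> : expo_supp (word_expo w) = [set: 'I_(size w)].
  by apply/setP => i; rewrite !inE.
by rewrite cardsT card_ord.
Qed.

Local Open Scope classical_set_scope.

(** * The functionals on the induced module *)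

(** A linear combination of known equations proves the goal as soon as the
    difference of both sides agrees with it, which is left to ring. *)
Lemma lincomb4 {K : comRingType} (k1 : K) {a1 b1} (H1 : a1 = b1) (k2 : K) {a2 b2}
  (H2 : a2 = b2) (k3 : K) {a3 b3} (H3 : a3 = b3) (k4 : K) {a4 b4} (H4 : a4 = b4)
  (x y : K) :
  x - y = k1 * (a1 - b1) + k2 * (a2 - b2) + k3 * (a3 - b3) + k4 * (a4 - b4) ->
  x = y.
Proof.
by rewrite H1 H2 H3 H4 !subrr !mulr0 !addr0 => /eqP; rewrite subr_eq0 => /eqP.
Qed.

Section DualAction.
Context {K : numClosedFieldType}.
Variables (c h : K).
Local Notation form := (seq nat -> nat -> K).

Definition cocycle (m n : int) : K :=
  if m + n == 0 then (m ^+ 3 - m)%:~R / 12 else 0.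

Lemma cocycle_jacobi m n p :
  (m - n)%:~R * cocycle (m + n) p + (n - p)%:~R * cocycle (n + p) m
  + (p - m)%:~R * cocycle (p + m) n = 0.
Proof.
rewrite /cocycle [n + p + m]addrC [p + m + n]addrC.
rewrite [m + (n + p)]addrA [n + (p + m)]addrA [n + p + m]addrAC [n + m]addrC.
case: eqP => [E|_]; last by rewrite !mulr0 !addr0.
have -> : p = - m - n by lia.
have n12 : (12 : K) != 0 by rewrite pnatr_eq0.
by field.
Qed.

Lemma cocycle_sym m n : cocycle n m = - cocycle m n.
Proof.
rewrite /cocycle [n + m]addrC; case: eqP => [E|_]; last by rewrite oppr0.
have -> : n = - m by apply/eqP; rewrite -addr_eq0 addrC E.
by rewrite -mulNr -intrN; congr (_%:~R / _); ring.
Qed.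

(** The letter b of a word stands for L_(-(b+1)), which is Negz b, and phi w j for
    the value of a functional at w u_j; then dact n phi is the functional
    v |-> phi (L_n v). For n >= 0 the mode L_n is commuted past the first letter
    of the word, and at the empty word it acts on u_j: it kills it for n > 0, and
    L_0 u_j = h u_j + u_(j-1). The test on j encodes u_0 = 0. *)
Fixpoint dact (n : int) (phi : form) (w : seq nat) (j : nat) {struct w} : K :=
  match n, w with
  | Negz a, _ => phi (a :: w) j
  | Posz n', [::] =>
      if n' == 0%N then h * phi [::] j + (if (j <= 1)%N then 0 else phi [::] j.-1)
      else 0
  | Posz n', b :: w' =>
      dact n (fun u => phi (b :: u)) w' j
      + (n - Negz b)%:~R * dact (n + Negz b) phi w' j
      + cocycle n (Negz b) * (c * phi w' j)
  end.

Definition comb (a : K) (phi psi : form) : form :=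
  fun w j => a * phi w j + psi w j.

Lemma dact_negz a phi : dact (Negz a) phi = fun w => phi (a :: w).
Proof. by apply/funext => -[|b w]; apply/funext. Qed.

Lemma dact_cons (n : nat) phi b w j : dact n phi (b :: w) j =
  dact n (dact (Negz b) phi) w j
  + (n%:Z - Negz b)%:~R * dact (n%:Z + Negz b) phi w j
  + cocycle n (Negz b) * (c * phi w j).
Proof. by rewrite dact_negz. Qed.

Lemma dact_comb n a phi psi :
  dact n (comb a phi psi) = comb a (dact n phi) (dact n psi).
Proof.
apply/funext => w; apply/funext => j; rewrite /comb.
elim: w n phi psi => [|b w IH] [n|n'] phi psi //=.
  by case: ifP => _; [case: ifP => _; ring|ring].
have -> : (fun u : seq nat => comb a phi psi (b :: u)) =
  comb a (fun u => phi (b :: u)) (fun u => psi (b :: u)) by [].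
by rewrite /comb !IH; ring.
Qed.

(** phi ([L_m, L_n] v) at v = w u_j; since functionals are acted on from the
    right, the composites appear in reverse order. *)
Definition bracket_at (m n : int) (phi : form) w j :=
  dact n (dact m phi) w j - dact m (dact n phi) w j =
  (m - n)%:~R * dact (m + n) phi w j + cocycle m n * (c * phi w j).

Lemma bracket_pos_neg (m : nat) b phi w j : bracket_at m (Negz b) phi w j.
Proof.
by rewrite /bracket_at [dact (Negz b) (dact m phi)]dact_negz dact_cons; ring.
Qed.

Lemma bracket_sym {m n phi w j} : bracket_at m n phi w j -> bracket_at n m phi w j.
Proof.
rewrite /bracket_at => H; rewrite -opprB H [n + m]addrC.
rewrite (cocycle_sym m n); ring.
Qed.

(** Two modes of nonnegative index: commute both past the first letter b. What is
    produced besides the induction hypothesis is the Jacobi identity for L_m, L_n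
    and L_(-(b+1)), whose brackets are known, either by induction or by the
    definition of the action. *)
Lemma bracket_pos (m n : nat) phi w j : bracket_at m n phi w j.
Proof.
elim: w m n phi => [|b w IH] m n phi.
  rewrite /bracket_at /cocycle; case: m n => [|m] [|n] //=; rewrite ?mulr0; try ring.
  - by case: ifP => _; ring.
  - by case: ifP => _; ring.
have IH' (p : int) (q : nat) : bracket_at p q phi w j.
  by case: p => p; [exact: IH|apply: bracket_sym; exact: bracket_pos_neg].
rewrite /bracket_at !dact_cons.
have E (p : nat) : dact (Negz b) (dact p phi) =
    comb (p%:Z - Negz b)%:~R (dact (p%:Z + Negz b) phi)
     (comb (cocycle p (Negz b) * c) phi (dact p (dact (Negz b) phi))).
  apply/funext => u; apply/funext => i; rewrite /comb.
  have := bracket_pos_neg p b phi u i; rewrite /bracket_at => /eqP.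
  by rewrite subr_eq => /eqP ->; ring.
rewrite !E !dact_comb /comb.
have H1 := IH m n (dact (Negz b) phi).
have H2 := IH' (n%:Z + Negz b) m.
have H3 := IH' (m%:Z + Negz b) n.
move: H1 H2 H3; rewrite /bracket_at => H1 H2 H3.
have k0 : cocycle m n = 0.
  by rewrite /cocycle; case: m n {IH' IH E H1 H2 H3} => [|m] [|n] //=; rewrite ?mul0r.
have J := cocycle_jacobi m n (Negz b).
rewrite k0; move: H1 H2 H3 J; rewrite k0 [Negz b + m]addrC.
rewrite [n%:Z + Negz b + m]addrC [m%:Z + (n%:Z + _)]addrA.
rewrite [m%:Z + Negz b + n]addrAC PoszD => H1 H2 H3 J.
apply: (lincomb4 1 H1 (m%:Z - Negz b)%:~R H3 (Negz b - n%:Z)%:~R H2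
  (- (c * phi w j)) J); ring.
Qed.

(** Functionals that respect the relations among the L_(-n), at every place of
    every word: those on U(L_-) (x) U(c,h,k), where L_- is spanned by the
    L_(-n), n > 0. *)
Definition admissible (phi : form) := forall u a b w j,
  phi (u ++ a :: b :: w) j - phi (u ++ b :: a :: w) j =
  (b%:Z - a%:Z)%:~R * phi (u ++ (a + b).+1 :: w) j.

Lemma bracket_admissible m n phi w j : admissible phi -> bracket_at m n phi w j.
Proof.
move=> A; case: m => m; case: n => n.
- exact: bracket_pos.
- exact: bracket_pos_neg.
- apply: bracket_sym; exact: bracket_pos_neg.
rewrite /bracket_at !dact_negz (A [::]) /= /cocycle.
have -> : Negz m + Negz n = Negz (m + n).+1 by lia.
have -> : Negz m - Negz n = n%:Z - m%:Z by lia.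
by rewrite mul0r addr0.
Qed.

Lemma dact_cons_admissible n b phi w j : admissible phi ->
  dact n phi (b :: w) j = dact n (dact (Negz b) phi) w j
  + (n - Negz b)%:~R * dact (n + Negz b) phi w j
  + cocycle n (Negz b) * (c * phi w j).
Proof.
move=> A; have := bracket_admissible n (Negz b) phi w j A.
rewrite /bracket_at [dact _ (dact n phi)]dact_negz => /eqP.
by rewrite subr_eq => /eqP ->; ring.
Qed.

(** [L_n, [L_(-a), L_(-b)]] is again a combination of brackets, so pushing L_n
    through a relation produces relations only. *)
Lemma admissible_dact n phi : admissible phi -> admissible (dact n phi).
Proof.
move=> A u; elim: u n phi A => [|x u IH] [n|a'] phi A a b w j;
  try by rewrite dact_negz; first [exact: (A [:: a']) | exact: (A [:: a', x & u])].
- have A' d : admissible (dact (Negz d) phi).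
    by rewrite dact_negz => u; exact: (A (d :: u)).
  rewrite !cat0s ![dact n phi (_ :: _) _]dact_cons_admissible //.
  rewrite ![dact _ _ (_ :: w) j]dact_cons_admissible //.
  have Ephi : dact (Negz b) (dact (Negz a) phi) =
      comb (b%:Z - a%:Z)%:~R (dact (Negz (a + b).+1) phi)
        (dact (Negz a) (dact (Negz b) phi)).
    apply/funext => v; apply/funext => i; rewrite !dact_negz /comb.
    by have /eqP := A [::] a b v i; rewrite subr_eq => /eqP.
  rewrite Ephi dact_comb /comb.
  have -> : n%:Z + Negz a + Negz b = n%:Z + Negz (a + b).+1 by lia.
  have -> : n%:Z + Negz b + Negz a = n%:Z + Negz (a + b).+1 by lia.
  have := cocycle_jacobi n (Negz a) (Negz b).
  rewrite [Negz b + n]addrC.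
  rewrite [cocycle (Negz a + Negz b) n]cocycle_sym => J.
  have -> : Negz (a + b).+1 = Negz a + Negz b by lia.
  have -> : b%:Z - a%:Z = Negz a - Negz b by lia.
  rewrite ![dact (Negz _) phi]dact_negz.
  by apply: (lincomb4 (c * phi w j) J 0 J 0 J 0 J); ring.
- rewrite !cat_cons /=.
  have Ax : admissible (fun v => phi (x :: v)) by move=> v; exact: (A (x :: v)).
  have H1 := IH n%:Z _ Ax a b w j.
  have H2 := IH (n%:Z + Negz x) _ A a b w j.
  have H3 := A u a b w j.
  by apply: (lincomb4 1 H1 (n%:Z - Negz x)%:~R H2
    (cocycle n (Negz x) * c) H3 0 H3); ring.
Qed.

End DualAction.

(** * The action of the enveloping algebra *)

Section EnvelopingAction.
Context {K : numClosedFieldType}.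
Variables (c h : K).
Local Notation form := (seq nat -> nat -> K).
Local Notation dact := (dact c h).

(** The right action on functionals, hence the exchanged order at products. *)
Fixpoint vact (t : vterm K) (phi : form) : form :=
  match t with
  | VL n => dact n phi
  | VC => fun w j => c * phi w j
  | Vconst a => fun w j => a * phi w j
  | Vadd s t => fun w j => vact s phi w j + vact t phi w j
  | Vopp s => fun w j => - vact s phi w j
  | Vmul s t => vact t (vact s phi)
  end.

Lemma admissible_scale a (phi : form) :
  admissible phi -> admissible (fun w j => a * phi w j).
Proof. by move=> A u x y w j; rewrite -mulrBr (A u x y w j); ring. Qed.

Lemma admissible_add (phi psi : form) : admissible phi -> admissible psi ->
  admissible (fun w j => phi w j + psi w j).
Proof.
move=> A B u x y w j; have Ha := A u x y w j; have Hb := B u x y w j.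
by apply: (lincomb4 1 Ha 1 Hb 0 Hb 0 Hb); ring.
Qed.

Lemma admissible_vact t phi : admissible phi -> admissible (vact t phi).
Proof.
elim: t phi => [n||a|s IHs t IHt|s IHs|s IHs t IHt] phi A /=.
- exact: admissible_dact.
- exact: admissible_scale.
- exact: admissible_scale.
- by apply: admissible_add; [exact: IHs|exact: IHt].
- have := admissible_scale (-1) _ (IHs _ A).
  by congr admissible; apply/funext => w; apply/funext => j; rewrite mulN1r.
- exact/IHt/IHs.
Qed.

Lemma vact_comb t a (phi psi : form) :
  vact t (comb a phi psi) = comb a (vact t phi) (vact t psi).
Proof.
elim: t phi psi => [n||b|s IHs t IHt|s IHs|s IHs t IHt] phi psi /=.
- exact: dact_comb.
- by apply/funext => w; apply/funext => j; rewrite /comb; ring.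
- by apply/funext => w; apply/funext => j; rewrite /comb; ring.
- by apply/funext => w; apply/funext => j; rewrite IHs IHt /comb; ring.
- by apply/funext => w; apply/funext => j; rewrite IHs /comb; ring.
- by rewrite IHs IHt.
Qed.

Lemma vact_scale t a (phi : form) :
  vact t (fun w j => a * phi w j) = fun w j => a * vact t phi w j.
Proof.
have -> : (fun w j => a * phi w j) = comb (a - 1) phi phi.
  by apply/funext => w; apply/funext => j; rewrite /comb; ring.
by rewrite vact_comb; apply/funext => w; apply/funext => j; rewrite /comb; ring.
Qed.

Lemma vact_add t (phi psi : form) :
  vact t (fun w j => phi w j + psi w j) =
  fun w j => vact t phi w j + vact t psi w j.
Proof.
have -> : (fun w j => phi w j + psi w j) = comb 1 phi psi.
  by apply/funext => w; apply/funext => j; rewrite /comb; ring.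
by rewrite vact_comb; apply/funext => w; apply/funext => j; rewrite /comb; ring.
Qed.

(** The congruence defining the enveloping algebra acts trivially on admissible
    functionals; the Virasoro bracket is the only case with content. *)
Lemma vact_eq s t : veq s t ->
  forall phi, admissible phi -> vact s phi = vact t phi.
Proof.
have fe (f g : form) : (forall w j, f w j = g w j) -> f = g.
  by move=> fg; apply/funext => w; apply/funext => j.
elim=> {s t} /=.
- by [].
- by move=> x y _ IH phi A; rewrite IH.
- by move=> x y z _ IH1 _ IH2 phi A; rewrite IH1 // IH2.
- by move=> x x' y y' _ IH1 _ IH2 phi A; rewrite IH1 // IH2.
- by move=> x x' _ IH phi A; rewrite IH.
- move=> x x' y y' _ IH1 _ IH2 phi A; rewrite IH1 // IH2 //.
  exact: admissible_vact.
- by move=> x y z phi A; apply: fe => w j; ring.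
- by move=> x y phi A; apply: fe => w j; ring.
- by move=> x phi A; apply: fe => w j; ring.
- by move=> x phi A; apply: fe => w j; ring.
- by [].
- move=> x phi A; congr vact; apply: fe => w j; ring.
- by move=> x phi A; apply: fe => w j; ring.
- by move=> x y z phi A; rewrite vact_add.
- by move=> x y z phi A.
- by move=> a b phi A; apply: fe => w j; ring.
- by move=> a b phi A; apply: fe => w j; ring.
- by move=> a x phi A; rewrite vact_scale.
- by move=> n phi A; have := vact_scale (VL K n) c phi.
- move=> m n phi A; apply: fe => w j.
  have := bracket_admissible c h m n phi w j A; rewrite /bracket_at => ->.
  have := vact_scale (VL K (m + n)) (m - n)%:~R phi => /= ->.
  by rewrite /cocycle; congr (_ + _); exact: mulrCA.
Qed.

Definition Uact (x : Uvir K) (phi : form) : form := vact (Urep x) phi.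

Lemma Uact_pi t phi : admissible phi -> Uact (Upi t) phi = vact t phi.
Proof. by move=> A; apply: vact_eq => //; exact: Urep_pi. Qed.

Lemma UactL n phi : admissible phi -> Uact (L K n) phi = dact n phi.
Proof. exact: Uact_pi. Qed.

Lemma UactM x y phi : admissible phi -> Uact (x * y) phi = Uact y (Uact x phi).
Proof.
move=> A; rewrite -[x]UrepK -[y]UrepK /GRing.mul/= UmulE !Uact_pi //.
exact: admissible_vact.
Qed.

Lemma UactD x y phi : admissible phi ->
  Uact (x + y) phi = fun w j => Uact x phi w j + Uact y phi w j.
Proof.
by move=> A; rewrite -[x]UrepK -[y]UrepK /GRing.add/= UaddE !Uact_pi.
Qed.

Lemma UactA a phi : admissible phi ->
  Uact (a%:A) phi = fun w j => a * phi w j.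
Proof.
move=> A; rewrite /GRing.scale/= /GRing.one/= UscaleE Uact_pi //=.
by apply/funext => w; apply/funext => j; rewrite mul1r.
Qed.

Lemma Uact1 phi : admissible phi -> Uact 1 phi = phi.
Proof.
move=> A; have -> : (1 : Uvir K) = 1%:A by rewrite scale1r.
rewrite UactA //; by apply/funext => w; apply/funext => j; rewrite mul1r.
Qed.

Lemma UactC phi : admissible phi -> Uact (cc K) phi = fun w j => c * phi w j.
Proof. exact: Uact_pi. Qed.

Lemma admissible_Uact x phi : admissible phi -> admissible (Uact x phi).
Proof. exact: admissible_vact. Qed.

Lemma Uact0 phi w j : admissible phi -> Uact 0 phi w j = 0.
Proof.
move=> A; have -> : (0 : Uvir K) = 0%:A by rewrite scale0r.
by rewrite UactA // mul0r.
Qed.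

End EnvelopingAction.

Section Pairing.
Context {K : numClosedFieldType} {c h : K} {k : nat}.
Local Notation form := (seq nat -> nat -> K).
Local Notation Uact := (Uact c h).

(** The functional phi evaluated at sum_i v_i (x) u_(i+1). *)
Definition row_pair (phi : form) (v : 'rV[Uvir K]_k) : K :=
  \sum_(i < k) Uact (v 0 i) phi [::] i.+1.

Lemma row_pairP phi a u v : admissible phi ->
  row_pair phi (a *: u + v) = row_pair (Uact a phi) u + row_pair phi v.
Proof.
move=> A; rewrite /row_pair -big_split /=; apply: eq_bigr => i _.
by rewrite !mxE UactD // UactM.
Qed.

Lemma row_pairK phi (a : K) u v : admissible phi ->
  row_pair phi (a ⋆ u + v) = a * row_pair phi u + row_pair phi v.
Proof.
move=> A; rewrite row_pairP // UactA //; congr (_ + _).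
by rewrite /row_pair mulr_sumr; apply: eq_bigr => i _; rewrite /Uact vact_scale.
Qed.

Lemma row_pair_jvec phi a j : admissible phi ->
  row_pair phi (a *: jvec K k j) =
  if (1 <= j <= k)%N then Uact a phi [::] j else 0.
Proof.
move=> A; rewrite /row_pair; under eq_bigr do rewrite !mxE.
case: ifP => [/andP[j1 jk]|jk].
  have j1k : (j.-1 < k)%N by lia.
  rewrite (bigD1 (Ordinal j1k)) //= big1 => [|i /eqP ij].
    by rewrite prednK // eqxx mulr1 addr0.
  case: eqP => [E|_]; last by rewrite mulr0 Uact0.
  by case: ij; apply: val_inj => /=; lia.
rewrite big1 // => i _; case: eqP => [E|_]; last by rewrite mulr0 Uact0.
by have := ltn_ord i; lia.
Qed.

Definition row_ann : set 'rV[Uvir K]_k :=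
  [set v | forall phi, admissible phi -> row_pair phi v = 0].

Lemma row_ann_submod : is_submod row_ann.
Proof.
split=> [phi A|a u v Hu Hv phi A].
  by rewrite /row_pair big1 // => i _; rewrite mxE Uact0.
by rewrite row_pairP // Hu ?Hv ?addr0 //; exact: admissible_Uact.
Qed.

(** The relations defining the induced module hold for the action on functionals
    by the very values of dact at the empty word. *)
Lemma ind_submod_ann : smset (ind_submod c h k) `<=` row_ann.
Proof.
move=> v; apply; first exact: row_ann_submod.
move=> {}v [j /andP[j1 jk]] [n n0|/=|/=] phi A /=.
- rewrite row_pair_jvec // j1 jk UactL //.
  by case: n n0 => // -[].
- have -> : L K 0 *: jvec K k j - (h ⋆ jvec K k j + jvec K k j.-1) =
      (-1) ⋆ (h ⋆ jvec K k j + jvec K k j.-1) + L K 0 *: jvec K k j.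
    by rewrite scaleN1r scaleN1r addrC.
  rewrite row_pairK // row_pairK // row_pair_jvec // j1 jk UactL //.
  rewrite -[jvec K k j]scale1r -[jvec K k j.-1]scale1r !row_pair_jvec //.
  rewrite !Uact1 // j1 jk /=; case: j j1 jk => // -[|j] _ jk /=; first ring.
  by rewrite (ltnW jk); ring.
- have -> : cc K *: jvec K k j - c ⋆ jvec K k j =
      (- c) ⋆ jvec K k j + cc K *: jvec K k j.
    by rewrite scaleNr scaleNr addrC.
  rewrite row_pairK // -[X in _ * row_pair _ X + _]scale1r !row_pair_jvec //.
  by rewrite j1 jk Uact1 // UactC //=; ring.
Qed.

(** The evaluation of an admissible functional on M(c,h,k), well defined by the
    previous lemma. *)
Definition pair (phi : form) (x : M c h k) : K :=
  row_pair phi (repr (x : Quotient.quot (smzmod (ind_submod c h k)))).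

Lemma pair_proj phi v : admissible phi ->
  pair phi (projmod (ind_submod c h k) v) = row_pair phi v.
Proof.
move=> A; rewrite /pair; set u := repr _.
have /eq_projmod/ind_submod_ann/(_ phi A) :
    projmod (ind_submod c h k) u = projmod (ind_submod c h k) v.
  exact: projmod_repr.
have -> : u - v = (-1) ⋆ v + u by rewrite scaleN1r scaleN1r addrC.
by rewrite row_pairK // mulN1r addrC => /eqP; rewrite subr_eq0 => /eqP.
Qed.

Lemma projmodP (x : M c h k) : exists v, x = projmod (ind_submod c h k) v.
Proof.
by exists (repr (x : Quotient.quot (smzmod (ind_submod c h k)))); rewrite projmod_repr.
Qed.

Lemma pairK phi (a : K) (x y : M c h k) : admissible phi ->
  pair phi (a ⋆ x + y) = a * pair phi x + pair phi y.
Proof.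
move=> A; have [u ->] := projmodP x; have [v ->] := projmodP y.
by rewrite -linearP !pair_proj // row_pairK.
Qed.

Lemma pair_act phi (y : Uvir K) (x : M c h k) : admissible phi ->
  pair phi (y *: x) = pair (Uact y phi) x.
Proof.
move=> A; have [u ->] := projmodP x; rewrite -linearZ.
rewrite !pair_proj //; last exact: admissible_Uact.
rewrite /row_pair; apply: eq_bigr => i _; by rewrite mxE UactM.
Qed.

Lemma pair_ugen phi j : admissible phi ->
  pair phi (ugen c h k j) = if (1 <= j <= k)%N then phi [::] j else 0.
Proof.
move=> A; rewrite /ugen pair_proj // -[jvec K k j]scale1r row_pair_jvec //.
by rewrite Uact1.
Qed.

Lemma pair0 phi : admissible phi -> pair phi 0 = 0.
Proof.
move=> A; have -> : 0 = projmod (ind_submod c h k) 0 by rewrite linear0.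
by rewrite pair_proj // /row_pair big1 // => i _; rewrite mxE Uact0.
Qed.

Lemma pair_sum phi (I : Type) (r : seq I) (P : pred I) (a : I -> K) (x : I -> M c h k) :
  admissible phi ->
  pair phi (\sum_(i <- r | P i) a i ⋆ x i) = \sum_(i <- r | P i) a i * pair phi (x i).
Proof.
move=> A; elim/big_rec2: _ => [|i y z _ <-]; first exact: pair0.
by rewrite pairK.
Qed.

End Pairing.

(** * Linear independence of the PBW vectors *)

Section PBWIndependence.
Context {K : numClosedFieldType} {c h : K} {k : nat}.
Local Notation form := (seq nat -> nat -> K).

Definition negword (w : seq nat) : Uvir K := \prod_(b <- w) L K (Negz b).

Definition pbw_word {l} (m : partition_of l) : seq nat :=
  flatten [seq nseq (val m i) (val i) | i <- index_enum 'I_l].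

Lemma pbw_negword {l} (m : partition_of l) : pbw K m = negword (pbw_word m).
Proof.
rewrite /pbw /negword /pbw_word big_flatten /= !big_map.
by apply: eq_bigr => i _; rewrite big_nseq -NegzE -Monoid.iteropE.
Qed.

Lemma count_pbw_word {l} (m : partition_of l) (i : 'I_l) :
  count_mem (val i) (pbw_word m) = val m i.
Proof.
rewrite /pbw_word count_flatten -map_comp sumnE big_map /=.
rewrite (bigD1 i) //= big1 => [|j ji]; first by rewrite count_nseq /= eqxx mul1n addn0.
by rewrite count_nseq /= (inj_eq val_inj) (negPf ji).
Qed.

Lemma pbw_word_inj {l} (m m' : partition_of l) :
  (forall x, count_mem x (pbw_word m) = count_mem x (pbw_word m')) -> m = m'.
Proof.
move=> E; apply: val_inj; apply/ffunP => i; apply: val_inj.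
by rewrite /= -!count_pbw_word.
Qed.

Lemma Uact_negword w phi : admissible phi ->
  Uact c h (negword w) phi = fun u => phi (w ++ u).
Proof.
rewrite /negword; elim: w phi => [|b w IH] phi A; first by rewrite big_nil Uact1.
have A' := admissible_dact c h (Negz b) phi A.
by rewrite big_cons UactM // UactL // IH // dact_negz.
Qed.

Definition vfform {r} (d : 'I_r -> nat) (j0 : nat) : form :=
  fun w j => if j == j0 then (vfcoef w d)%:R else 0.

Lemma admissible_vfform r (d : 'I_r -> nat) j0 : admissible (vfform d j0).
Proof.
move=> u a b w j; rewrite /vfform; case: eqP => _; first exact: vfcoef_bracket.
by rewrite subrr mulr0.
Qed.

(** Among the monomials with nonzero coefficient at u_j choose one of maximal
    length r, and take the functional that reads off, at u_j, the coefficient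
    with the parts of this monomial as exponents. It vanishes on shorter
    monomials, which reach fewer than r variables, and on the other monomials of
    length r, which are different multisets. *)
Theorem pbw_independent l (x : nat -> 'I_(npart l) -> K) :
  \sum_(1 <= j < k.+1) \sum_a x j a ⋆ (pbw K (enum_val a) *: ugen c h k j) = 0 ->
  forall j a, (1 <= j <= k)%N -> x j a = 0.
Proof.
move=> S0 j a jk; apply/eqP; apply: contraT => xja.
pose len (a : 'I_(npart l)) := size (pbw_word (enum_val a)).
case: (@arg_maxnP _ a (fun a => x j a != 0) len xja) => a0 xa0 maxa0.
set w0 := pbw_word (enum_val a0).
set phi := vfform (word_expo w0) j.
have A : admissible phi by exact: admissible_vfform.
have pairE i b : (1 <= i <= k)%N ->
    pair phi (pbw K (enum_val b) *: ugen c h k i) = phi (pbw_word (enum_val b)) i.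
  move=> ik; rewrite pair_act // pair_ugen; last exact: admissible_Uact.
  by rewrite ik pbw_negword Uact_negword // cats0.
have := congr1 (pair phi) S0; rewrite pair0 //.
have -> : \sum_(1 <= i < k.+1) \sum_b x i b ⋆ (pbw K (enum_val b) *: ugen c h k i)
  = \sum_(1 <= i < k.+1) 1 ⋆ (\sum_b x i b ⋆ (pbw K (enum_val b) *: ugen c h k i)).
  by apply: eq_bigr => i _; rewrite !scale1r.
rewrite pair_sum // (bigD1_seq j) /=; last 2 first.
- by rewrite mem_index_iota; lia.
- exact: iota_uniq.
rewrite [X in _ + X]big_nat_cond [X in _ + X]big1 ?addr0 => [|i /andP[ik ij]]; last first.
  rewrite pair_sum // big1 ?mulr0 // => b _; rewrite pairE; last by lia.
  by rewrite /phi /vfform (negPf ij) mulr0.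
rewrite mul1r pair_sum // (bigD1 a0) //= big1 ?addr0 => [|b ba0]; last first.
  rewrite pairE // /phi /vfform eqxx.
  case: (eqVneq (x j b) 0) => [->|xb]; first by rewrite mul0r.
  case: (eqVneq (vfcoef (pbw_word (enum_val b)) (word_expo w0)) 0%N) => [->|].
    by rewrite mulr0.
  case/vfcoef_support => _ H; case/eqP: ba0.
  apply: enum_val_inj; apply: pbw_word_inj => y; rewrite H ?card_word_expo //.
  by rewrite card_expo_supp_word; exact: maxa0.
rewrite pairE // /phi /vfform eqxx => /eqP; rewrite mulf_eq0 (negPf xa0) /=.
rewrite pnatr_eq0 (negPf (vfcoef_neq0 _ _ _)) // => y.
by rewrite card_word_expo.
Qed.

End PBWIndependence.

(** * The radical of the degree zero pairing *)

Section DegreeZero.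
Context {K : numClosedFieldType} {c h : K}.
Local Notation form := (seq nat -> nat -> K).

Definition weight (w : seq nat) : int := \sum_(b <- w) b.+1%:Z.

Definition of_degree (d : int) (phi : form) :=
  forall w j, weight w != d -> phi w j = 0.

(** If phi lives on words of weight d, then w contributes to phi (L_n w) only
    when it has weight d + n. *)
Lemma of_degree_dact n d phi :
  of_degree d phi -> of_degree (d + n) (dact c h n phi).
Proof.
move=> D w j; elim: w n d phi D => [|b w IH] [n|a] d phi D wd.
- rewrite /=; case: (n =P 0%N) => // n0; move: wd; rewrite /weight big_nil n0 => wd.
  have E w j' : w = [::] -> phi w j' = 0.
    by move=> ->; apply: D; rewrite /weight big_nil; move: wd; rewrite addr0.
  by rewrite !E //; case: ifP; rewrite ?mulr0 addr0.
- rewrite dact_negz; apply: D; apply: contraNneq wd.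
  by rewrite /weight !big_cons big_nil => <-; apply/eqP; lia.
- move: wd; rewrite /weight big_cons -/(weight w) => wd.
  have Db : of_degree (d - b.+1%:Z) (fun u => phi (b :: u)).
    move=> u i ud; apply: D; apply: contraNneq ud.
    by rewrite /weight big_cons => <-; rewrite [X in _ == X]addrC addKr.
  rewrite /= (IH _ _ _ Db); last by apply: contraNneq wd => ->; apply/eqP; lia.
  rewrite (IH _ _ _ D); last by apply: contraNneq wd => ->; apply/eqP; lia.
  rewrite mulr0 !add0r /cocycle; case: eqP => [nb|]; last by rewrite mul0r.
  rewrite D ?mulr0 //; apply: contraNneq wd => ->; apply/eqP; lia.
- rewrite dact_negz; apply: D; apply: contraNneq wd.
  by rewrite /weight big_cons => <-; rewrite NegzE [X in _ == X]addrAC subrr add0r.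
Qed.

Lemma of_degree_Lword s d phi : admissible phi -> of_degree d phi ->
  of_degree (d + \sum_(n <- s) n) (Uact c h (Lword K s) phi).
Proof.
rewrite /Lword; elim: s d phi => [|n s IH] d phi A D.
  by rewrite !big_nil addr0 Uact1.
rewrite !big_cons addrA UactM // UactL //; apply: IH; first exact: admissible_dact.
exact: of_degree_dact.
Qed.

(** The coordinate of the degree zero component at u_j0. *)
Definition top_form (j0 : nat) : form :=
  fun w j => ((w == [::]) && (j == j0))%:R.

Lemma admissible_top_form j0 : admissible (top_form j0).
Proof. by move=> [|x u] a b w j; rewrite /top_form subrr mulr0. Qed.

Lemma of_degree_top_form j0 : of_degree 0 (top_form j0).
Proof.
by move=> [|b w] j; rewrite /top_form // /weight big_nil eqxx.
Qed.

Lemma pair_Kspan0 k phi (G : set (M c h k)) x : admissible phi ->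
  (forall g, G g -> pair phi g = 0) -> Kspan G x -> pair phi x = 0.
Proof.
move=> A G0 [n [a [g [Gg ->]]]]; rewrite pair_sum // big1 // => i _.
by rewrite G0 ?mulr0.
Qed.

Lemma pair_zero_deg0 k j0 (x : M c h k) :
  zero_deg0 x -> pair (top_form j0) x = 0.
Proof.
have A := admissible_top_form j0; apply: pair_Kspan0 => // y [l /= l0].
apply: pair_Kspan0 => // _ [s [j [sl ->]]].
rewrite pair_act // pair_ugen; last exact: admissible_Uact.
have D := of_degree_Lword s 0 (top_form j0) A (of_degree_top_form j0).
case: ifP => // _; apply: D; rewrite /weight big_nil add0r eq_sym.
by apply: contra_neq l0 => E; rewrite -sl E oppr0.
Qed.

(** phi is a functional on the quotient of M(c,h,k) by the submodule generated by
    the u_j with j < j0, and restricts to psi on the copy of M(c,h) generated by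
    u_j0 in this quotient. *)
Definition leading (j0 : nat) (phi psi : form) :=
  (forall w j, (j < j0)%N -> phi w j = 0) /\ (forall w, phi w j0 = psi w 1%N).

Lemma leading_dact j0 n phi psi : (0 < j0)%N -> leading j0 phi psi ->
  leading j0 (dact c h n phi) (dact c h n psi).
Proof.
move=> j00; suff H w : forall n phi psi, leading j0 phi psi ->
    (forall j, (j < j0)%N -> dact c h n phi w j = 0) /\
    dact c h n phi w j0 = dact c h n psi w 1%N.
  by move=> P; split=> [w|w]; have [] := H w n phi psi P.
elim: w {n phi psi} => [|b w IH] [n|a] phi psi [P0 P1]; try by split=> [j|] /=; auto.
- split=> [j jj0|] /=; case: (n =P 0%N) => // _.
    have -> : phi [::] j.-1 = 0 by apply: P0; lia.
    by rewrite P0 // if_same mulr0 addr0.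
  by rewrite P1; case: ifP => // _; rewrite P0 //; lia.
- have Pb : leading j0 (fun u => phi (b :: u)) (fun u => psi (b :: u)).
    by split=> [u j jj0|u]; [exact: P0|exact: P1].
  have [H1 H2] := IH n%:Z _ _ Pb; have [H3 H4] := IH (n%:Z + Negz b) phi psi (conj P0 P1).
  split=> [j jj0|] /=; first by rewrite H1 // H3 // P0 // !mulr0 !addr0.
  by rewrite H2 H4 P1.
Qed.

Lemma leading_Uact j0 y phi psi : (0 < j0)%N -> leading j0 phi psi ->
  leading j0 (Uact c h y phi) (Uact c h y psi).
Proof.
move=> j00; rewrite /Uact; elim: (Urep y) phi psi => {y}
  [n||a|s IHs t IHt|s IHs|s IHs t IHt] phi psi P /=.
- exact: leading_dact.
- by have [P0 P1] := P; split=> [w j jj0|w]; [rewrite P0 // mulr0|rewrite P1].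
- by have [P0 P1] := P; split=> [w j jj0|w]; [rewrite P0 // mulr0|rewrite P1].
- have [s0 s1] := IHs _ _ P; have [t0 t1] := IHt _ _ P.
  by split=> [w j jj0|w]; [rewrite s0 // t0 // addr0|rewrite s1 t1].
- have [s0 s1] := IHs _ _ P.
  by split=> [w j jj0|w]; [rewrite s0 // oppr0|rewrite s1].
- exact/IHt/IHs.
Qed.

End DegreeZero.

Lemma family_sumB {K : numClosedFieldType} {V : lmodType (Uvir K)} (n k : nat)
    (e : nat -> 'I_n -> V) (x y : nat -> 'I_n -> K) :
  \sum_(1 <= j < k) \sum_a y j a ⋆ e j a = \sum_(1 <= j < k) \sum_a x j a ⋆ e j a ->
  \sum_(1 <= j < k) \sum_a (y j a - x j a) ⋆ e j a = 0.
Proof.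
move=> E; transitivity (\sum_(1 <= j < k) \sum_a y j a ⋆ e j a -
                       \sum_(1 <= j < k) \sum_a x j a ⋆ e j a);
  last by rewrite E subrr.
rewrite -sumrB; apply: eq_bigr => i _; rewrite -sumrB.
by apply: eq_bigr => b _; rewrite scalerBl scalerBl.
Qed.

Section Radical.
Context {K : numClosedFieldType} {c h : K}.

(** The submodule generated by x is not contained in the radical, which is zero,
    so it is not proper. *)
Lemma Verma_irreducible (x : Verma c h) : Verma_eq_Lirr c h -> x <> 0 ->
  exists y : Uvir K, y *: x = vac c h.
Proof.
move=> [g gK _] x0.
pose S := [set v : Verma c h | exists y : Uvir K, y *: x = v].
have Ssub : is_submod S.
  split=> [|a _ _ [y <-] [z <-]]; first by exists 0; rewrite scale0r.
  by exists (a * y + z); rewrite scalerDl scalerA.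
case: (pselect (S = setT)) => [ST|SNT]; first by have : S (vac c h) by rewrite ST.
case: x0; apply: (can_inj gK); apply/eq_projmod; rewrite subr0.
by move=> T Tsub; apply; exists (Submodule Ssub); split=> //; exists 1; rewrite scale1r.
Qed.

(** With j0 the highest Jordan index that occurs and wbar the j0-part of the
    vector, moved to M(c,h), choose y with y wbar = 1_(c,h). The degree zero
    coordinate of y w at u_j0 only depends on wbar and equals 1, whereas w in J
    forces it to vanish. *)
Lemma pbw_J_trivial k l (x : nat -> 'I_(npart l) -> K) : Verma_eq_Lirr c h ->
  Jset (\sum_(1 <= j < k.+1) \sum_a x j a ⋆ (pbw K (enum_val a) *: ugen c h k j)) ->
  forall j a, (1 <= j <= k)%N -> x j a = 0.
Proof.
move=> irr Jw j a jk; apply/eqP; apply: contraT => xja.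
pose P (i : 'I_k.+1) := (1 <= i)%N && [exists b, x i b != 0].
have jk1 : (j < k.+1)%N by lia.
have Pj : P (Ordinal jk1).
  by apply/andP; split; [by case/andP: jk|apply/existsP; exists a].
case: (@arg_maxnP _ _ P (@nat_of_ord _) Pj) => j0 /andP[j01 /existsP[b xb]] maxj.
pose wbar : Verma c h := \sum_a x j0 a ⋆ (pbw K (enum_val a) *: vac c h).
have wbar0 : wbar <> 0.
  move=> w0; case/eqP: xb; apply: (@pbw_independent _ c h 1 l (fun _ => x j0) _ 1%N) => //.
  by rewrite big_nat1.
have [y yw] := Verma_irreducible _ irr wbar0.
have At i : admissible (top_form i : seq nat -> nat -> K) := admissible_top_form i.
have Ay i : admissible (Uact c h y (top_form i)) by exact: admissible_Uact.
have L : leading j0 (Uact c h y (top_form j0)) (Uact c h y (top_form 1)).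
  apply: leading_Uact => //; split=> [w i ij|w]; rewrite /top_form ?eqxx //.
  by rewrite (ltn_eqF ij) andbF.
have pairE k' i j' (d : 'I_(npart l)) : (1 <= j' <= k')%N ->
    pair (Uact c h y (top_form i)) (pbw K (enum_val d) *: ugen c h k' j') =
    Uact c h (pbw K (enum_val d)) (Uact c h y (top_form i)) [::] j'.
  move=> jk'; rewrite pair_act // pair_ugen ?jk' //; exact: admissible_Uact.
have L' (d : 'I_(npart l)) : leading j0
    (Uact c h (pbw K (enum_val d)) (Uact c h y (top_form j0)))
    (Uact c h (pbw K (enum_val d)) (Uact c h y (top_form 1))).
  exact: leading_Uact.
have := pair_zero_deg0 k j0 _ (Jw y); rewrite pair_act //.
set S := \sum_(1 <= i < k.+1) _.
have -> : S = \sum_(1 <= i < k.+1)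
    1 ⋆ (\sum_b x i b ⋆ (pbw K (enum_val b) *: ugen c h k i)).
  by apply: eq_bigr => i _; rewrite !scale1r.
rewrite pair_sum // (bigD1_seq (val j0)) /=; last 2 first.
- by rewrite mem_index_iota; have := ltn_ord j0; lia.
- exact: iota_uniq.
rewrite [X in _ + X]big_nat_cond [X in _ + X]big1 ?addr0 => [|i /andP[ik ij]]; last first.
  rewrite pair_sum // big1 ?mulr0 // => d _; rewrite pairE; last by lia.
  case: (ltnP i j0) => ij0; first by rewrite (L' d).1 ?mulr0.
  have ik1 : (i < k.+1)%N by lia.
  case: (eqVneq (x i d) 0) => [->|xd]; first by rewrite mul0r.
  have : P (Ordinal ik1) by apply/andP; split; [by case/andP: ik|apply/existsP; exists d].
  by move/maxj => /=; lia.
rewrite mul1r pair_sum //.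
have -> : \sum_i x j0 i * pair (Uact c h y (top_form j0)) (pbw K (enum_val i) *: ugen c h k j0)
  = pair (top_form 1) (y *: wbar).
  rewrite pair_act // pair_sum //; apply: eq_bigr => d _.
  rewrite pairE ?(L' d).2; last by have := ltn_ord j0; lia.
  by rewrite /vac pairE.
by rewrite yw /vac pair_ugen //= /top_form eqxx => /eqP; rewrite oner_eq0.
Qed.

Lemma pbw_basis_independent k l (x : nat -> 'I_(npart l) -> K) : Verma_eq_Lirr c h ->
  \sum_(1 <= j < k.+1) \sum_a x j a ⋆ pbw_basis c h k j a = 0 ->
  forall j a, (1 <= j <= k)%N -> x j a = 0.
Proof.
move=> irr S0; apply: pbw_J_trivial irr _.
set w := \sum_(1 <= j < k.+1) _.
have : projmod (J c h k) w = projmod (J c h k) 0.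
  rewrite linear0 -S0 /w raddf_sum; apply: eq_bigr => j _.
  rewrite raddf_sum; apply: eq_bigr => a _.
  by rewrite /= (projmod_is_scalable (J c h k)) (projmod_is_scalable (J c h k)).
by move/eq_projmod; rewrite subr0.
Qed.

Lemma pbw_coordE k l (x : nat -> 'I_(npart l) -> K) j a : Verma_eq_Lirr c h ->
  (1 <= j <= k)%N ->
  pbw_coord (\sum_(1 <= j < k.+1) \sum_a x j a ⋆ pbw_basis c h k j a) j a = x j a.
Proof.
move=> irr jk; rewrite /pbw_coord.
case: xgetP => [y _ /= /esym E|/(_ x)]; last by case.
pose z j a := y j a - x j a.
have H := family_sumB _ _ _ _ _ E.
by have /eqP := @pbw_basis_independent k l z irr H j a jk; rewrite subr_eq0 => /eqP.
Qed.

End Radical.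

(** * Spanning and dimensions *)

Section KSpan.
Context {K : numClosedFieldType} {V : lmodType (Uvir K)}.
Implicit Types (G H S : set V).

Lemma KspanZ G (a : K) v : Kspan G v -> Kspan G (a ⋆ v).
Proof.
move=> [n [b [g [Gg ->]]]]; exists n, (fun i => a * b i), g; split=> //.
rewrite scaler_sumr; apply: eq_bigr => i _.
by rewrite scalerA -scalerAl mul1r scalerA.
Qed.

Lemma Kspan_trans G H : G `<=` Kspan H -> Kspan G `<=` Kspan H.
Proof.
move=> GH _ [n [a [g [Gg ->]]]]; elim/big_ind: _; [exact: Kspan0| |].
  by move=> x y; exact: KspanD.
by move=> i _; apply: KspanZ; exact: GH.
Qed.

Lemma Kspan_range n (e : 'I_n -> V) v : Kspan (range e) v ->
  exists a : 'I_n -> K, v = \sum_i a i ⋆ e i.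
Proof.
move=> [m [b [g [Gg ->]]]].
have /boolp.choice [f fE] : forall i, exists j, g i = e j.
  by move=> i; have [j _ <-] := Gg i; exists j.
exists (fun j => \sum_(i | f i == j) b i).
rewrite (partition_big f xpredT) //=; apply: eq_bigr => j _.
rewrite !scaler_suml; apply: eq_bigr => i /eqP <-.
by rewrite fE.
Qed.

(** If n > m, the n x m matrix of coordinates has a nonzero row kernel, that is, a
    linear relation among the e_i. *)
Lemma Kindependent_le S n m (e : 'I_n -> V) (f : 'I_m -> V) :
  (forall i, S (e i)) -> Kindependent e -> S `<=` Kspan (range f) -> (n <= m)%N.
Proof.
move=> Se ie sf.
have /boolp.choice [A AE] : forall i, exists a : 'I_m -> K, e i = \sum_j a j ⋆ f j.
  by move=> i; apply: Kspan_range; exact: sf.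
pose B := \matrix_(i, j) A i j.
suff : row_free B by move/eqP <-; exact: rank_leq_col.
rewrite -kermx_eq0; apply/rowV0P => x /sub_kermxP xB.
apply/rowP => i; rewrite mxE; apply: ie.
under eq_bigr => j _ do rewrite AE scaler_sumr.
rewrite exchange_big /= big1 // => j _.
have := congr1 (fun M : 'rV[K]_m => M 0 j) xB; rewrite !mxE => E.
transitivity ((\sum_i x 0 i * B i j) ⋆ f j); last by rewrite E scale0r scale0r.
rewrite !scaler_suml; apply: eq_bigr => a _.
by rewrite scalerA -scalerAl mul1r scalerA mxE.
Qed.

Lemma Kdim_basis S n (e : 'I_n -> V) : is_Kbasis S e -> Kdim S = n.
Proof.
move=> [Se ie se]; rewrite /Kdim; case: xgetP => [m _ [f [Sf jf sf]]|/(_ n)].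
  apply/eqP; rewrite eqn_leq.
  by rewrite (Kindependent_le _ _ _ _ _ Sf jf se) (Kindependent_le _ _ _ _ _ Se ie sf).
by case; exists e.
Qed.

End KSpan.

Section HighestWeightSpan.
Context {K : numClosedFieldType} {V : lmodType (Uvir K)}.
Variables (c h : K) (u : V).
Hypothesis u_pos : forall n : nat, L K n.+1 *: u = 0.
Hypothesis u_L0 : L K 0 *: u = h ⋆ u.
Hypothesis u_c : cc K *: u = c ⋆ u.

Lemma scaleL_comm (a : K) (y : Uvir K) (v : V) : y *: (a ⋆ v) = a ⋆ (y *: v).
Proof. by rewrite !scalerA -scalerAr mulr1 -scalerAl mul1r. Qed.

Lemma scale_alg (a : K) (y : Uvir K) (v : V) : (a *: y) *: v = a ⋆ (y *: v).
Proof. by rewrite scalerA -scalerAl mul1r. Qed.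

Definition negspan (d : int) : set V :=
  Kspan [set v | exists2 w, weight w = d & v = negword w *: u].

Lemma weight_cons b w : weight (b :: w) = b.+1%:Z + weight w.
Proof. by rewrite /weight big_cons. Qed.

Lemma negword_cons b w : negword (b :: w) = L K (Negz b) * negword w :> Uvir K.
Proof. by rewrite /negword big_cons. Qed.

Lemma negspan_neg b d v : negspan d v -> negspan (d - Negz b) (L K (Negz b) *: v).
Proof.
move=> [n [a [g [Gg ->]]]]; exists n, a, (fun i => L K (Negz b) *: g i); split.
  move=> i; have [w wd ->] := Gg i; exists (b :: w); last by rewrite negword_cons scalerA.
  by rewrite weight_cons wd NegzE opprK addrC.
by rewrite scaler_sumr; apply: eq_bigr => i _; rewrite scaleL_comm.
Qed.

Lemma cc_negword w : cc K *: (negword w *: u) = c ⋆ (negword w *: u).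
Proof.
elim: w => [|b w IH]; first by rewrite /negword big_nil scale1r.
rewrite negword_cons -!scalerA -(scaleL_comm c) -IH [LHS]scalerA [RHS]scalerA.
by rewrite cc_central.
Qed.

Lemma bracket_act m n (v : V) : L K m *: (L K n *: v) =
  L K n *: (L K m *: v) + (m - n)%:~R ⋆ (L K (m + n) *: v)
  + (cocycle m n : K) ⋆ (cc K *: v).
Proof.
have := congr1 (fun x => x *: v) (vir_bracket K m n).
rewrite scalerBl scalerDl -!scalerA => /eqP; rewrite subr_eq => /eqP ->.
rewrite (scale_alg _ (L K (m + n))) (scale_alg _ (cc K)) /cocycle.
set A := L K n *: _; set B := _ ⋆ _; set C := _ ⋆ _.
by rewrite [RHS]addrAC [A + C]addrC -addrA [A + B]addrC addrA [C + B]addrC.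
Qed.

(** Commute L_n with n >= 0 to the right through the word; each bracket gives a
    mode of smaller index applied to a shorter word. *)
Lemma negspan_word w : forall n : int, negspan (weight w - n) (L K n *: (negword w *: u)).
Proof.
elim: w => [|b w IH] [n|a].
- rewrite /negword big_nil scale1r; case: n => [|n]; last by rewrite u_pos; exact: Kspan0.
  rewrite u_L0; apply: KspanZ; apply: Kspan_incl; exists [::].
    by rewrite subr0.
  by rewrite /negword big_nil scale1r.
- apply: negspan_neg; apply: Kspan_incl; exists [::] => //.
- rewrite negword_cons -scalerA bracket_act weight_cons; apply: KspanD; first apply: KspanD.
  + have := negspan_neg b (weight w - n%:Z) _ (IH n%:Z).
    by congr (negspan _ _); rewrite NegzE; lia.
  + apply: KspanZ; have := IH (n%:Z + Negz b).
    by congr (negspan _ _); rewrite NegzE; lia.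
  + rewrite cc_negword /cocycle; case: eqP => [nb|_]; last first.
      by rewrite scale0r scale0r; exact: Kspan0.
    do 2! apply: KspanZ; apply: Kspan_incl; exists w => //.
    by move: nb; rewrite NegzE; lia.
- by apply: negspan_neg; apply: Kspan_incl; exists (b :: w).
Qed.

Lemma negspan_L n d v : negspan d v -> negspan (d - n) (L K n *: v).
Proof.
move=> [r [a [g [Gg ->]]]]; rewrite scaler_sumr; elim/big_ind: _.
- exact: Kspan0.
- by move=> x y; exact: KspanD.
- move=> i _; rewrite scaleL_comm; apply: KspanZ.
  by have [w <- ->] := Gg i; exact: negspan_word.
Qed.

Lemma negspan_Lword s : negspan (- \sum_(n <- s) n) (Lword K s *: u).
Proof.
rewrite /Lword; elim: s => [|n s IH].
  rewrite !big_nil oppr0; apply: Kspan_incl; exists [::]; first by rewrite /weight big_nil.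
  by rewrite /negword big_nil.
by rewrite !big_cons -scalerA opprD addrC; exact: negspan_L.
Qed.

Definition pbw_vec l (a : 'I_(npart l)) : V := pbw K (enum_val a) *: u.

Lemma weight_count w l : (forall b, b \in w -> (b < l)%N) ->
  weight w = (\sum_(i < l) i.+1 * count_mem (val i) w)%N.
Proof.
elim: w => [|b w IH] wl /=.
  by rewrite /weight big_nil big1 // => i _; rewrite muln0.
have bl : (b < l)%N by apply: wl; rewrite mem_head.
rewrite weight_cons IH => [|x xw]; last by apply: wl; rewrite inE xw orbT.
under eq_bigr do rewrite mulnDr.
have E : (\sum_(i < l) i.+1 * (b == val i) = b.+1)%N.
  rewrite (bigD1 (Ordinal bl)) //= eqxx muln1 big1 ?addn0 // => i.
  by rewrite -val_eqE /= eq_sym => /negPf ->; rewrite muln0.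
by rewrite [X in _ = Posz X]big_split E PoszD.
Qed.

Lemma mem_weight w b : b \in w -> (b.+1%:Z <= weight w)%R.
Proof.
have wge0 s : 0 <= weight s by rewrite /weight; apply: sumr_ge0.
elim: w => //= a w IH; rewrite inE weight_cons => /orP[/eqP ->|/IH H].
  by rewrite lerDl.
by apply: le_trans H _; rewrite lerDr.
Qed.

Lemma perm_pbw_word w (l : nat) : weight w = l ->
  exists m : partition_of l, perm_eq w (pbw_word m).
Proof.
move=> wl.
have wlt b : b \in w -> (b < l)%N by move/mem_weight; rewrite wl; lia.
have wc := weight_count w l wlt.
have le_count (i : 'I_l) : (count_mem (val i) w < l.+1)%N.
  move: wc; rewrite wl => -[E]; rewrite ltnS [X in (_ <= X)%N]E (bigD1 i) //=.
  by apply: leq_trans (leq_addr _ _); rewrite leq_pmull.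
pose m : {ffun 'I_l -> 'I_l.+1} := [ffun i => Ordinal (le_count i)].
have mP : (\sum_(i < l) i.+1 * m i == l)%N.
  move: wc; rewrite wl => -[E]; rewrite [X in _ == X]E; apply/eqP.
  by apply: eq_bigr => i _; rewrite ffunE.
exists (exist _ m mP : partition_of l).
apply/allP => b _; apply/eqP.
case: (ltnP b l) => bl.
  by rewrite (count_pbw_word (exist _ m mP : partition_of l) (Ordinal bl)) /= ffunE.
rewrite (count_memPn _); last by apply/negP => /wlt; lia.
apply/esym; apply/count_memPn; apply/negP => /flattenP[s /mapP[i _ ->]].
by move/nseqP => [bi _]; have := ltn_ord i; rewrite -bi; lia.
Qed.

Lemma weight_pbw_word l (m : partition_of l) : weight (pbw_word m) = l.
Proof.
rewrite (weight_count _ l).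
  by congr Posz; rewrite -[RHS](eqP (valP m)); apply: eq_bigr => i _; rewrite count_pbw_word.
by move=> b /flattenP[s /mapP[i _ ->]] /nseqP[-> _]; exact: ltn_ord.
Qed.

Lemma negword_swap p a b q :
  negword (p ++ a :: b :: q) - negword (p ++ b :: a :: q) =
  (b%:Z - a%:Z)%:~R *: negword (p ++ (a + b).+1 :: q) :> Uvir K.
Proof.
elim: p => [|x p IH] /=; last by rewrite !negword_cons -mulrBr IH -scalerAr.
rewrite !negword_cons !mulrA -mulrBl vir_bracket /=.
have -> : Negz a + Negz b = Negz (a + b).+1 by lia.
have -> : Negz a - Negz b = b%:Z - a%:Z by lia.
by rewrite scale0r addr0 -scalerAl.
Qed.

Lemma weight_cat p q : weight (p ++ q) = weight p + weight q.
Proof. by rewrite /weight big_cat. Qed.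

(** Block exchanges, as in catCA_perm_ind, are composed of adjacent transpositions. *)
Lemma perm_ind_adjacent (P : seq nat -> Prop) :
  (forall p a b q, P (p ++ a :: b :: q) -> P (p ++ b :: a :: q)) ->
  forall s t, perm_eq s t -> P s -> P t.
Proof.
move=> Padj; apply: catCA_perm_ind.
have Pmove s : forall p a q, P (p ++ a :: s ++ q) -> P (p ++ s ++ a :: q).
  elim: s => [|b s IH] p a q //= H.
  by rewrite -cat_rcons; apply: IH; rewrite cat_rcons; exact: Padj.
suff H s1 : forall p s2 s3, P (p ++ s1 ++ s2 ++ s3) -> P (p ++ s2 ++ s1 ++ s3).
  by move=> s1 s2 s3; exact: (H s1 [::]).
elim: s1 => [|a s1 IH] p s2 s3 //= H.
by apply: Pmove; rewrite -cat_rcons; apply: IH; rewrite cat_rcons.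
Qed.

(** By induction on the length: exchanging two adjacent letters changes the word
    by a shorter one, so the word may be sorted into PBW order. *)
Lemma negword_span w (l : nat) : weight w = l ->
  Kspan (range (@pbw_vec l)) (negword w *: u).
Proof.
have [t] := ubnP (size w); elim: t w => // t IH w wt wl.
pose P v := size v = size w -> weight v = l ->
  Kspan (range (@pbw_vec l)) (negword v *: u).
suff : P w by apply.
have [m wm] := perm_pbw_word w l wl; rewrite perm_sym in wm.
apply: perm_ind_adjacent wm _ => [p a b q Hab sv wv|_ _]; last first.
  apply: Kspan_incl; exists (enum_rank m) => //.
  by rewrite /pbw_vec enum_rankK pbw_negword.
have -> : negword (p ++ b :: a :: q) = (- (b%:Z - a%:Z)%:~R) *:
   negword (p ++ (a + b).+1 :: q) + negword (p ++ a :: b :: q) :> Uvir K.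
  by rewrite scaleNr -negword_swap opprB subrK.
rewrite scalerDl (scale_alg _ (negword _)); apply: KspanD.
  apply: KspanZ; apply: IH.
    by move: wt sv; rewrite !size_cat /=; lia.
  by move: wv; rewrite !weight_cat !weight_cons; lia.
apply: Hab.
  by move: sv; rewrite !size_cat.
by move: wv; rewrite !weight_cat !weight_cons; lia.
Qed.

Lemma Lword_span (s : seq int) (l : nat) : - \sum_(n <- s) n = l%:Z ->
  Kspan (range (@pbw_vec l)) (Lword K s *: u).
Proof.
move=> sl; have := negspan_Lword s; rewrite sl; apply: Kspan_trans.
by move=> _ [w wl ->]; exact: negword_span.
Qed.

End HighestWeightSpan.

(** * The Jordan structure and the pseudo-traces *)

Section JordanAction.
Context {K : numClosedFieldType} {V : lmodType (Uvir K)}.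
Variables (h : K) (k : nat) (u : nat -> V).
Hypothesis u_L0 : forall j, (j <= k)%N -> L K 0 *: u j = h ⋆ u j + u j.-1.

Lemma L0_lower b (v : V) : L K 0 *: (L K (Negz b) *: v) =
  L K (Negz b) *: (L K 0 *: v) + (b.+1%:Z)%:~R ⋆ (L K (Negz b) *: v).
Proof.
have -> : b.+1%:Z = 0 - Negz b by rewrite NegzE sub0r opprK.
rewrite bracket_act add0r; have -> : cocycle 0 (Negz b) = 0 :> K by rewrite /cocycle add0r.
by rewrite (scale0r (1 : Uvir K)) (scale0r (cc K *: v)) addr0 add0r.
Qed.

Lemma L0_negword w j : (j <= k)%N -> L K 0 *: (negword w *: u j) =
  (h + (weight w)%:~R) ⋆ (negword w *: u j) + negword w *: u j.-1.
Proof.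
move=> jk; elim: w => [|b w IH].
  by rewrite /negword big_nil !scale1r u_L0 // /weight big_nil addr0.
have E i : negword (b :: w) *: u i = L K (Negz b) *: (negword w *: u i).
  by rewrite negword_cons scalerA.
rewrite !E L0_lower IH scalerDr scaleL_comm addrAC -scalerDl -scalerDl.
by rewrite weight_cons rmorphD /= addrA [h + _ + _]addrAC.
Qed.

Definition jordan_vec l j (a : 'I_(npart l)) : V := pbw K (enum_val a) *: u j.

Lemma L0_jordan l j a : (j <= k)%N -> L K 0 *: jordan_vec l j a =
  (h + l%:R) ⋆ jordan_vec l j a + jordan_vec l j.-1 a.
Proof. by move=> jk; rewrite /jordan_vec pbw_negword L0_negword // weight_pbw_word. Qed.

(** With the convention u_0 = 0 the index 0 is its own predecessor, so truncated
    subtraction is right also after more than j steps. *)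
Lemma iter_nilpotent l j a i : (j <= k)%N ->
  iter i (fun w : V => L K 0 *: w - (h + l%:R) ⋆ w) (jordan_vec l j a) =
  jordan_vec l (j - i)%N a.
Proof.
move=> jk; elim: i => [|i IH]; first by rewrite subn0.
rewrite iterS IH L0_jordan; last by apply: leq_trans (leq_subr _ _) jk.
by rewrite addrAC subrr add0r subnS.
Qed.

End JordanAction.

Section GeneratorRelations.
Context {K : numClosedFieldType} {c h : K} {k : nat}.

Lemma ugen_relation j v : (1 <= j <= k)%N -> ind_relation c h j v ->
  projmod (ind_submod c h k) v = 0.
Proof.
move=> jk rv; rewrite -(raddf0 (projmod (ind_submod c h k))).
by apply/eq_projmod; rewrite subr0 => S _; apply; exists j.
Qed.

Lemma ugen_out j : ~~ (1 <= j <= k)%N -> ugen c h k j = 0.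
Proof.
move=> jk; rewrite /ugen; have -> : jvec K k j = 0.
  apply/rowP => i; rewrite !mxE; case: eqP => // ij.
  by move: jk; rewrite -ij ltn_ord.
exact: raddf0.
Qed.

Lemma ugen_pos j (n : nat) : L K n.+1 *: ugen c h k j = 0.
Proof.
case: (boolP (1 <= j <= k)%N) => jk; last by rewrite ugen_out // scaler0.
rewrite /ugen -(projmod_is_scalable (ind_submod c h k)).
by apply: (ugen_relation j) => //; exact: ind_Ln.
Qed.

Lemma ugen_L0 j : (j <= k)%N ->
  L K 0 *: ugen c h k j = h ⋆ ugen c h k j + ugen c h k j.-1.
Proof.
case: j => [|j] jk; first by rewrite ugen_out // !scaler0 addr0.
have := ugen_relation j.+1 _ jk (ind_L0 c h k j.+1).
rewrite raddfB raddfD /= !(projmod_is_scalable (ind_submod c h k)).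
by move/eqP; rewrite subr_eq0 => /eqP.
Qed.

Lemma ugen_c j : cc K *: ugen c h k j = c ⋆ ugen c h k j.
Proof.
case: (boolP (1 <= j <= k)%N) => jk; last by rewrite ugen_out // !scaler0.
have := ugen_relation j _ jk (ind_c c h k j).
rewrite raddfB /= !(projmod_is_scalable (ind_submod c h k)).
by move/eqP; rewrite subr_eq0 => /eqP.
Qed.

End GeneratorRelations.

Lemma Mdeg_basis {K : numClosedFieldType} (c h : K) (l : nat) :
  is_Kbasis (@Mdeg K c h 1 l%:Z) (pbw_vec (V := Verma c h) (vac c h) l).
Proof.
split.
- move=> a; apply: Kspan_incl.
  exists [seq Negz b | b <- pbw_word (enum_val a)], 1%N; split.
    rewrite big_map; apply: etrans (weight_pbw_word l (enum_val a)); rewrite /weight -sumrN.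
    by apply: eq_bigr => b _; rewrite NegzE opprK.
  by rewrite /pbw_vec pbw_negword /Lword big_map.
- move=> a S0 i.
  apply: (@pbw_independent _ c h 1 l (fun _ => a) _ 1%N) => //.
  by rewrite big_nat1.
- apply: Kspan_trans => _ [s [j [sl ->]]].
  case: (j =P 1%N) => [->|j1].
    apply: (@Lword_span _ _ c h) => //.
    + exact: ugen_pos.
    + by rewrite ugen_L0 // [ugen c h 1 1.-1]ugen_out // addr0.
    + exact: ugen_c.
  rewrite ugen_out ?scaler0; first exact: Kspan0.
  by apply/negP; lia.
Qed.

Lemma Kdim_Mdeg {K : numClosedFieldType} (c h : K) (l : nat) :
  Kdim (@Mdeg K c h 1 l%:Z) = npart l.
Proof. exact: Kdim_basis (Mdeg_basis c h l). Qed.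

Lemma fsum_ord {K : nmodType} (F : nat -> K) n : (forall i, (n <= i)%N -> F i = 0) ->
  \sum_(i \in [set: nat]) F i = \sum_(i < n) F i.
Proof.
move=> F0; rewrite fsbig_ord; apply/esym/fsbig_widen => // i /= [_ ni].
by apply: F0; rewrite leqNgt; apply/negP.
Qed.

Lemma scale_eq0 {K : numClosedFieldType} {V : lmodType (Uvir K)} (a : K) (v : V) :
  a ⋆ v = 0 -> v <> 0 -> a = 0.
Proof.
move=> av v0; apply/eqP; apply: contraT => a0; case: v0.
have : (a^-1 * a) ⋆ v = 0 by rewrite -scalerA scale_alg av scaler0.
by rewrite mulVf // scale1r scale1r.
Qed.

Lemma scale_K0 {K : numClosedFieldType} {V : lmodType (Uvir K)} (a : K) (v : V) :
  a = 0 -> a ⋆ v = 0.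
Proof. by move=> ->; rewrite scale0r scale0r. Qed.

Lemma single_jordan {K : numClosedFieldType} {V : lmodType (Uvir K)} (n k : nat)
    (e : nat -> 'I_n -> V) (a : K) i b : (forall b, e 0%N b = 0) -> (i <= k)%N ->
  a ⋆ e i b = \sum_(1 <= j < k.+1) \sum_d (a *+ ((j == i) && (d == b))) ⋆ e j d.
Proof.
move=> e0 ik; case: i ik => [|i] ik.
  rewrite e0 scaler0 big_nat big1 // => j j1.
  by rewrite big1 // => d _; case: j j1 => // j _; rewrite /= scale0r scale0r.
rewrite (bigD1_seq i.+1) /=; last 2 first.
- by rewrite mem_index_iota.
- exact: iota_uniq.
rewrite [X in _ + X]big1 ?addr0 => [|j ji]; last first.
  by rewrite big1 // => d _; rewrite (negPf ji) /= scale0r scale0r.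
rewrite (bigD1 b) //= !eqxx mulr1n big1 ?addr0 // => d db.
by rewrite (negPf db) andbF scale0r scale0r.
Qed.

Section Module.
Context {K : numClosedFieldType} {c h : K} {k : nat}.
Hypothesis irr : Verma_eq_Lirr c h.

Lemma wgen0 : wgen c h k 0 = 0.
Proof. by rewrite /wgen ugen_out // raddf0. Qed.

Lemma wgen_L0 j : (j <= k)%N -> L K 0 *: wgen c h k j = h ⋆ wgen c h k j + wgen c h k j.-1.
Proof.
move=> jk; rewrite /wgen -!(projmod_is_scalable (J c h k)) -raddfD.
by rewrite ugen_L0.
Qed.

Lemma wgen_neq0 j : (1 <= j <= k)%N -> wgen c h k j <> 0.
Proof.
move=> jk; rewrite -(raddf0 (projmod (J c h k))) => /eq_projmod; rewrite subr0.
move=> /(_ 1) /(pair_zero_deg0 k j); rewrite scale1r pair_ugen;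
  last exact: admissible_top_form.
by rewrite jk /top_form !eqxx => /eqP; rewrite oner_eq0.
Qed.

Lemma pbw_basis0 l (a : 'I_(npart l)) : pbw_basis c h k 0 a = 0.
Proof. by rewrite /pbw_basis wgen0 scaler0. Qed.

Lemma iter_L0N l (a : 'I_(npart l)) i :
  iter i (L0N (h + l%:R)) (pbw_basis c h k k a) = pbw_basis c h k (k - i) a.
Proof. exact: (iter_nilpotent h k _ wgen_L0). Qed.

Lemma L0_pbw_basis l j (a : 'I_(npart l)) : (j <= k)%N ->
  L K 0 *: pbw_basis c h k j a =
  (h + l%:R) ⋆ pbw_basis c h k j a + pbw_basis c h k j.-1 a.
Proof. exact: (L0_jordan h k _ wgen_L0). Qed.

(** Every block of sigma in the last block column is scalar, so the trace of the
    upper right block is that scalar times the number of PBW monomials. *)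
Lemma pstr_op_jordan l (sigma : W c h k -> W c h k) (a b : K) i j :
  (2 <= k)%N -> (i <= k)%N -> (j <= k)%N ->
  (forall d : 'I_(npart l), sigma (pbw_basis c h k k d) =
     a ⋆ pbw_basis c h k i d + b ⋆ pbw_basis c h k j d) ->
  pstr_op l sigma = (a *+ (i == 1%N) + b *+ (j == 1%N)) * (npart l)%:R.
Proof.
move=> k2 ik jk sE; rewrite /pstr_op leqNgt k2 /= /mxtrace.
transitivity (\sum_(d < npart l) (a *+ (i == 1%N) + b *+ (j == 1%N))); last first.
  by rewrite sumr_const card_ord mulr_natr.
apply: eq_bigr => d _; rewrite mxE sE.
rewrite (single_jordan _ _ _ a i d (@pbw_basis0 l) ik).
rewrite (single_jordan _ _ _ b j d (@pbw_basis0 l) jk).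
rewrite -big_split /=.
pose x e (f : 'I_(npart l)) := a *+ ((e == i) && (f == d)) + b *+ ((e == j) && (f == d)).
have -> : \sum_(1 <= e < k.+1)
    (\sum_f (a *+ ((e == i) && (f == d))) ⋆ pbw_basis c h k e f +
     \sum_f (b *+ ((e == j) && (f == d))) ⋆ pbw_basis c h k e f) =
    \sum_(1 <= e < k.+1) \sum_f x e f ⋆ pbw_basis c h k e f.
  apply: eq_bigr => e _; rewrite -big_split /=; apply: eq_bigr => f _.
  by rewrite -scalerDl -scalerDl.
rewrite pbw_coordE //; last by lia.
by rewrite /x !eqxx !andbT ![(1 == _)%N]eq_sym.
Qed.

End Module.

Section ZeroModes.
Context {K : numClosedFieldType} {c : K}.

(** In characteristic 0 a nonzero vector has at most one integral weight, so the
    choice made in wt is determined. *)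
Lemma wt_unique (v : Vvir c) (d : int) : v <> 0 ->
  L K 0 *: v = (d%:~R : K) ⋆ v -> wt v = d.
Proof.
move=> v0 vd; rewrite /wt; case: xgetP => [n _ /= nd|/(_ d)]; last by case.
have /scale_eq0 : (n%:~R - d%:~R : K) ⋆ v = 0.
  by rewrite scalerBl scalerBl -nd vd subrr.
by move=> /(_ v0) /eqP; rewrite subr_eq0 eqr_int => /eqP.
Qed.

Lemma vacuum_L0 : L K 0 *: vacuum c = 0.
Proof.
rewrite /vacuum -(projmod_is_scalable (generated [set L K (-1) *: vac c 0])).
have -> : L K 0 *: vac c 0 = 0.
  rewrite /vac ugen_L0 // [ugen c 0 1 1.-1]ugen_out // addr0.
  by rewrite (scale0r (1 : Uvir K)) scale0r.
exact: raddf0.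
Qed.

Lemma omega_L0 : L K 0 *: omega c = (2%:~R : K) ⋆ omega c.
Proof.
have := L0_lower 1 (vacuum c).
by rewrite vacuum_L0 scaler0 add0r.
Qed.

Variables (X : lmodType (Uvir K)) (YV : Vvir c -> int -> Vvir c -> Vvir c).
Variable (Y : Vvir c -> int -> X -> X).
Hypothesis hY : is_Vvir_module YV Y.

Lemma mode0 n x : Y 0 n x = 0.
Proof.
have [[lin _] _ _ _ _] := hY.
have := lin 1 0 0 n x; rewrite scaler0 addr0 scale1r scale1r.
by move/eqP; rewrite -subr_eq0 opprD addrA subrr add0r oppr_eq0 => /eqP.
Qed.

(** A nonzero module shows that the vacuum is nonzero, because it acts as the
    identity; this spares an analysis of V_Vir(c,0) itself. *)
Lemma vacuum_zero_mode (x0 : X) : x0 <> 0 -> zero_mode Y (vacuum c) =1 id.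
Proof.
move=> x00 x; have [_ _ Yv _ _] := hY.
have v0 : vacuum c <> 0.
  by move=> v0; apply: x00; have := Yv (-1) x0; rewrite v0 mode0 eqxx.
rewrite /zero_mode (wt_unique _ 0 v0); first by rewrite Yv.
by rewrite vacuum_L0 (scale0r (1 : Uvir K)) scale0r.
Qed.

(** Likewise omega is nonzero as soon as its mode L_0 is. *)
Lemma omega_zero_mode (x0 : X) : L K 0 *: x0 <> 0 ->
  zero_mode Y (omega c) =1 (fun x => L K 0 *: x).
Proof.
move=> x00 x; have [_ _ _ Yw _] := hY.
have w0 : omega c <> 0.
  by move=> w0; apply: x00; rewrite -Yw w0 mode0.
by rewrite /zero_mode (wt_unique _ _ w0 omega_L0) -Yw.
Qed.

End ZeroModes.

Section Terms.
Context {R : realType} {c h : Cplx R} {k : nat}.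
Hypotheses (k2 : (2 <= k)%N) (irr : Verma_eq_Lirr c h).
Variables (YV : Vvir c -> int -> Vvir c -> Vvir c).
Variable (Y : Vvir c -> int -> W c h k -> W c h k).
Hypothesis hY : is_Vvir_module YV Y.

Lemma pstr_term_vacuum tau l : pstr_term Y (vacuum c) tau l =
  (npart l)%:R * ((k - 1)`!%:R^-1 * logq tau ^+ (k - 1) * qpow tau (h + l%:R - c / 24)).
Proof.
have w0 : wgen c h k 1 <> 0 by apply: wgen_neq0; lia.
have opE j : pstr_op l (fun w => zero_mode Y (vacuum c)
      ((j`!%:R^-1 : Cplx R) ⋆ iter j (L0N (h + l%:R)) w)) =
    (j`!%:R^-1 *+ ((k - j)%N == 1%N)) * (npart l)%:R.
  rewrite (pstr_op_jordan irr l _ (j`!%:R^-1) 0 (k - j)%N 0%N) ?leq_subr //.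
    by rewrite mulr0n addr0.
  move=> d; rewrite (vacuum_zero_mode _ _ _ hY _ w0) iter_L0N.
  by rewrite pbw_basis0 scaler0 addr0.
rewrite /pstr_term (fsum_ord _ k) => [|j kj]; last first.
  rewrite opE; have -> : (k - j == 1)%N = false by lia.
  by rewrite mulr0n !mul0r.
have k1 : (k - 1 < k)%N by lia.
rewrite (bigD1 (Ordinal k1)) //= big1 ?addr0 => [|j jk1].
  rewrite opE; have -> : (k - (k - 1) == 1)%N by lia.
  by rewrite mulr1n; ring.
rewrite opE; have -> : (k - j == 1)%N = false.
  by have := ltn_ord j; move: jk1; rewrite -val_eqE /=; lia.
by rewrite mulr0n !mul0r.
Qed.

Lemma pstr_term_omega tau l : pstr_term Y (omega c) tau l =
  (npart l)%:R * (((h + l%:R) / (k - 1)`!%:R * logq tau ^+ (k - 1)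
    + (k - 2)`!%:R^-1 * logq tau ^+ (k - 2)) * qpow tau (h + l%:R - c / 24)).
Proof.
have w1 : wgen c h k 1 <> 0 by apply: wgen_neq0; lia.
(* If h = 0 then L_0 u_2 = u_1, and otherwise L_0 u_1 = h u_1. *)
have [x0 w0] : exists x0 : W c h k, L _ 0 *: x0 <> 0.
  case: (h =P 0) => h0.
    exists (wgen c h k 2); rewrite wgen_L0 //= => E; apply: w1.
    by move: E; rewrite (scale_K0 _ _ h0) add0r.
  exists (wgen c h k 1); rewrite wgen_L0 ?wgen0 ?addr0; last exact: ltnW.
  by move=> /scale_eq0 /(_ w1).
have opE j : pstr_op l (fun w => zero_mode Y (omega c)
      ((j`!%:R^-1 : Cplx R) ⋆ iter j (L0N (h + l%:R)) w)) =
    ((j`!%:R^-1 * (h + l%:R)) *+ ((k - j)%N == 1%N) +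
     j`!%:R^-1 *+ ((k - j).-1 == 1%N)) * (npart l)%:R.
  rewrite (pstr_op_jordan irr l _ (j`!%:R^-1 * (h + l%:R)) (j`!%:R^-1)
    (k - j)%N (k - j).-1) //;
    try lia.
  move=> d; rewrite (omega_zero_mode _ _ _ hY _ w0) iter_L0N scaleL_comm.
  rewrite L0_pbw_basis ?leq_subr //.
  by rewrite scalerDr -[in RHS]scalerA (scale_alg _ (_%:A)).
rewrite /pstr_term (fsum_ord _ k) => [|j kj]; last first.
  rewrite opE; have -> : (k - j == 1)%N = false by lia.
  have -> : ((k - j).-1 == 1)%N = false by lia.
  by rewrite mulr0n addr0 !mul0r.
have k1 : (k - 1 < k)%N by lia.
have k2' : (k - 2 < k)%N by lia.
rewrite (bigD1 (Ordinal k1)) //= (bigD1 (Ordinal k2')) /=; last first.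
  by rewrite -val_eqE /=; lia.
rewrite big1 ?addr0 => [|j /andP[jk1 jk2]].
  rewrite !opE; have -> : (k - (k - 1) == 1)%N by lia.
  have -> : ((k - (k - 1)).-1 == 1)%N = false by lia.
  have -> : (k - (k - 2) == 1)%N = false by lia.
  have -> : ((k - (k - 2)).-1 == 1)%N by lia.
  by rewrite !mulr1n !mulr0n; ring.
have jk := ltn_ord j; move: jk1 jk2; rewrite -!val_eqE /= => jk1 jk2.
rewrite opE; have -> : (k - j == 1)%N = false by lia.
have -> : ((k - j).-1 == 1)%N = false by lia.
by rewrite !mulr0n addr0 !mul0r.
Qed.

End Terms.

(** * Limits of complex functions *)

Section Limits.
Context {K : numFieldType} {T : Type} {F : set_system T} {FF : Filter F}.
Implicit Types (f g : T -> K) (a b : K).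

Lemma lim_add {f g a b} : f @ F --> a -> g @ F --> b -> (fun t => f t + g t) @ F --> a + b.
Proof. by move=> fa gb; exact: (@cvgD K K T F FF f g a b fa gb). Qed.

Lemma lim_sub {f g a b} : f @ F --> a -> g @ F --> b -> (fun t => f t - g t) @ F --> a - b.
Proof. by move=> fa gb; exact: (@cvgB K K T F FF f g a b fa gb). Qed.

Lemma lim_mul {f g a b} : f @ F --> a -> g @ F --> b -> (fun t => f t * g t) @ F --> a * b.
Proof. by move=> fa gb; exact: (@cvgM K T F FF f g a b fa gb). Qed.

Lemma lim_cst a : (fun=> a) @ F --> a.
Proof. exact: cvg_cst. Qed.

Lemma lim_inv {f a} : a != 0 -> f @ F --> a -> (fun t => (f t)^-1) @ F --> a^-1.
Proof. by move=> a0 fa; apply: cvgV. Qed.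

Lemma lim_neq0 {f a} : a != 0 -> f @ F --> a -> \forall t \near F, f t != 0.
Proof. by move=> a0 fa; apply: (cvgr_neq0 _ fa a0). Qed.

Lemma lim_near {f g a} : f @ F --> a -> (\forall t \near F, f t = g t) -> g @ F --> a.
Proof.
move=> fa fg; apply: cvg_trans fa; apply: near_eq_cvg.
by apply: filterS fg => t ->.
Qed.

End Limits.

Section ComplexNorm.
Context {R : realType}.
Local Notation C := (Cplx R).

(** The modulus as an element of R: the norm of the complex numbers takes values in
    the complex numbers, which are only partially ordered. *)
Definition nm (z : C) : R := complex.Re `|z|.

Lemma normE (z : C) : `|z| = (nm z)%:C%C.
Proof. by rewrite /nm normc_def. Qed.

Lemma nm_ge0 z : 0 <= nm z.
Proof. by rewrite /nm normc_def sqrtr_ge0. Qed.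

Lemma nm_le (x y : C) : (nm x <= nm y) = (`|x| <= `|y|).
Proof. by rewrite !normE lecR. Qed.

Lemma nmM x y : nm (x * y) = nm x * nm y.
Proof. by apply: (@complexI R); rewrite rmorphM /= -!normE normrM. Qed.

Lemma nmD x y : nm (x + y) <= nm x + nm y.
Proof. by rewrite -lecR rmorphD /= -!normE; exact: ler_normD. Qed.

Lemma nmN x : nm (- x) = nm x.
Proof. by rewrite /nm normrN. Qed.

Lemma nmX x n : nm (x ^+ n) = nm x ^+ n.
Proof. by apply: (@complexI R); rewrite rmorphXn /= -!normE normrX. Qed.

Lemma nm0 : nm 0 = 0. Proof. by rewrite /nm normr0. Qed.
Lemma nm1 : nm 1 = 1. Proof. by rewrite /nm normr1. Qed.

Lemma nm_nat n : nm n%:R = n%:R.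
Proof. by apply: (@complexI R); rewrite -normE normr_nat rmorph_nat. Qed.

Lemma nm_eq0 x : (nm x == 0) = (x == 0).
Proof. by rewrite -[RHS]normr_eq0 normE -(inj_eq (@complexI R)). Qed.

Lemma nm_real (x : R) : nm (x%:C)%C = `|x|.
Proof. by rewrite /nm normc_def /= expr0n addr0 sqrtr_sqr. Qed.

Lemma nm_sum (I : Type) (r : seq I) (P : pred I) (F : I -> C) :
  nm (\sum_(i <- r | P i) F i) <= \sum_(i <- r | P i) nm (F i).
Proof.
elim/big_rec2: _ => [|i x y _ H]; first by rewrite nm0.
by apply: le_trans (nmD _ _) _; rewrite lerD2l.
Qed.

Lemma Re_le_nm (z : C) : `|complex.Re z| <= nm z.
Proof.
case: z => a b; rewrite /nm normc_def /= -sqrtr_sqr; apply: ler_wsqrtr.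
by rewrite lerDl sqr_ge0.
Qed.

Lemma Im_le_nm (z : C) : `|complex.Im z| <= nm z.
Proof.
case: z => a b; rewrite /nm normc_def /= -sqrtr_sqr; apply: ler_wsqrtr.
by rewrite lerDr sqr_ge0.
Qed.

Lemma nm_le_ReIm (z : C) : nm z <= `|complex.Re z| + `|complex.Im z|.
Proof.
case: z => a b /=.
have -> : (a +i* b)%C = (a%:C + 'i * b%:C)%C :> C.
  by apply/eqP; rewrite eq_complex /= !(mul0r,mul1r,mulr0,addr0,subr0,add0r) !eqxx.
apply: le_trans (nmD _ _) _; rewrite nmM !nm_real.
suff -> : nm 'i%C = 1 by rewrite mul1r.
by rewrite /nm normc_def /= expr0n expr1n add0r sqrtr1.
Qed.

Lemma cvg_nmP {T : Type} (F : set_system T) {FF : Filter F} (f : T -> C) (l : C) :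
  f @ F --> l <-> (fun t => nm (f t - l)) @ F --> 0.
Proof.
split.
  move=> /cvgrPdist_lt H; apply/cvgrPdist_lt => e e0.
  have e0' : (0 : C) < e%:C%C by rewrite ltcR.
  apply: filterS (H _ e0') => t; rewrite normE ltcR => lt_e.
  by rewrite sub0r normrN ger0_norm ?nm_ge0 // -nmN opprB.
move=> /cvgrPdist_lt H; apply/cvgrPdist_lt => e e0.
have [r r0 ->] : exists2 r : R, 0 < r & e = r%:C%C.
  move: e0; case: e => a b; rewrite ltcE /= => /andP[/eqP -> a0].
  by exists a.
apply: filterS (H _ r0) => t; rewrite sub0r normrN ger0_norm ?nm_ge0 // => lt_r.
by rewrite normE ltcR -nmN opprB.
Qed.

Lemma cvg_nm_near {T : Type} (F : set_system T) {FF : Filter F} (f : T -> C) (l : C) :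
  (forall e : R, 0 < e -> \forall t \near F, nm (f t - l) <= e) -> f @ F --> l.
Proof.
move=> H; apply/cvg_nmP; apply/cvgrPdist_le => e e0.
apply: filterS (H e e0) => t.
by rewrite sub0r normrN ger0_norm ?nm_ge0.
Qed.

Lemma cvg_ReIm (u : nat -> C) :
  cvgn (fun n => complex.Re (u n) : R) -> cvgn (fun n => complex.Im (u n) : R) -> cvgn u.
Proof.
move=> /cvg_ex [a ua] /cvg_ex [b ub]; apply/cvg_ex; exists (a +i* b)%C.
apply/cvg_nmP.
have H : (fun n => `|complex.Re (u n) - a| + `|complex.Im (u n) - b|) @ \oo --> (0 : R).
  rewrite -[X in _ --> X]addr0 -[X in _ --> X + _](normr0 R) -[X in _ --> _ + X](normr0 R).
  rewrite -{1}(subrr a) -(subrr b).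
  by apply: cvgD; apply: cvg_norm; apply: cvgB => //; exact: cvg_cst.
apply: squeeze_cvgr H; last exact: (@cvg_cst R).
near=> n; rewrite nm_ge0 /=; apply: le_trans (nm_le_ReIm _) _.
by case: (u n).
Unshelve. all: by end_near. Qed.

(** Completeness is only used for R, through real and imaginary parts. *)
Lemma series_dominated (u : nat -> C) (b : nat -> R) :
  (forall n, nm (u n) <= b n) -> cvgn (series b) -> cvgn (series u).
Proof.
move=> ub cb; have b0 n : 0 <= b n := le_trans (nm_ge0 _) (ub n).
have H (p : C -> R) : (forall z, `|p z| <= nm z) -> cvgn (series (fun n => p (u n))).
  move=> pz; apply: normed_cvg; apply: series_le_cvg cb => // n /=; first exact: normr_ge0.
  by apply: le_trans (ub n); exact: pz.
have ER : (fun n => complex.Re (series u n) : R) = series (fun n => complex.Re (u n)).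
  by apply/funext => n; rewrite /series /= raddf_sum.
have EI : (fun n => complex.Im (series u n) : R) = series (fun n => complex.Im (u n)).
  by apply/funext => n; rewrite /series /= raddf_sum.
by apply: cvg_ReIm; [rewrite ER; exact: H Re_le_nm|rewrite EI; exact: H Im_le_nm].
Qed.

Lemma nm_lim_le (u : nat -> C) (v : nat -> R) : cvgn u -> cvgn v ->
  (forall n, nm (u n) <= v n) -> nm (limn u) <= limn v.
Proof.
move=> cu cv uv.
have /cvg_nmP H : u @ \oo --> limn u by [].
have : (fun n => nm (u n - limn u) + v n) @ \oo --> 0 + limn v by exact: cvgD.
rewrite add0r => cw; rewrite -(cvg_lim _ cw) //.
apply: limr_ge; first by apply/cvg_ex; exists (limn v).
near=> n; rewrite -{1}(subrK (u n) (limn u)); apply: le_trans (nmD _ _) _.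
by apply: lerD => //; rewrite -nmN opprB.
Unshelve. all: by end_near. Qed.

End ComplexNorm.

(** * Power series *)

Lemma cvg_seriesMl {K : numFieldType} (k : K) (f : nat -> K) (l : K) :
  series f @ \oo --> l -> series (fun n => k * f n) @ \oo --> k * l.
Proof.
move=> fl; have -> : series (fun n => k * f n) = fun n => k * series f n.
  by apply/funext => n; rewrite /series /= mulr_sumr.
exact: cvgMl_tmp.
Qed.

Lemma is_cvg_seriesMl {K : numFieldType} (k : K) (f : nat -> K) :
  cvgn (series f) -> cvgn (series (fun n => k * f n)).
Proof. by move=> /cvg_ex[l fl]; apply/cvg_ex; exists (k * l); exact: cvg_seriesMl. Qed.

Section PowerEstimates.
Context {R : realType}.
Local Notation C := (Cplx R).
Variables (z u : C) (r d : R).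
Hypotheses (zr : nm z <= r) (d0 : 0 < d) (ud : nm u <= d).

Let r0 : 0 <= r. Proof. exact: le_trans (nm_ge0 z) zr. Qed.
Let rho0 : 0 <= r + d. Proof. by rewrite addr_ge0 // ltW. Qed.
Let zud : nm (z + u) <= r + d. Proof. exact: le_trans (nmD _ _) (lerD zr ud). Qed.

Lemma nm_scaled : nm u = nm u / d * d.
Proof. by rewrite divfK // gt_eqF. Qed.

Let t0 : 0 <= nm u / d. Proof. by rewrite divr_ge0 ?nm_ge0 // ltW. Qed.

Lemma pow_diff l : nm ((z + u) ^+ l - z ^+ l) <= nm u / d * (r + d) ^+ l.
Proof.
elim: l => [|l IH]; first by rewrite !expr0 subrr nm0 mulr1.
have -> : (z + u) ^+ l.+1 - z ^+ l.+1 =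
    z * ((z + u) ^+ l - z ^+ l) + u * (z + u) ^+ l by rewrite !exprS; ring.
apply: le_trans (nmD _ _) _; rewrite !nmM nmX.
have -> : nm u / d * (r + d) ^+ l.+1 =
    r * (nm u / d * (r + d) ^+ l) + nm u / d * d * (r + d) ^+ l.
  by rewrite exprS; ring.
rewrite -nm_scaled; apply: lerD.
  by apply: ler_pM => //; exact: nm_ge0.
apply: ler_wpM2l; first exact: nm_ge0.
by apply: lerXn2r; rewrite ?nnegrE ?nm_ge0.
Qed.

(** Second order Taylor remainder of z^l in terms of (r + d)^l alone. Its quotient
    by (|u|/d)^2 is a sum of terms C(l,i) r^(l-i) d^i of the expansion of
    (r + d)^l, so no power of l is lost and convergence at the radius r + d is all
    that a power series needs to be differentiated. *)
Lemma pow_diff2 l : nm ((z + u) ^+ l - z ^+ l - l%:R * z ^+ l.-1 * u) <=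
  (nm u / d) ^+ 2 * (r + d) ^+ l.
Proof.
elim: l => [|l IH].
  by rewrite !expr0 subrr sub0r mul0r mul0r oppr0 nm0 mulr1 exprn_ge0.
have -> : (z + u) ^+ l.+1 - z ^+ l.+1 - l.+1%:R * z ^+ l.+1.-1 * u =
    z * ((z + u) ^+ l - z ^+ l - l%:R * z ^+ l.-1 * u) + u * ((z + u) ^+ l - z ^+ l).
  by case: l {IH} => [|l] /=; rewrite ?exprS ?expr0 -?[l.+2%:R]natr1; ring.
apply: le_trans (nmD _ _) _; rewrite !nmM.
have -> : (nm u / d) ^+ 2 * (r + d) ^+ l.+1 =
    r * ((nm u / d) ^+ 2 * (r + d) ^+ l) + nm u / d * d * (nm u / d * (r + d) ^+ l).
  by rewrite [(r + d) ^+ l.+1]exprS; ring.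
rewrite -nm_scaled; apply: lerD.
  by apply: ler_pM => //; exact: nm_ge0.
by apply: ler_wpM2l; [exact: nm_ge0|exact: pow_diff].
Qed.

End PowerEstimates.

(** The linear term of the binomial expansion. *)
Lemma natmul_pow_le {R : realType} (r d : R) l : 0 <= r -> 0 < d ->
  l%:R * r ^+ l.-1 * d <= (r + d) ^+ l.
Proof.
move=> r0 d0; elim: l => [|l IH]; first by rewrite !mul0r expr0.
have -> : l.+1%:R * r ^+ l.+1.-1 * d = r * (l%:R * r ^+ l.-1 * d) + d * r ^+ l.
  by case: l {IH} => [|l] /=; rewrite ?exprS ?expr0 -?[l.+2%:R]natr1; ring.
rewrite exprS mulrDl; apply: lerD; first exact: ler_wpM2l.
apply: ler_wpM2l; first exact: ltW.
apply: lerXn2r; rewrite ?nnegrE //; first by rewrite addr_ge0 // ltW.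
by rewrite lerDl ltW.
Qed.

Section PowerSeries.
Context {R : realType}.
Local Notation C := (Cplx R).
Variable a : nat -> R.
Hypothesis a0 : forall l, 0 <= a l.
Hypothesis a_cvg : forall rho : R, 0 <= rho < 1 ->
  cvgn (series (fun l => a l * rho ^+ l)).

Definition pterm (z : C) (l : nat) : C := (a l)%:C%C * z ^+ l.
Definition dterm (z : C) (l : nat) : C := (a l)%:C%C * (l%:R * z ^+ l.-1).
Definition psum (z : C) : C := limn (series (pterm z)).
Definition dsum (z : C) : C := limn (series (dterm z)).

Lemma nm_coef l : nm (a l)%:C%C = a l.
Proof. by rewrite nm_real ger0_norm. Qed.

Lemma pterm_cvg z : nm z < 1 -> cvgn (series (pterm z)).
Proof.
move=> z1; apply: series_dominated (a_cvg (nm z) _); last by rewrite nm_ge0.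
by move=> l; rewrite nmM nmX nm_coef.
Qed.

Lemma larger_radius (r : R) : r < 1 -> exists d, 0 < d /\ r + d < 1.
Proof. by move=> r1; exists ((1 - r) / 2); lra. Qed.

Lemma dterm_cvg z : nm z < 1 -> cvgn (series (dterm z)).
Proof.
move=> z1; have [d [d0 zd]] := larger_radius _ z1.
have rho1 : 0 <= nm z + d < 1 by rewrite zd addr_ge0 ?nm_ge0 // ltW.
apply: (@series_dominated _ _ (fun l => d^-1 * (a l * (nm z + d) ^+ l))).
  move=> l; rewrite !nmM nmX nm_coef nm_nat [X in _ <= X]mulrCA ler_wpM2l //.
  by rewrite [X in _ <= X]mulrC ler_pdivlMr // natmul_pow_le ?nm_ge0.
exact: is_cvg_seriesMl (a_cvg _ rho1).
Qed.

Lemma psum_quadratic z : nm z < 1 -> exists K d : R, 0 < d /\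
  forall u, nm u <= d -> nm (psum (z + u) - psum z - dsum z * u) <= K * nm u ^+ 2.
Proof.
move=> z1; have [d [d0 zd]] := larger_radius _ z1.
have rho1 : 0 <= nm z + d < 1 by rewrite zd addr_ge0 ?nm_ge0 // ltW.
exists (limn (series (fun l => d^-1 ^+ 2 * (a l * (nm z + d) ^+ l)))), d; split=> // u ud.
have zu1 : nm (z + u) < 1.
  by apply: le_lt_trans (nmD _ _) _; apply: le_lt_trans zd; rewrite lerD2l.
have c1 : series (pterm (z + u)) @ \oo --> psum (z + u) := pterm_cvg _ zu1.
have c2 : series (pterm z) @ \oo --> psum z := pterm_cvg _ z1.
have c3 : series (dterm z) @ \oo --> dsum z := dterm_cvg _ z1.
have ck : cvgn (series (fun l => d^-1 ^+ 2 * (a l * (nm z + d) ^+ l))).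
  exact: is_cvg_seriesMl (a_cvg _ rho1).
pose v n := series (pterm (z + u)) n - series (pterm z) n - series (dterm z) n * u.
have cv : v @ \oo --> psum (z + u) - psum z - dsum z * u.
  have c4 : (fun n => series (dterm z) n * u) @ \oo --> dsum z * u.
    exact: (@cvgMr_tmp _ _ _ _ _ _ _ c3).
  exact: (@cvgB C C _ _ _ _ _ _ _ (@cvgB C C _ _ _ _ _ _ _ c1 c2) c4).
rewrite -(cvg_lim _ cv) //.
have -> : limn (series (fun l => d^-1 ^+ 2 * (a l * (nm z + d) ^+ l))) * nm u ^+ 2 =
   limn (fun n => series (fun l => d^-1 ^+ 2 * (a l * (nm z + d) ^+ l)) n * nm u ^+ 2).
  by apply/esym/cvg_lim => //; exact: cvgMr_tmp.
apply: nm_lim_le.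
- by apply/cvg_ex; eexists; exact: cv.
- by apply: is_cvgMr_tmp.
move=> n; rewrite /v /series /= -sumrB mulr_suml -sumrB mulr_suml.
apply: le_trans (nm_sum _ _ _ _) _; apply: ler_sum => l _.
rewrite /pterm /dterm -mulrBr -!mulrA -mulrBr nmM nm_coef.
rewrite [X in _ <= X](_ : _ = a l * ((nm u / d) ^+ 2 * (nm z + d) ^+ l)).
  by apply: ler_wpM2l => //; rewrite mulrA; exact: pow_diff2.
by rewrite exprMn; ring.
Qed.

End PowerSeries.

(** * Euler's product for the partition numbers *)

Section PartitionPolynomial.
Context {A : numDomainType}.

(** part_poly N B is the product over the parts 1, ..., N of geometric series
    truncated at multiplicity B. *)
Definition part_factor (B i : nat) : {poly A} := \sum_(j < B.+1) 'X^(i.+1 * j).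
Definition part_poly (N B : nat) : {poly A} := \prod_(i < N) part_factor B i.

Lemma coef_part_poly N B l :
  (part_poly N B)`_l =
  #|[pred f : {ffun 'I_N -> 'I_B.+1} | (\sum_(i < N) i.+1 * f i == l)%N]|%:R.
Proof.
rewrite /part_poly /part_factor bigA_distr_bigA /= coef_sum.
rewrite -sum1_card natr_sum [RHS]big_mkcond /=; apply: eq_bigr => f _.
by rewrite inE -expr_sum coefXn eq_sym; case: eqP.
Qed.

(** The encoding of partitions of l by multiplicities below l.+1 is the case
    N = B = l. *)
Lemma coef_part_polyE l : (part_poly l l)`_l = (npart l)%:R.
Proof. by rewrite coef_part_poly /npart card_sig. Qed.

Definition agree (l : nat) (p q : {poly A}) := forall i, (i <= l)%N -> p`_i = q`_i.

Lemma agreeM l p p' q q' : agree l p p' -> agree l q q' -> agree l (p * q) (p' * q').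
Proof.
move=> pp qq i il; rewrite !coefM; apply: eq_bigr => j _.
by rewrite pp ?qq //; have := ltn_ord j; lia.
Qed.

Lemma agree_factor l B i : (l <= B)%N -> agree l (part_factor B i) (part_factor l i).
Proof.
move=> lB n nl; rewrite /part_factor !coef_sum.
rewrite -!(big_mkord xpredT (fun j => ('X^(i.+1 * j) : {poly A})`_n)).
rewrite (@big_cat_nat _ _ _ l.+1 0 B.+1) //= [X in _ + X]big_nat [X in _ + X]big1 ?addr0 //.
move=> j /andP[lj _]; rewrite coefXn; case: eqP => // E.
by have := leq_pmull j (ltn0Sn i); lia.
Qed.

Lemma agree_factor1 l B i : (l <= i)%N -> agree l (part_factor B i) 1.
Proof.
move=> li n nl; rewrite /part_factor big_ord_recl muln0 expr0 coefD coef1.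
rewrite coef_sum big1 ?addr0 // => j _; rewrite coefXn; case: eqP => // E.
by have := leq_pmulr i.+1 (ltn0Sn j); rewrite -E; lia.
Qed.

(** Up to degree l neither parts nor multiplicities larger than l matter. *)
Lemma agree_part_poly l N B : (l <= N)%N -> (l <= B)%N ->
  agree l (part_poly N B) (part_poly l l).
Proof.
move=> lN lB; rewrite /part_poly -(subnKC lN).
elim: (N - l)%N => [|m IH].
  rewrite addn0; elim/big_rec2: _ => [//|i p q _ H].
  by apply: agreeM => //; exact: agree_factor.
rewrite addnS big_ord_recr /= -[X in agree l _ X]mulr1.
by apply: agreeM => //; apply: agree_factor1; exact: leq_addr.
Qed.

Lemma coef_part_poly_npart l N B : (l <= N)%N -> (l <= B)%N ->
  (part_poly N B)`_l = (npart l)%:R.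
Proof. by move=> lN lB; rewrite (agree_part_poly _ _ _ lN lB) // coef_part_polyE. Qed.

Definition coef_le (p q : {poly A}) := forall i, 0 <= p`_i <= q`_i.

Lemma coef_leM p p' q q' : coef_le p p' -> coef_le q q' -> coef_le (p * q) (p' * q').
Proof.
move=> pp qq i; rewrite !coefM; apply/andP; split.
  by apply: sumr_ge0 => j _; apply: mulr_ge0; [case/andP: (pp j)|case/andP: (qq (i - j)%N)].
apply: ler_sum => j _; have /andP[? ?] := pp j; have /andP[? ?] := qq (i - j)%N.
exact: ler_pM.
Qed.

Lemma part_factor_ge0 B i n : 0 <= (part_factor B i)`_n.
Proof. by rewrite coef_sum; apply: sumr_ge0 => j _; rewrite coefXn ler0n. Qed.

Lemma part_factor_le B B' i : (B <= B')%N -> coef_le (part_factor B i) (part_factor B' i).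
Proof.
move=> BB n; rewrite part_factor_ge0 /= /part_factor !coef_sum.
rewrite -!(big_mkord xpredT (fun j => ('X^(i.+1 * j) : {poly A})`_n)).
rewrite (@big_cat_nat _ _ _ B.+1 0 B'.+1) //= lerDl.
by apply: sumr_ge0 => j _; rewrite coefXn ler0n.
Qed.

Lemma part_factor_ge1 B i : coef_le 1 (part_factor B i).
Proof.
move=> n; rewrite coef1 ler0n /= /part_factor big_ord_recl muln0 expr0 coefD coef1 lerDl.
by rewrite coef_sum; apply: sumr_ge0 => j _; rewrite coefXn ler0n.
Qed.

Lemma part_poly_le N B N' B' : (N <= N')%N -> (B <= B')%N ->
  coef_le (part_poly N B) (part_poly N' B').
Proof.
move=> NN BB; rewrite /part_poly -(subnKC NN); elim: (N' - N)%N => [|m IH].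
  rewrite addn0; elim/big_rec2: _ => [i|i p q _ H].
    by rewrite coef1 ler0n lexx.
  by apply: coef_leM => //; exact: part_factor_le.
rewrite addnS big_ord_recr /= -[X in coef_le X _]mulr1.
by apply: coef_leM => //; exact: part_factor_ge1.
Qed.

Lemma coef_part_poly_bounds N B l : 0 <= (part_poly N B)`_l <= (npart l)%:R.
Proof.
have /andP[H1 H2] := @part_poly_le N B (maxn N l) (maxn B l) (leq_maxl _ _) (leq_maxl _ _) l.
by rewrite H1 -[X in _ <= X](coef_part_poly_npart l (maxn N l) (maxn B l)) ?leq_maxr.
Qed.

(** Telescoping of the truncated geometric series. *)
Lemma horner_part_poly N B (x : A) :
  (\prod_(i < N) (1 - x ^+ i.+1)) * (part_poly N B).[x] =
  \prod_(i < N) (1 - x ^+ (i.+1 * B.+1)).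
Proof.
rewrite /part_poly horner_prod -big_split /=; apply: eq_bigr => i _.
rewrite /part_factor horner_sum exprM.
rewrite -{2}(expr1n _ B.+1) subrXX; congr (_ * _); apply: eq_bigr => j _.
by rewrite hornerXn exprM expr1n mul1r.
Qed.

End PartitionPolynomial.

Lemma cvg_nm_le {R : realType} (u : nat -> Cplx R) (l : Cplx R) (M : R) :
  u @ \oo --> l -> (\forall n \near \oo, nm (u n) <= M) -> nm l <= M.
Proof.
move=> /cvg_nmP H uM.
have cw : (fun n => nm (u n - l) + M) @ \oo --> M.
  by rewrite -[X in _ --> X]add0r; apply: cvgD => //; exact: cvg_cst.
rewrite -[X in _ <= X](cvg_lim _ cw) //.
apply: limr_ge; first by apply/cvg_ex; exists M.
near=> n; rewrite -{1}(subrK (u n) l); apply: le_trans (nmD _ _) _.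
by apply: lerD; [rewrite -nmN opprB|near: n].
Unshelve. all: by end_near. Qed.

Section EulerProduct.
Context {R : realType}.
Local Notation C := (Cplx R).

Definition pcoef (l : nat) : R := (npart l)%:R.

Lemma pcoef_ge0 l : 0 <= pcoef l. Proof. exact: ler0n. Qed.

(** From 1/(1-x) = 1 + x/(1-x) <= exp (x/(1-r)) for 0 <= x <= r < 1, summed over
    x = r, r^2, ... *)
Definition euler_bound (r : R) : R := expR (r / (1 - r) ^+ 2).

Lemma geometric_partial_le (r : R) N : 0 <= r < 1 ->
  \sum_(i < N) r ^+ i.+1 <= r / (1 - r).
Proof.
move=> /andP[r0 r1]; have r1' : 0 < 1 - r by rewrite subr_gt0.
rewrite ler_pdivlMr //; under eq_bigr do rewrite exprS.
rewrite -mulr_sumr -mulrA -[X in _ <= X]mulr1 ler_wpM2l //.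
have := subrXX 1 r N; rewrite expr1n => E.
have -> : (\sum_(i < N) r ^+ i) * (1 - r) = 1 - r ^+ N.
  by rewrite E mulrC; congr (_ * _); apply: eq_bigr => i _; rewrite expr1n mul1r.
by rewrite gerBl exprn_ge0.
Qed.

Lemma euler_inv_bound (r : R) N : 0 <= r < 1 ->
  \prod_(i < N) (1 - r ^+ i.+1)^-1 <= euler_bound r.
Proof.
move=> r01; have /andP[r0 r1] := r01.
have r1' : 0 < 1 - r by rewrite subr_gt0.
have ri i : r ^+ i.+1 <= r by rewrite exprS ler_piMr // exprn_ile1 // ltW.
apply: (@le_trans _ _ (\prod_(i < N) expR (r ^+ i.+1 / (1 - r)))).
  apply: ler_prod => i _.
  have pos : 0 < 1 - r ^+ i.+1 by rewrite subr_gt0; apply: le_lt_trans r1.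
  rewrite invr_ge0 ltW //=; apply: le_trans (expR_ge1Dx _).
  have -> : (1 - r ^+ i.+1)^-1 = 1 + r ^+ i.+1 / (1 - r ^+ i.+1).
    by field; rewrite gt_eqF.
  rewrite lerD2l ler_wpM2l ?exprn_ge0 // lef_pV2 ?posrE //.
  by rewrite lerB.
rewrite -expR_sum ler_expR -mulr_suml /euler_bound.
have -> : r / (1 - r) ^+ 2 = r / (1 - r) / (1 - r) by field; rewrite gt_eqF.
apply: ler_wpM2r; first by rewrite invr_ge0 ltW.
exact: geometric_partial_le.
Qed.

Lemma part_poly_bound (r : R) N B : 0 <= r < 1 -> (part_poly N B).[r] <= euler_bound r.
Proof.
move=> r01; have /andP[r0 r1] := r01; apply: le_trans (euler_inv_bound r N r01).
have ri i : r ^+ i.+1 < 1.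
  by apply: (le_lt_trans _ r1); rewrite exprS ler_piMr // exprn_ile1 // ltW.
have Q0 : 0 < \prod_(i < N) (1 - r ^+ i.+1).
  by apply: prodr_gt0 => i _; rewrite subr_gt0.
rewrite prodfV -[X in X <= _](mulKf (lt0r_neq0 Q0)) ler_piMr ?invr_ge0 ?(ltW Q0) //.
rewrite horner_part_poly.
apply: (@le_trans _ _ (\prod_(i < N) (1 : R))); last by rewrite big1_eq.
apply: ler_prod => i _.
rewrite subr_ge0 exprn_ile1 //=; last exact: ltW.
by rewrite gerBl exprn_ge0.
Qed.

Lemma part_poly_partial_sum (r : R) N : 0 <= r ->
  series (fun l => pcoef l * r ^+ l) N <= (part_poly N N).[r].
Proof.
move=> r0; pose M := maxn N (size (part_poly N N : {poly R})).
rewrite (horner_coef_wide (n := M)) ?leq_maxr //.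
rewrite /series /= -(big_mkord xpredT (fun i => (part_poly N N)`_i * r ^+ i)).
rewrite (@big_cat_nat _ _ _ N 0 M) ?leq_maxl //=.
rewrite -[X in X <= _]addr0; apply: lerD; last first.
  apply: sumr_ge0 => l _; rewrite mulr_ge0 ?exprn_ge0 //.
  by case/andP: (@coef_part_poly_bounds R N N l).
rewrite big_nat [X in _ <= X]big_nat; apply: ler_sum => l /andP[_ lN].
by rewrite coef_part_poly_npart // ltnW.
Qed.

Lemma pcoef_cvg (r : R) : 0 <= r < 1 -> cvgn (series (fun l => pcoef l * r ^+ l)).
Proof.
move=> r01; have /andP[r0 r1] := r01; apply: nondecreasing_is_cvgn.
  by apply: nondecreasing_series => n _ _; rewrite mulr_ge0 ?exprn_ge0 ?pcoef_ge0.
exists (euler_bound r) => _ [n _ <-].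
by apply: le_trans (part_poly_partial_sum r n r0) _; exact: part_poly_bound.
Qed.

Definition ptail (r : R) (N : nat) : R :=
  limn (series (fun l => pcoef l * r ^+ l)) - series (fun l => pcoef l * r ^+ l) N.

Lemma ptail_cvg (r : R) : 0 <= r < 1 -> ptail r @ \oo --> 0.
Proof.
move=> r01; have c := pcoef_cvg r r01.
rewrite -(subrr (limn (series (fun l => pcoef l * r ^+ l)))).
by apply: cvgB; [exact: cvg_cst|exact: c].
Qed.

(** The coefficients in degree below N are exact, and the others are between 0 and
    p(l), so the error is bounded by the tail of the real series. *)
Lemma part_poly_approx (q : C) N B : nm q < 1 -> (N <= B)%N ->
  nm ((part_poly N B).[q] - series (pterm pcoef q) N) <= ptail (nm q) N.
Proof.
move=> q1 NB; have q01 : 0 <= nm q < 1 by rewrite nm_ge0.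
pose M := maxn N (size (part_poly N B : {poly C})).
have NM : (N <= M)%N by exact: leq_maxl.
rewrite (horner_coef_wide (n := M)) ?leq_maxr //.
rewrite -(big_mkord xpredT (fun i => (part_poly N B)`_i * q ^+ i)).
rewrite (@big_cat_nat _ _ _ N 0 M) //=.
have -> : \sum_(0 <= i < N) (part_poly N B)`_i * q ^+ i = series (pterm pcoef q) N.
  rewrite /series /= big_nat [RHS]big_nat; apply: eq_bigr => l /andP[_ lN].
  have lB : (l <= B)%N by lia.
  by rewrite coef_part_poly_npart ?(ltnW lN) // /pterm /pcoef rmorph_nat.
rewrite addrAC subrr add0r; apply: le_trans (nm_sum _ _ _ _) _.
apply: (@le_trans _ _ (\sum_(N <= l < M) pcoef l * nm q ^+ l)).
  apply: ler_sum => l _; rewrite nmM nmX ler_wpM2r ?exprn_ge0 ?nm_ge0 //.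
  have /andP[c0 cp] := @coef_part_poly_bounds C N B l.
  by rewrite /pcoef -(nm_nat (npart l)) nm_le !ger0_norm // ler0n.
rewrite /ptail lerBrDl /series /= -big_cat_nat //.
apply: (nondecreasing_cvgn_le _ (pcoef_cvg _ q01)).
by apply: nondecreasing_series => n _ _; rewrite mulr_ge0 ?exprn_ge0 ?nm_ge0 ?pcoef_ge0.
Qed.

Lemma nm_prod (I : Type) (s : seq I) (P : pred I) (F : I -> C) :
  nm (\prod_(i <- s | P i) F i) = \prod_(i <- s | P i) nm (F i).
Proof. by elim/big_rec2: _ => [|i x y _ <-]; rewrite ?nm1 ?nmM. Qed.

Lemma euler_prod_bound (q : C) N : nm q < 1 ->
  nm (\prod_(i < N) (1 - q ^+ i.+1)) <= euler_bound (nm q).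
Proof.
move=> q1; have q01 : 0 <= nm q < 1 by rewrite nm_ge0.
apply: le_trans (euler_inv_bound _ N q01); rewrite nm_prod; apply: ler_prod => i _.
rewrite nm_ge0 /=.
have qi : nm q ^+ i.+1 < 1.
  by apply: (le_lt_trans _ q1); rewrite exprS ler_piMr ?nm_ge0 // exprn_ile1 ?nm_ge0 // ltW.
apply: le_trans (nmD _ _) _; rewrite nm1 nmN nmX -[X in _ <= X]mul1r.
rewrite ler_pdivlMr ?subr_gt0 //; set x := nm q ^+ _.
by rewrite (_ : (1 + x) * (1 - x) = 1 - x ^+ 2) ?gerBl ?sqr_ge0 //; ring.
Qed.

Lemma cvg_power (q : C) : nm q < 1 -> (fun n => q ^+ n) @ \oo --> (0 : C).
Proof.
move=> q1; apply/cvg_nmP.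
have -> : (fun n => nm (q ^+ n - 0)) = (fun n => nm q ^+ n).
  by apply/funext => n; rewrite subr0 nmX.
by apply: cvg_expr; rewrite ger0_norm ?nm_ge0.
Qed.

Lemma cvg_prod_power (q : C) N : nm q < 1 ->
  (fun B => \prod_(i < N) (1 - q ^+ (i.+1 * B.+1))) @ \oo --> (1 : C).
Proof.
move=> q1; elim: N => [|N IH].
  have -> : (fun B => \prod_(i < 0) (1 - q ^+ (i.+1 * B.+1))) = (fun=> 1).
    by apply/funext => B; rewrite big_ord0.
  exact: cvg_cst.
have -> : (fun B => \prod_(i < N.+1) (1 - q ^+ (i.+1 * B.+1))) =
  (fun B => (\prod_(i < N) (1 - q ^+ (i.+1 * B.+1))) * (1 - (q ^+ N.+1) ^+ B.+1)).
  by apply/funext => B; rewrite big_ord_recr /= exprM.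
have H : (fun B => (q ^+ N.+1) ^+ B.+1) @ \oo --> (0 : C).
  rewrite (cvg_shiftS (fun n => (q ^+ N.+1) ^+ n)); apply: cvg_power.
  by rewrite nmX exprn_ilt1 ?nm_ge0.
have c1 : (fun B => 1 - (q ^+ N.+1) ^+ B.+1) @ \oo --> (1 - 0 : C).
  exact: (lim_sub (cvg_cst (1 : C)) H).
rewrite subr0 in c1.
rewrite -[X in _ --> X](mulr1 (1 : C)); exact: (lim_mul IH c1).
Qed.

(** Let B tend to infinity in the telescoped product: for fixed N the right side
    tends to 1, and part_poly N B stays within the tail of the partial sum. *)
Lemma euler_partial (q : C) N : nm q < 1 ->
  nm (1 - (\prod_(i < N) (1 - q ^+ i.+1)) * series (pterm pcoef q) N) <=
  euler_bound (nm q) * ptail (nm q) N.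
Proof.
move=> q1; set Q := \prod_(i < N) _; set S := series _ N.
have c : (fun B => \prod_(i < N) (1 - q ^+ (i.+1 * B.+1)) - Q * S) @ \oo --> 1 - Q * S.
  exact: (lim_sub (cvg_prod_power q N q1) (cvg_cst (Q * S))).
apply: cvg_nm_le c _; near=> B.
have NB : (N <= B)%N by near: B; exists N.
rewrite -horner_part_poly -/Q -mulrBr nmM; apply: ler_pM; rewrite ?nm_ge0 //.
  exact: euler_prod_bound.
exact: part_poly_approx.
Unshelve. all: by end_near. Qed.

(** The partial products times the partial sums tend to 1. The products being
    bounded, the sum of the series is not 0, and the products converge to its
    inverse. *)
Theorem euler_product (q : C) : nm q < 1 ->
  psum pcoef q != 0 /\
  (fun n => \prod_(1 <= j < n.+1) (1 - q ^+ j)) @ \oo --> (psum pcoef q)^-1.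
Proof.
move=> q1; have q01 : 0 <= nm q < 1 by rewrite nm_ge0.
pose Q N := \prod_(i < N) (1 - q ^+ i.+1); pose S := series (pterm pcoef q).
have cS : S @ \oo --> psum pcoef q := pterm_cvg _ pcoef_ge0 pcoef_cvg _ q1.
have cQS : (fun N => Q N * S N) @ \oo --> (1 : C).
  apply/cvg_nmP.
  have ct : (fun N => euler_bound (nm q) * ptail (nm q) N) @ \oo --> (0 : R).
    rewrite -[X in _ --> X](mulr0 (euler_bound (nm q))).
    exact: (lim_mul (cvg_cst _) (ptail_cvg _ q01)).
  apply: squeeze_cvgr ct; last exact: (@cvg_cst R).
  near=> N; rewrite nm_ge0 /= -nmN opprB; exact: euler_partial.
have P0 : psum pcoef q != 0.
  (* Otherwise bounded times null would tend to 1. *)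
  apply/negP => /eqP P0; rewrite P0 in cS.
  have : (fun N => Q N * S N) @ \oo --> (0 : C).
    apply/cvg_nmP.
    have ct : (fun N => euler_bound (nm q) * nm (S N - 0)) @ \oo --> (0 : R).
      rewrite -[X in _ --> X](mulr0 (euler_bound (nm q))).
      have c3 : (fun N => nm (S N - 0)) @ \oo --> (0 : R) by apply/cvg_nmP.
      exact: (lim_mul (lim_cst _) c3).
    apply: squeeze_cvgr ct; last exact: (@cvg_cst R).
    near=> N; rewrite nm_ge0 /= !subr0 nmM ler_wpM2r ?nm_ge0 //.
    exact: euler_prod_bound.
  move=> /(cvg_unique (@norm_hausdorff _ _) cQS) /eqP.
  by rewrite oner_eq0.
split; first exact: P0.
have E : (fun n => \prod_(1 <= j < n.+1) (1 - q ^+ j)) = Q.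
  by apply/funext => n; rewrite big_add1 big_mkord.
rewrite E.
have cV : (fun N => (S N)^-1) @ \oo --> (psum pcoef q)^-1.
  exact: lim_inv P0 cS.
have cQ : (fun N => Q N * S N * (S N)^-1) @ \oo --> (psum pcoef q)^-1.
  by rewrite -[X in _ --> X]mul1r; exact: lim_mul cQS cV.
apply: lim_near cQ _; near=> N.
have SN0 : S N != 0 by near: N; exact: lim_neq0 P0 cS.
by rewrite mulfK.
Unshelve. all: by end_near. Qed.

End EulerProduct.

(** * Complex derivatives *)

Section Caratheodory.
Context {K : numFieldType}.
Implicit Types (f g : K -> K) (z l m : K).

(** Caratheodory's form of f'(z) = l: the difference quotient extends continuously
    to z. *)
Definition carat f z l := exists phi : K -> K,
  phi @ z --> l /\ \forall w \near z, f w - f z = phi w * (w - z).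

Lemma carat_continuous {f z l} : carat f z l -> f @ z --> f z.
Proof.
move=> [phi [cphi ephi]].
have c1 : (fun w : K => w - z) @ z --> (0 : K).
  have ci : (fun w : K => w) @ z --> z by exact: cvg_id.
  by rewrite -[X in _ --> X](subrr z); exact: lim_sub ci (lim_cst z).
have c2 : (fun w => f z + phi w * (w - z)) @ z --> f z.
  rewrite -[X in _ --> X]addr0 -[X in _ --> _ + X](mulr0 l).
  exact: lim_add (lim_cst _) (lim_mul cphi c1).
apply: lim_near c2 _; near=> w.
have <- : f w - f z = phi w * (w - z) by near: w.
by rewrite addrC subrK.
Unshelve. all: by end_near. Qed.

Lemma carat_derive1 {f z l} : carat f z l -> derivable f z 1 /\ derive1 f z = l.
Proof.
move=> [phi [cphi ephi]].
have cs : (fun h : K => h + z) @ (0 : K)^' --> z.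
  have ci : (fun w : K => w) @ (0 : K) --> (0 : K) by exact: cvg_id.
  have c0 := lim_add ci (lim_cst z); rewrite add0r in c0.
  by move=> A cA; apply: nbhs_dnbhs; exact: c0.
have c : (fun h : K => h^-1 *: (f (h + z) - f z)) @ (0 : K)^' --> l.
  have c1 := cvg_comp _ _ cs cphi.
  have e1 := cs _ ephi.
  apply: lim_near c1 _.
  near=> h.
  have h0 : h != 0 by near: h; exact: nbhs_dnbhs_neq.
  have -> : f (h + z) - f z = phi (h + z) * (h + z - z) by near: h.
  by rewrite /= addrK mulrC scalerA mulVf // scale1r.
split.
  apply/cvg_ex; exists l.
  by under eq_fun do rewrite [_ *: 1]mulr1.
exact: cvg_lim c.
Unshelve. all: by end_near. Qed.

Lemma carat_cst c z : carat (fun=> c) z 0.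
Proof.
exists (fun=> 0); split; first exact: (@lim_cst K K (nbhs z) (nbhs_filter z)).
by near=> w; rewrite subrr mul0r.
Unshelve. all: by end_near. Qed.

Lemma carat_id z : carat id z 1.
Proof.
exists (fun=> 1); split; first exact: (@lim_cst K K (nbhs z) (nbhs_filter z)).
by near=> w; rewrite mul1r.
Unshelve. all: by end_near. Qed.

Lemma caratM {f g z l m} : carat f z l -> carat g z m ->
  carat (fun w => f w * g w) z (l * g z + f z * m).
Proof.
move=> [phi [cphi ephi]] cg; have gz := carat_continuous cg.
have [psi [cpsi epsi]] := cg.
exists (fun w => phi w * g w + f z * psi w); split.
  exact: lim_add (lim_mul cphi gz) (lim_mul (lim_cst _) cpsi).
near=> w.
have E1 : f w - f z = phi w * (w - z) by near: w.
have E2 : g w - g z = psi w * (w - z) by near: w.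
rewrite mulrDl mulrAC -E1 -mulrA -E2; ring.
Unshelve. all: by end_near. Qed.

Lemma caratMl {f z l} c : carat f z l -> carat (fun w => c * f w) z (c * l).
Proof. by move=> cf; have := caratM (carat_cst c z) cf; rewrite mul0r add0r. Qed.

Lemma caratX {f z l} n : carat f z l ->
  carat (fun w => f w ^+ n) z (n%:R * f z ^+ n.-1 * l).
Proof.
move=> cf; elim: n => [|n IH].
  by have := carat_cst 1 z; rewrite mul0r mul0r.
have := caratM cf IH.
have -> : l * f z ^+ n + f z * (n%:R * f z ^+ n.-1 * l) = n.+1%:R * f z ^+ n.+1.-1 * l.
  by case: n {IH} => [|n] /=; rewrite ?exprS ?expr0 -?[n.+2%:R]natr1; ring.
by under eq_fun do rewrite -exprS.
Qed.

Lemma carat_comp {f g z l m} : carat f (g z) l -> carat g z m ->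
  carat (f \o g) z (l * m).
Proof.
move=> [phi [cphi ephi]] cg; have gz := carat_continuous cg.
have [psi [cpsi epsi]] := cg.
exists (fun w => phi (g w) * psi w); split.
  have c1 : (fun w => phi (g w)) @ z --> l by exact: (cvg_comp _ _ gz cphi).
  exact: lim_mul c1 cpsi.
have e1 := gz _ ephi; near=> w.
have E1 : f (g w) - f (g z) = phi (g w) * (g w - g z) by near: w.
have E2 : g w - g z = psi w * (w - z) by near: w.
by rewrite /= E1 E2 mulrA.
Unshelve. all: by end_near. Qed.

Lemma carat_near {f g z l} : (\forall w \near z, f w = g w) -> carat f z l -> carat g z l.
Proof.
move=> fg [phi [cphi ephi]]; exists phi; split=> //; near=> w.
have -> : g w = f w by apply/esym; near: w.
have <- : f z = g z by exact: nbhs_singleton fg.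
by near: w.
Unshelve. all: by end_near. Qed.

Lemma carat_shift {f l} z : carat f 0 l -> carat (fun w => f (w - z)) z l.
Proof.
move=> cf; rewrite -[l]mulr1.
have cs : carat (fun w => w - z) z 1.
  exists (fun=> 1); split; first exact: (@lim_cst K K (nbhs z) (nbhs_filter z)).
  by near=> w; rewrite subrr subr0 mul1r.
have cf' : carat f (z - z) l by rewrite subrr.
exact: (@carat_comp f (fun w => w - z) z l 1 cf' cs).
Unshelve. all: by end_near. Qed.

(** g (t w) = w reads w - q = phi (t w) (t w - t q), and phi (t w) tends to l <> 0;
    continuity of t is all that is needed. *)
Lemma carat_inverse {g t : K -> K} {q l} : carat g (t q) l -> l != 0 ->
  {for q, continuous t} -> (\forall w \near q, g (t w) = w) -> carat t q l^-1.
Proof.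
move=> [phi [cphi ephi]] l0 ct gt.
have c1 : (phi \o t) @ q --> l by exact: (cvg_comp _ _ ct cphi).
exists (fun w => (phi (t w))^-1); split; first exact: lim_inv l0 c1.
have e1 := ct _ ephi.
have e2 : \forall w \near q, phi (t w) != 0 by exact: lim_neq0 c1.
have gq : g (t q) = q by exact: nbhs_singleton gt.
near=> w.
have E : g (t w) - g (t q) = phi (t w) * (t w - t q) by near: w.
have gw : g (t w) = w by near: w.
have p0 : phi (t w) != 0 by near: w.
have <- : g (t w) - g (t q) = w - q by rewrite gw gq.
by rewrite E mulKf.
Unshelve. all: by end_near. Qed.

End Caratheodory.

Section ComplexDerivatives.
Context {R : realType}.
Local Notation C := (Cplx R).

Lemma carat_little_o (f : C -> C) (z l : C) :
  (forall e : R, 0 < e -> exists2 d : R, 0 < d & forall u, nm u < d ->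
     nm (f (z + u) - f z - l * u) <= e * nm u) -> carat f z l.
Proof.
move=> H; exists (fun w => if w == z then l else (f w - f z) / (w - z)); split.
  apply: (@cvg_nm_near R C (nbhs z) (nbhs_filter z)) => e e0.
  have [d d0 Hd] := H e e0.
  have d0' : (0 : C) < (d%:C)%C by rewrite ltcR.
  have := near_dist z d0'; apply: (@filterS _ (nbhs z) (nbhs_filter z)) => w.
  rewrite normE ltcR -nmN opprB => wd.
  case: eqP => [_|/eqP wz]; first by rewrite subrr nm0 ltW.
  have wz0 : w - z != 0 by rewrite subr_eq0.
  have pos : 0 < nm (w - z) by rewrite lt_def nm_eq0 wz0 nm_ge0.
  have -> : (f w - f z) / (w - z) - l = (f (z + (w - z)) - f z - l * (w - z)) / (w - z).
    by rewrite [z + (w - z)]addrC subrK [RHS]mulrBl mulfK.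
  have := Hd _ wd; rewrite -ler_pdivrMr // => H1; apply: le_trans H1.
  by rewrite nmM (_ : nm _^-1 = (nm (w - z))^-1) //; apply: (mulfI (lt0r_neq0 pos));
    rewrite -nmM !divff ?nm1 // gt_eqF.
apply: (@filterE _ (nbhs z) (nbhs_filter z)) => w.
case: eqP => [->|/eqP wz]; first by rewrite !subrr mulr0.
by rewrite divfK // subr_eq0.
Qed.

Lemma carat_quadratic (f : C -> C) (z l : C) (M d : R) : 0 < d ->
  (forall u, nm u <= d -> nm (f (z + u) - f z - l * u) <= M * nm u ^+ 2) ->
  carat f z l.
Proof.
move=> d0 H; apply: carat_little_o => e e0.
exists (Num.min d (e / (`|M| + 1))).
  by rewrite lt_min d0 divr_gt0 // ltr_wpDl.
move=> u; rewrite lt_min => /andP[ud ue]; apply: le_trans (H _ (ltW ud)) _.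
rewrite expr2 mulrA ler_wpM2r ?nm_ge0 //.
apply: (@le_trans _ _ ((`|M| + 1) * nm u)).
  rewrite ler_wpM2r ?nm_ge0 //; apply: le_trans (ler_norm _) _.
  by rewrite lerDl.
by rewrite mulrC -ler_pdivlMr ?ltW // ltr_wpDl.
Qed.

Lemma real_little_o (f : R -> R) (x l : R) : is_derive x 1 f l ->
  forall e : R, 0 < e -> exists2 d : R, 0 < d &
    forall u, `|u| < d -> `|f (u + x) - f x - l * u| <= e * `|u|.
Proof.
move=> [df <-] e e0.
have c : (fun h : R => h^-1 *: (f (h *: 1 + x) - f x)) @ 0^' --> 'D_1 f x by exact: df.
have near_e : \forall h \near nbhs (0 : R), h != 0 ->
    `|'D_1 f x - h^-1 *: (f (h *: 1 + x) - f x)| <= e.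
  by have /cvgrPdist_le /(_ e e0) := c.
have /nbhs_ballP [d /= d0 Hd] := near_e.
exists d => // u ud.
case: (eqVneq u 0) => [->|u0]; first by rewrite add0r subrr mulr0 subr0 !normr0 mulr0.
have := Hd u; rewrite /ball /= sub0r normrN => /(_ ud u0).
rewrite [_ *: 1]mulr1 -(ler_pM2r (x := `|u|)) ?normr_gt0 // -normrM.
by rewrite mulrBl -normrN opprB mulrAC mulVf // mul1r.
Qed.

(** Put together from the real derivatives of exp, cos and sin at 0, by
    Re = (E - 1 - a) + E (cos b - 1) and Im = E (sin b - b) + (E - 1) b, where
    E = exp a. *)
Lemma carat_cexp0 : carat (@cexp R) 0 1.
Proof.
apply: carat_little_o => e e0.
(* The two parts are at most 4 e' |u| and 5 e' |u|, and 9/16 < 1. *)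
have [e' [e'0 e'16 e'1]] : exists e', [/\ 0 < e', e' <= e / 16 & e' <= 1].
  exists (Num.min (e / 16) 1); split; last by rewrite ge_min lexx orbT.
    by rewrite lt_min ltr01 divr_gt0.
  by rewrite ge_min lexx.
have [d1 d10 H1] := real_little_o _ _ _ (is_derive_expR 0) _ e'0.
have [d2 d20 H2] := real_little_o _ _ _ (is_derive_cos 0) _ e'0.
have [d3 d30 H3] := real_little_o _ _ _ (is_derive_sin 0) _ e'0.
exists (Num.min (Num.min d1 d2) (Num.min d3 e')); first by rewrite !lt_min d10 d20 d30 e'0.
move=> [a b]; rewrite !lt_min => /andP[/andP[ud1 ud2] /andP[ud3 ue']].
set u : C := (a +i* b)%C in ud1 ud2 ud3 ue' *.
have ua : `|a| <= nm u := Re_le_nm u.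
have ub : `|b| <= nm u := Im_le_nm u.
have := H1 a (le_lt_trans ua ud1); rewrite addr0 expR0 mul1r => h1.
have := H2 b (le_lt_trans ub ud2); rewrite addr0 cos0 sin0 oppr0 mul0r subr0 => h2.
have := H3 b (le_lt_trans ub ud3); rewrite addr0 sin0 cos0 mul1r subr0 => h3.
rewrite add0r cexp0 mul1r; apply: le_trans (nm_le_ReIm _) _.
have -> : cexp u - 1 - u = ((expR a * cos b - 1 - a) +i* (expR a * sin b - b))%C.
  by apply/eqP; rewrite eq_complex /= !(mul0r, subr0, addr0) !eqxx.
rewrite [complex.Re _]/= [complex.Im _]/=.
move: h1 h2 h3; set E := expR a; set c := cos b; set s := sin b => h1 h2 h3.
have N0 := nm_ge0 u; move: (nm u) ua ub ue' N0 => N ua ub ue' N0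
  {ud1 ud2 ud3 H1 H2 H3 d1 d2 d3 d10 d20 d30}.
have aN : `|E - 1 - a| <= e' * N by apply: le_trans h1 _; rewrite ler_wpM2l // ltW.
have bN : `|c - 1| <= e' * N by apply: le_trans h2 _; rewrite ler_wpM2l // ltW.
have cN : `|s - b| <= e' * N by apply: le_trans h3 _; rewrite ler_wpM2l // ltW.
have E1 : `|E - 1| <= 2 * N.
  have -> : E - 1 = (E - 1 - a) + a by ring.
  apply: le_trans (ler_normD _ _) _.
  have : e' * N <= N by rewrite ler_piMl.
  by lra.
have E3 : `|E| <= 3.
  have -> : E = (E - 1) + 1 by ring.
  apply: le_trans (ler_normD _ _) _; rewrite normr1; lra.
have r1 : `|E * c - 1 - a| <= 4 * (e' * N).
  have -> : E * c - 1 - a = (E - 1 - a) + E * (c - 1) by ring.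
  apply: le_trans (ler_normD _ _) _; rewrite normrM.
  have : `|E| * `|c - 1| <= 3 * (e' * N) by apply: ler_pM.
  by lra.
have r2 : `|E * s - b| <= 5 * (e' * N).
  have -> : E * s - b = E * (s - b) + (E - 1) * b by ring.
  apply: le_trans (ler_normD _ _) _; rewrite !normrM.
  have : `|E| * `|s - b| <= 3 * (e' * N) by apply: ler_pM.
  have : `|E - 1| * `|b| <= 2 * N * e' by apply: ler_pM => //; lra.
  by lra.
have : e' * N <= e / 16 * N by rewrite ler_wpM2r.
have : 0 <= e * N by rewrite mulr_ge0 // ltW.
lra.
Qed.

Lemma carat_cexp (x : C) : carat (@cexp R) x (cexp x).
Proof.
have c1 : carat (fun w => cexp x * cexp (w - x)) x (cexp x * 1).
  exact: caratMl _ (carat_shift x carat_cexp0).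
rewrite (mulr1 (cexp x)) in c1; apply: carat_near c1.
apply: (@filterE _ (nbhs x) (nbhs_filter x)) => w.
by rewrite -cexpD addrC subrK.
Qed.

Lemma carat_linear (k z : C) : carat (fun w => k * w) z k.
Proof. by have := caratMl k (carat_id z); rewrite mulr1. Qed.

Lemma carat_qpow (x tau : C) : carat (fun t => qpow t x) tau (twopii R * x * qpow tau x).
Proof.
have E t : cexp (twopii R * x * t) = qpow t x by rewrite /qpow /logq mulrAC.
have := @carat_comp C (@cexp R) (fun t => twopii R * x * t) tau _ _
  (carat_cexp (twopii R * x * tau)) (carat_linear (twopii R * x) tau).
rewrite E [qpow tau x * _]mulrC; apply: carat_near.
by apply: (@filterE _ (nbhs tau) (nbhs_filter tau)) => t; rewrite /= E.
Qed.

Lemma carat_logqX n tau : carat (fun t : C => logq t ^+ n) tau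
  (n%:R * logq tau ^+ n.-1 * twopii R).
Proof. exact: caratX (carat_linear (twopii R) tau). Qed.

End ComplexDerivatives.

(** * Closed forms of the graded pseudo-traces *)

Section QSeries.
Context {R : realType}.
Local Notation C := (Cplx R).
Implicit Types (tau x y : C).

Lemma qpowD tau x y : qpow tau (x + y) = qpow tau x * qpow tau y.
Proof. by rewrite /qpow mulrDr cexpD. Qed.

Lemma qpow0 tau : qpow tau 0 = 1.
Proof. by rewrite /qpow mulr0 cexp0. Qed.

Lemma qpow_neq0 tau x : qpow tau x != 0.
Proof. exact: cexp_neq0. Qed.

Lemma qpow_nat tau l : qpow tau l%:R = qpow tau 1 ^+ l.
Proof.
elim: l => [|l IH]; first by rewrite qpow0.
by rewrite -natr1 qpowD IH exprSr.
Qed.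

Lemma nm_cexp (z : C) : nm (cexp z) = expR (complex.Re z).
Proof.
rewrite /cexp nmM nm_real ger0_norm ?expR_ge0 //.
by rewrite /nm normc_def /= cos2Dsin2 sqrtr1 mulr1.
Qed.

Lemma nm_qpow1 tau : 0 < complex.Im tau -> nm (qpow tau 1) < 1.
Proof.
move=> t0; rewrite nm_cexp expR_lt1 mulr1 /logq /twopii.
case: tau t0 => a b /= b0.
rewrite !(mul0r, mulr0, mul1r, mulr1, subr0, sub0r, addr0, add0r, oppr0).
by rewrite oppr_lt0 mulr_gt0 // mulr_gt0 // pi_gt0.
Qed.

Definition pgen (z : C) : C := psum pcoef z.
Definition pgen' (z : C) : C := dsum pcoef z.

Lemma pgen_cvg z : nm z < 1 -> series (pterm pcoef z) @ \oo --> pgen z.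
Proof. move=> z1; exact: (pterm_cvg _ pcoef_ge0 pcoef_cvg _ z1). Qed.

Lemma pgen'_cvg z : nm z < 1 -> series (dterm pcoef z) @ \oo --> pgen' z.
Proof. move=> z1; exact: (dterm_cvg _ pcoef_ge0 pcoef_cvg _ z1). Qed.

Lemma carat_pgen z : nm z < 1 -> carat pgen z (pgen' z).
Proof.
move=> z1; have [M [d [d0 H]]] := psum_quadratic _ pcoef_ge0 pcoef_cvg _ z1.
exact: carat_quadratic d0 H.
Qed.

Lemma ptermE (tau : C) l : pterm pcoef (qpow tau 1) l = (npart l)%:R * qpow tau l%:R.
Proof. by rewrite /pterm /pcoef rmorph_nat qpow_nat. Qed.

Lemma dtermE (tau : C) l : qpow tau 1 * dterm pcoef (qpow tau 1) l =
  l%:R * ((npart l)%:R * qpow tau l%:R).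
Proof.
rewrite /dterm /pcoef rmorph_nat qpow_nat.
by case: l => [|l]; rewrite ?exprS /=; ring.
Qed.

Lemma lin_series_cvg (tau a b : C) : nm (qpow tau 1) < 1 ->
  series (fun l => (a * l%:R + b) * ((npart l)%:R * qpow tau l%:R)) @ \oo -->
  a * (qpow tau 1 * pgen' (qpow tau 1)) + b * pgen (qpow tau 1).
Proof.
move=> q1; have c1 := cvg_seriesMl (a * qpow tau 1) _ _ (pgen'_cvg _ q1).
have c2 := cvg_seriesMl b _ _ (pgen_cvg _ q1).
rewrite [a * (_ * _)]mulrA; apply: lim_near (lim_add c1 c2) _.
near=> n; rewrite /series /= -big_split /=; apply: eq_bigr => l _.
by rewrite -mulrA dtermE ptermE; ring.
Unshelve. all: by end_near. Qed.

(** Euler's identity: 1/eta = q^(-1/24) sum_l p(l) q^l. *)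
Lemma eta_inv (tau : C) : nm (qpow tau 1) < 1 ->
  (eta tau)^-1 = (qpow tau (1 / 24))^-1 * pgen (qpow tau 1).
Proof.
move=> q1; have [P0 cP] := euler_product _ q1.
rewrite /eta invfM; congr (_ * _); rewrite -[RHS]invrK; congr (_^-1).
have -> : (fun n => \prod_(1 <= j < n.+1) (1 - qpow tau j%:R)) =
    (fun n => \prod_(1 <= j < n.+1) (1 - qpow tau 1 ^+ j)).
  by apply/funext => n; apply: eq_bigr => j _; rewrite qpow_nat.
exact: cvg_lim cP.
Qed.

End QSeries.

Section Factors.
Context {R : realType}.
Local Notation C := (Cplx R).
Implicit Types (h tau : C) (k : nat).

Definition leading_log k tau : C := (k - 1)`!%:R^-1 * logq tau ^+ (k - 1).
Definition lower_log k tau : C := (k - 2)`!%:R^-1 * logq tau ^+ (k - 2).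

Definition u1_term h k tau (l : nat) : C := (npart l)%:R * qpow tau l%:R *
  ((l%:R + h) / (k - 1)`!%:R * logq tau ^+ (k - 1)
   + ((k - 2)`!%:R)^-1 * logq tau ^+ (k - 2)).

(** The sum of u1_term for |q| < 1, split according to whether p(l) q^l carries the
    factor l. *)
Definition omega_sum h k tau : C :=
  leading_log k tau * (qpow tau 1 * pgen' (qpow tau 1)) +
  (leading_log k tau * h + lower_log k tau) * pgen (qpow tau 1).

(** q^(c/24) times the pseudo-trace of the vacuum, for Im t > 0. *)
Definition closed_form h k t : C := leading_log k t * qpow t h * pgen (qpow t 1).

End Factors.

Section ClosedForms.
Context {R : realType} {c h : Cplx R} {k : nat}.
Local Notation C := (Cplx R).
Hypotheses (k2 : (2 <= k)%N) (irr : Verma_eq_Lirr c h).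
Variables (YV : Vvir c -> int -> Vvir c -> Vvir c).
Variable (Y : Vvir c -> int -> W c h k -> W c h k).
Hypothesis hY : is_Vvir_module YV Y.
Implicit Types tau : C.

Lemma weight_factor tau l : qpow tau (h + l%:R - c / 24) =
  qpow tau (h - c / 24) * qpow tau l%:R.
Proof. by rewrite addrAC [LHS]qpowD. Qed.

Lemma pstr_vacuum_cvg tau : nm (qpow tau 1) < 1 ->
  series (pstr_term Y (vacuum c) tau) @ \oo -->
  qpow tau (h - c / 24) * leading_log k tau * pgen (qpow tau 1).
Proof.
move=> q1.
have := cvg_seriesMl (qpow tau (h - c / 24) * leading_log k tau) _ _ (pgen_cvg _ q1).
have -> : (fun n => qpow tau (h - c / 24) * leading_log k tau * pterm pcoef (qpow tau 1) n) =
    pstr_term Y (vacuum c) tau; last by [].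
apply/funext => l; rewrite (pstr_term_vacuum k2 irr _ _ hY) weight_factor ptermE.
by rewrite /leading_log; ring.
Qed.

Lemma Zterm_cvg tau : nm (qpow tau 1) < 1 ->
  series (Zterm c h tau) @ \oo --> qpow tau h * pgen (qpow tau 1).
Proof.
move=> q1; have := cvg_seriesMl (qpow tau h) _ _ (pgen_cvg _ q1).
have -> : (fun n => qpow tau h * pterm pcoef (qpow tau 1) n) = Zterm c h tau; last by [].
by apply/funext => l; rewrite /Zterm Kdim_Mdeg qpowD ptermE; ring.
Qed.

Lemma factorial_step : (k - 1)%:R / (k - 1)`!%:R = (k - 2)`!%:R^-1 :> C.
Proof.
have -> : (k - 1 = (k - 2).+1)%N by lia.
by rewrite factS natrM invfM mulrA divff ?mul1r // pnatr_eq0.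
Qed.

Lemma u1_cvg tau : nm (qpow tau 1) < 1 -> series (u1_term h k tau) @ \oo --> omega_sum h k tau.
Proof.
move=> q1.
have := lin_series_cvg tau (leading_log k tau)
  (leading_log k tau * h + lower_log k tau) q1.
set f := (fun l => _ * _); have -> : f = u1_term h k tau; last by [].
by apply/funext => l; rewrite /f /u1_term /leading_log /lower_log; ring.
Qed.

Lemma pstr_omega_cvg tau : nm (qpow tau 1) < 1 ->
  series (pstr_term Y (omega c) tau) @ \oo --> qpow tau (h - c / 24) * omega_sum h k tau.
Proof.
move=> q1; have := cvg_seriesMl (qpow tau (h - c / 24)) _ _ (u1_cvg _ q1).
set f := (fun l => _ * _); have -> : f = pstr_term Y (omega c) tau; last by [].
apply/funext => l; rewrite (pstr_term_omega k2 irr _ _ hY) weight_factor /f /u1_term.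
by ring.
Qed.

Lemma u2_cvg tau : nm (qpow tau 1) < 1 ->
  series (fun l : nat => (l%:R + h) * (npart l)%:R * qpow tau l%:R) @ \oo -->
  qpow tau 1 * pgen' (qpow tau 1) + h * pgen (qpow tau 1).
Proof.
move=> q1; have := lin_series_cvg tau 1 h q1; rewrite mul1r.
set f := (fun l => _ * _); set g := (fun l : nat => _ * qpow tau l%:R).
have -> : f = g; last by [].
by apply/funext => l; rewrite /f /g; ring.
Qed.

Lemma near_upper tau : 0 < complex.Im tau -> \forall t \near tau, 0 < complex.Im t.
Proof. by move=> t0; exact: (cvgr_gt _ (@continuous_Im R tau) 0 t0). Qed.

(** This is the logarithmic derivative property: differentiating (log q)^(k-1)
    produces the terms with (log q)^(k-2), and differentiating q^(l+h) the weights
    l + h. *)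
Lemma carat_closed_form tau : nm (qpow tau 1) < 1 ->
  carat (closed_form h k) tau (twopii R * qpow tau h * omega_sum h k tau).
Proof.
move=> q1.
have c1 := caratMl (k - 1)`!%:R^-1 (carat_logqX (k - 1) tau).
have c2 := caratM c1 (carat_qpow h tau).
have c3 := @carat_comp C pgen (fun t => qpow t 1) tau _ _ (carat_pgen _ q1) (carat_qpow 1 tau).
have := caratM c2 c3; rewrite /closed_form /=.
set d := (X in carat _ _ X); suff -> : d = twopii R * qpow tau h * omega_sum h k tau by [].
rewrite /d /omega_sum /leading_log /lower_log -factorial_step.
have -> : (k - 1).-1 = (k - 2)%N by lia.
by ring.
Qed.

End ClosedForms.

Theorem theorem8p1 (R : realType) (c h : Cplx R) (k : nat) (hk : (2 <= k)%N)
    (hirr : Verma_eq_Lirr c h)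
    (YV : Vvir c -> int -> Vvir c -> Vvir c) (hYV : is_Vvir_voa YV)
    (Y : Vvir c -> int -> W c h k -> W c h k) (hY : is_Vvir_module YV Y)
    (tau : Cplx R) (htau : 0 < complex.Im tau) :
  let p : nat -> Cplx R := fun l => (npart l)%:R in
  let pstr1 : Cplx R -> Cplx R := pstr Y (vacuum c) in
  let pstrw : Cplx R -> Cplx R := pstr Y (omega c) in
  let F : Cplx R -> Cplx R := fun t => qpow t (c / 24) * pstr1 t in
  [/\ [/\ cvgn (series (pstr_term Y (vacuum c) tau)),
          cvgn (series (Zterm c h tau)),
          pstr1 tau = qpow tau ((1 - c) / 24 + h) * ((k - 1)`!%:R)^-1
                      * logq tau ^+ (k - 1) * (eta tau)^-1
        & pstr1 tau = ((k - 1)`!%:R)^-1 * logq tau ^+ (k - 1) * ZM c h tau],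
      derivable F tau 1 /\
      pstrw tau = qpow tau (- (c / 24)) * ((twopii R)^-1 * derive1 F tau),
      (forall t, tau_branch tau t ->
         derivable (F \o t) (qpow tau 1) 1 /\
         pstrw tau = qpow tau (- (c / 24))
                     * (qpow tau 1 * derive1 (F \o t) (qpow tau 1)))
    & let u1 := fun l : nat => p l * qpow tau l%:R *
          ((l%:R + h) / (k - 1)`!%:R * logq tau ^+ (k - 1)
           + ((k - 2)`!%:R)^-1 * logq tau ^+ (k - 2)) in
      let u2 := fun l : nat => (l%:R + h) * p l * qpow tau l%:R in
      [/\ cvgn (series (pstr_term Y (omega c) tau)),
          cvgn (series u1), cvgn (series u2),
          pstrw tau = qpow tau (h - c / 24) * tsum u1
        & pstrw tau = qpow tau (h - c / 24) * ((k - 2)`!%:R)^-1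
             * logq tau ^+ (k - 2)
             * (logq tau / (k - 1)%:R * tsum u2
                + qpow tau (1 / 24) * (eta tau)^-1)]].
Proof.
move=> p pstr1 pstrw F.
have q1 := nm_qpow1 _ htau.
have cv := pstr_vacuum_cvg hk hirr _ _ hY _ q1.
have cz := @Zterm_cvg R c h _ q1.
have co := pstr_omega_cvg hk hirr _ _ hY _ q1.
have cu1 := @u1_cvg R h k _ q1.
have cu2 := @u2_cvg R h _ q1.
have v t : nm (qpow t 1) < 1 ->
    pstr1 t = qpow t (h - c / 24) * leading_log k t * pgen (qpow t 1).
  move=> t1; have ct := pstr_vacuum_cvg hk hirr _ _ hY _ t1.
  by rewrite /pstr1 /pstr /tsum (cvg_lim _ ct).
have v1 := v tau q1.
have vz : ZM c h tau = qpow tau (- (c / 24)) * (qpow tau h * pgen (qpow tau 1)).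
  by rewrite /ZM /tsum (cvg_lim _ cz).
have vw : pstrw tau = qpow tau (h - c / 24) * omega_sum h k tau.
  by rewrite /pstrw /pstr /tsum (cvg_lim _ co).
have ve := eta_inv _ q1.
have qn := qpow_neq0 tau (1 / 24).
have kf2 : (k - 2)`!%:R != 0 :> Cplx R by rewrite pnatr_eq0 -lt0n fact_gt0.
have kf : (k - 1)`!%:R != 0 :> Cplx R by rewrite pnatr_eq0 -lt0n fact_gt0.
(* F and closed_form agree on the upper half-plane, a neighbourhood of tau. *)
have carF : carat F tau (twopii R * qpow tau h * omega_sum h k tau).
  apply: carat_near (@carat_closed_form R h k hk tau q1).
  have := near_upper _ htau; apply: (@filterS _ (nbhs tau) (nbhs_filter tau)) => t t0.
  have -> : F t = qpow t (c / 24) * pstr1 t by [].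
  rewrite (v t (nm_qpow1 _ t0)).
  have E : qpow t h = qpow t (c / 24) * qpow t (h - c / 24).
    by rewrite -qpowD addrC subrK.
  by rewrite /closed_form E; ring.
have [dF dFE] := carat_derive1 carF.
have t0 := twopii_neq0 R.
split.
- split.
  + by apply/cvg_ex; eexists; exact: cv.
  + by apply/cvg_ex; eexists; exact: cz.
  + rewrite v1 ve (_ : (1 - c) / 24 + h = (h - c / 24) + 1 / 24); last by ring.
    by rewrite [qpow tau (h - c / 24 + _)]qpowD /leading_log; field; rewrite qn kf.
  + by rewrite v1 vz qpowD /leading_log; ring.
- split=> //; rewrite dFE vw qpowD; by field.
- move=> t [tq ct gt].
  (* The branch of (log q)/(2 pi i) has derivative 1/(2 pi i q) at q0. *)
  have ci : carat t (qpow tau 1) (twopii R * 1 * qpow tau 1)^-1.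
    have := carat_qpow 1 (t (qpow tau 1)); rewrite {2}tq => cg.
    apply: (@carat_inverse _ (fun s => qpow s 1) t (qpow tau 1) _ cg _ ct gt).
    by rewrite mulr1 mulf_neq0 // qpow_neq0.
  have cF : carat F (t (qpow tau 1)) (twopii R * qpow tau h * omega_sum h k tau).
    by rewrite tq.
  have [d E] := carat_derive1 (carat_comp cF ci).
  split=> //; rewrite E vw qpowD; field.
  by rewrite t0 qpow_neq0.
- split.
  + by apply/cvg_ex; eexists; exact: co.
  + by apply/cvg_ex; eexists; exact: cu1.
  + by apply/cvg_ex; eexists; exact: cu2.
  + by rewrite vw /tsum (cvg_lim _ cu1).
  + rewrite vw /tsum (cvg_lim _ cu2) // ve /omega_sum /leading_log /lower_log.
    rewrite (_ : (k - 1 = (k - 2).+1)%N); last by move: hk; lia.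
    rewrite factS natrM exprS; field.
    by rewrite qn kf2 [1 + _]addrC natr1 pnatr_eq0.
Qed.
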